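(* Let $A,B\in(1,\infty)$, and let $X,Y$ be marked complete finite-area hyperbolic once-punctured tori. If $\mathcal F_A(X)\cap\mathcal F_B(Y)$ is dense in $\mathcal I=\mathbb P^1(\mathbb R)\setminus\mathbb P^1(\mathbb Q)$, then $A=B$, $\|\cdot\|_X=\|\cdot\|_Y$, and $X=Y$ as marked hyperbolic tori. In particular, for every fixed $A\in(1,\infty)$, the level set $\mathcal F_A(X)$ determines the marked torus $X$.
   Context: A marked torus is a complete finite-area hyperbolic once-punctured torus together with a marking by a fixed oriented topological once-punctured torus $S$ with a fixed integral basis of $H_1(S;\mathbb Z)$; this gives identifications $H_1(X;\mathbb Z)\cong\mathbb Z^2\cong H_1(Y;\mathbb Z)$ and of real homology with $\mathbb R^2$. ''$X=Y$ as marked hyperbolic tori'' means they are the same point of the Teichmüller space of $S$. Unoriented essential simple closed curves up to free homotopy correspond to primitive $w\in\mathbb Z^2$ modulo sign; $\gamma_w$ is the corresponding closed geodesic on $X$. The McShane--Rivin norm $\|\cdot\|_X$ is the (unique) norm on $\mathbb R^2$ with $\|w\|_X=\ell_X(\gamma_w)$ for every primitive $w\in\mathbb Z^2$ (existence is a known theorem); its unit ball $B_X$ is compact, centrally symmetric and strictly convex. It is known that $\partial B_X$ has a unique supporting line at each of the two antipodal points of $\beta\cap\partial B_X$, for every irrational direction $\beta\in\mathcal I$ (directions are lines through $0$ in $\mathbb R^2$). Graph-flatness order: for $p\in\partial B_X$ with a unique supporting line, choose Euclidean coordinates centered at $p$ in which this line is $y=0$ and $B_X$ lies locally in $y\ge0$,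 and write the boundary near $p$ as $y=f(x)$, $f(0)=0$. For $N>0$, $\partial B_X$ is flat to order at least $N$ at $p$ if there is $\delta>0$ with $f(x)\le|x|^N$ whenever $|x|<\delta$; $\mathfrak f_X(p)\in(0,\infty]$ is the supremum of all such $N$. For $\beta\in\mathcal I$, $\mathfrak f_X(\beta)=\mathfrak f_X(p)$ for either $p\in\beta\cap\partial B_X$. Finally $\mathcal F_A(X)=\{\beta\in\mathcal I:\mathfrak f_X(\beta)=A\}$, and similarly for $Y$. *)

(* Defs.v *)
From HB Require Import structures.
From mathcomp Require Import all_boot all_order all_algebra.
From mathcomp Require Import all_classical all_reals all_analysis.
From mathcomp Require Import complex.
Set Implicit Arguments.
Unset Strict Implicit.
Unset Printing Implicit Defensive.
Import Order.TTheory GRing.Theory Num.Theory.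
Import numFieldNormedType.Exports.
Local Open Scope classical_set_scope.
Local Open Scope ring_scope.
Local Open Scope complex_scope.

(* The fundamental group of S, free on the loops a and b.  The letter (g, e)
   is a (g = false) or b (g = true), inverted when e = true.  The classes of
   a and b form the fixed basis of H_1(S; Z), which is positively oriented:
   the algebraic intersection number of a with b is +1. *)
Definition letter := (bool * bool)%type.
Definition word := seq letter.

Definition la : letter := (false, false).
Definition lb : letter := (true, false).
Definition linv (l : letter) : letter := (l.1, ~~ l.2).
Definition winv (u : word) : word := rev (map linv u).

Definition reduced (u : word) : bool := sorted (fun l m => m != linv l) u.

Definition reduce (u : word) : word :=
  foldr (fun l s => if s is m :: s' then if m == linv l then s' else l :: s
                    else [:: l]) [::] u.

Definition subst_letter (u v : word) (l : letter) : word :=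
  let w := if l.1 then v else u in if l.2 then winv w else w.
(* the image of w under the endomorphism a |-> u, b |-> v *)
Definition subst (u v w : word) : word := flatten (map (subst_letter u v) w).

(* u and v generate the free group; as free groups of finite rank are
   Hopfian, (u, v) is then a free basis. *)
Definition generating_pair (u v : word) : Prop :=
  exists s t : word,
    reduce (subst u v s) = [:: la] /\ reduce (subst u v t) = [:: lb].

(* The essential (non-peripheral) simple closed curves of S are the images of
   a under the self-homeomorphisms of S, and these induce all the outer
   automorphisms of the free group (Nielsen).  The words representing such
   curves are hence the elements of free bases. *)
Definition simple_curve (u : word) : Prop := exists v, generating_pair u v.

Definition homology (u : word) : 'rV[int]_2 :=
  \row_j \sum_(l <- u | l.1 == (j == 1)) (-1) ^+ l.2.

Definition primitive (w : 'rV[int]_2) : bool := coprimez (w 0 0) (w 0 1).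

(* The path around the puncture that keeps it on its left: the boundary of the
   square spanned by a and b, run counterclockwise, the puncture being at the
   centre of the square. *)
Definition peripheral : word := [:: la; lb; linv la; linv lb].

Section Hyperbolic.
Variable R : realType.

Definition upper_half : set R[i] := [set z | 0 < complex.Im z].

Definition arcosh (x : R) : R := ln (x + Num.sqrt (x ^+ 2 - 1)).

Definition hdist (z w : R[i]) : R :=
  arcosh (1 + ((complex.Re z - complex.Re w) ^+ 2
               + (complex.Im z - complex.Im w) ^+ 2)
              / (2 * complex.Im z * complex.Im w)).

Definition mobius (M : 'M[R]_2) (z : R[i]) : R[i] :=
  ((M 0 0)%:C * z + (M 0 1)%:C) / ((M 1 0)%:C * z + (M 1 1)%:C).

Definition letter_mx (A B : 'M[R]_2) (l : letter) : 'M[R]_2 :=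
  let M := if l.1 then B else A in if l.2 then M^-1 else M.
Definition word_mx (A B : 'M[R]_2) (u : word) : 'M[R]_2 :=
  \prod_(l <- u) letter_mx A B l.

(* Equality in PSL_2(R) of elements of SL_2(R). *)
Definition psl_eq (M N : 'M[R]_2) : Prop := M = N \/ M = - N.

Definition psl_conj (M N : 'M[R]_2) : Prop :=
  exists2 g : 'M[R]_2, \det g = 1 & psl_eq (g * M * g^-1) N.

Definition unit_translation : 'M[R]_2 :=
  \matrix_(i, j) ((i <= j)%N)%:R.

(* A point of the Teichmueller space of S, given by its holonomy, that is, by
   lifts to SL_2(R) of the images of a and b under a representation of the
   fundamental group of S into PSL_2(R), the group of orientation-preserving
   isometries of the hyperbolic plane H.
   - mt_covering: the group acts on H by a covering action (free and properly
     discontinuous), so that the quotient is a complete hyperbolic surface and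
     the representation identifies its fundamental group with that of S.
   - mt_cusp: the loop around the puncture of S becomes a loop around a cusp,
     with the cusp on the same (left) side.  So the quotient is a punctured
     torus of finite area, and the identification of fundamental groups is
     induced by an orientation-preserving homeomorphism from S.  Without it
     the quotient could be a pair of pants or have infinite area. *)
Record marked_torus := MarkedTorus {
  mt_a : 'M[R]_2;
  mt_b : 'M[R]_2;
  mt_det_a : \det mt_a = 1;
  mt_det_b : \det mt_b = 1;
  mt_covering : forall z, upper_half z ->
    exists2 r : R, 0 < r & forall u, reduced u -> u != [::] ->
      r <= hdist z (mobius (word_mx mt_a mt_b u) z);
  mt_cusp : psl_conj (word_mx mt_a mt_b peripheral) unit_translation
}.

Definition holonomy (X : marked_torus) (u : word) : 'M[R]_2 :=
  word_mx (mt_a X) (mt_b X) u.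

(* Equality in Teichmueller space: there is an orientation-preserving isometry
   compatible with the markings up to homotopy, that is, the holonomies are
   conjugate in PSL_2(R). *)
Definition teich_eq (X Y : marked_torus) : Prop :=
  exists2 g : 'M[R]_2, \det g = 1 &
    psl_eq (g * mt_a X * g^-1) (mt_a Y) /\ psl_eq (g * mt_b X * g^-1) (mt_b Y).

(* The length of the closed geodesic of X freely homotopic to u is the
   translation length of its holonomy. *)
Definition geodesic_length (X : marked_torus) (u : word) : R :=
  inf [set hdist z (mobius (holonomy X u) z) | z in upper_half].

Definition is_norm (n : 'rV[R]_2 -> R) : Prop :=
  [/\ forall v, 0 <= n v,
      forall v, n v = 0 -> v = 0,
      forall t v, n (t *: v) = `|t| * n v
    & forall u v, n (u + v) <= n u + n v].

(* For each primitive w the simple closed curves in the class w are all freely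
   homotopic, so gamma_w is represented by any such u. *)
Definition is_mcshane_rivin_norm (X : marked_torus) (n : 'rV[R]_2 -> R) :=
  is_norm n /\
  forall (w : 'rV[int]_2) (u : word), primitive w ->
    simple_curve u -> homology u = w ->
    n (map_mx intr w) = geodesic_length X u.

End Hyperbolic.

Section Flatness.
Variable R : realType.
Implicit Types (n : 'rV[R]_2 -> R) (p nu : 'rV[R]_2).

Definition dot (u v : 'rV[R]_2) : R := (u *m v^T) 0 0.

(* nu is a Euclidean unit inward normal of a supporting line at p of the unit
   ball of n; supporting lines at p correspond to such vectors. *)
Definition supporting_normal n p nu : Prop :=
  dot nu nu = 1 /\ forall q, n q <= 1 -> 0 <= dot (q - p) nu.

(* the unit vector such that (tangent nu, nu) is a direct orthonormal frame *)
Definition tangent nu : 'rV[R]_2 :=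
  \row_j (if j == 0 then nu 0 1 else - nu 0 0).

(* y = f x is the unit sphere of n near p, in the coordinates (x, y) with
   origin p and frame (tangent nu, nu).  This determines f near 0. *)
Definition boundary_graph n p nu (f : R -> R) : Prop :=
  exists2 r : R, 0 < r & forall x y : R, `|x| < r -> `|y| < r ->
    (n (p + x *: tangent nu + y *: nu) = 1 <-> y = f x).

Definition flat_to_order n p (N : R) : Prop :=
  exists nu, [/\ supporting_normal n p nu,
    forall nu', supporting_normal n p nu' -> nu' = nu
  & exists f, [/\ boundary_graph n p nu f, f 0 = 0 &
      exists2 delta : R, 0 < delta &
        forall x, `|x| < delta -> f x <= `|x| `^ N]].

Definition flatness n p : \bar R :=
  ereal_sup [set N%:E | N in [set N : R | 0 < N /\ flat_to_order n p N]].

(* Points of P^1(R) are lines through 0, as sets of vectors. *)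
Definition line (v : 'rV[R]_2) : set 'rV[R]_2 := [set t *: v | t in [set: R]].

Definition P1 : set (set 'rV[R]_2) := [set line v | v in [set v | v != 0]].

Definition P1Q : set (set 'rV[R]_2) :=
  [set line (map_mx ratr q) | q in [set q : 'rV[rat]_2 | q != 0]].

Definition irrationals : set (set 'rV[R]_2) := P1 `\` P1Q.

(* The quotient topology of P^1(R). *)
Definition P1_open (U : set (set 'rV[R]_2)) : Prop :=
  U `<=` P1 /\ open [set v : 'rV[R]_2 | v != 0 /\ U (line v)].

Definition dense_in_irrationals (D : set (set 'rV[R]_2)) : Prop :=
  forall U, P1_open U -> U `&` irrationals !=set0 -> U `&` D !=set0.

(* F_A: a line beta meets the unit sphere in two antipodal points p. *)
Definition level_set n (A : R) : set (set 'rV[R]_2) :=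
  [set beta | irrationals beta /\
              forall p, beta p -> n p = 1 -> flatness n p = A%:E].

End Flatness.

(* Main.v *)
(* At a rational point w of the unit sphere of the McShane-Rivin norm the Markov
   equation of the traces gives a corner of exterior angle comparable to
   exp(- n(w)), while the sphere is exponentially close to its chords between
   Farey neighbours.  So the flatness A at an irrational direction p only
   depends on how well p is approximated: A - 1 is the supremum of the M such
   that exp(- n(w)) is O(|det(p, w)|^M) for w integral primitive.  Comparing two
   norms along the best approximations of p gives
   n_X(p) (B - 1) = n_Y(p) (A - 1) if p has flatness A for X and B for Y.  By
   density n_X = c n_Y.  As the exterior angle at w is 4 ln coth(n(w) / 2), which
   is not homogeneous in n, this forces c = 1.  Then X and Y have the same
   traces, and these determine the holonomy up to conjugacy once the commutator
   has been normalized to minus the unit translation; that normalization also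
   fixes the orientation.  Directions of flatness A are dense since a continued
   fraction may be continued with partial quotients close to
   exp(n(w_k) / (A - 1)). *)
Require Import Defs.
From mathcomp Require Import all_boot all_order all_algebra.
From mathcomp Require Import all_classical all_reals all_analysis.
From mathcomp Require Import complex ring lra zify.
Import Order.TTheory GRing.Theory Num.Theory.
Import numFieldNormedType.Exports.
Local Open Scope classical_set_scope.
Local Open Scope ring_scope.
Set Implicit Arguments.
Unset Strict Implicit.
Unset Printing Implicit Defensive.

(** * The free group and Nielsen pairs *)

(** The corner is read off from the traces along v + j u, with u, v Farey neighbours: they equal A
    lam^j + B lam^(-j) for lam = exp(n(u) / 2). Hence n(v + j u) - j n(u) tends to 2 ln A, and
    convexity turns this limit into a supporting form on the half-plane of u containing v; - v gives
    the other side, with B. The Markov equation makes A B depend on u only, and 2 ln(A B) measures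
    the corner. Flatness is defined by a Euclidean graph, while these estimates live on rays through
    0. The height of the sphere over the supporting line, measured along rays, mediates. The change
    of coordinates and a factor n(w) in the upper bound cost an arbitrarily small part of the
    exponent, which a supremum does not see. The rational point that controls the height on a given
    ray is a mediant in the Stern-Brocot tree, and the chord estimate uses two Farey pairs
    containing it. Curves enter as words obtained from (a, b) by Nielsen moves, so that integer
    vectors carry a certificate [good]. *)

Definition push (l : letter) (s : word) : word :=
  if s is m :: s' then if m == linv l then s' else l :: s else [:: l].

Lemma linvK : involutive linv.
Proof. by case=> g e; rewrite /linv /= negbK. Qed.

Lemma push_reduced l s : reduced s -> reduced (push l s).
Proof.
case: s => [|m s] //= red_s; case: ifP => [_|/negbT neq].
  by rewrite /reduced; exact: path_sorted red_s.
by rewrite /reduced /= neq.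
Qed.

(** Letters thus act on the reduced words by permutations, so that words are invertible up to
    [free_eq]; this replaces a quotient type for the free group. *)
Lemma pushK l s : reduced s -> push l (push (linv l) s) = s.
Proof.
case: s => [|m s] /=; first by rewrite eqxx.
rewrite linvK; case: eqP => [->|_ _] /=; last by rewrite eqxx.
by case: s => [|k s] //= /andP[/negbTE ->].
Qed.

Lemma winvK : involutive winv.
Proof.
move=> u; rewrite /winv map_rev revK -map_comp -[RHS]map_id.
by apply: eq_map => l /=; rewrite linvK.
Qed.

Lemma winv_cat u v : winv (u ++ v) = winv v ++ winv u.
Proof. by rewrite /winv map_cat rev_cat. Qed.

Lemma push_all_reduced w s : reduced s -> reduced (foldr push s w).
Proof. by elim: w => //= l w IH /IH; apply: push_reduced. Qed.

(* Equality in the free group, through its action on reduced words. *)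
Definition free_eq (u v : word) : Prop :=
  forall s, reduced s -> foldr push s u = foldr push s v.

Lemma free_eq_reduce u v : free_eq u v -> reduce u = reduce v.
Proof. by move=> /(_ [::] isT). Qed.

Lemma free_eq_sym u v : free_eq u v -> free_eq v u.
Proof. by move=> uv s rs; rewrite uv. Qed.

Lemma free_eq_cat u u' v v' :
  free_eq u u' -> free_eq v v' -> free_eq (u ++ v) (u' ++ v').
Proof.
move=> uu vv s rs; rewrite !foldr_cat vv // uu //.
exact: push_all_reduced.
Qed.

Lemma free_eq_catV u : free_eq (u ++ winv u) [::].
Proof.
elim: u => //= l u IH s rs.
rewrite /winv /= rev_cons -cats1 catA -/(winv u) foldr_cat.
by rewrite IH ?push_reduced //= pushK.
Qed.

Lemma free_eq_Vcat u : free_eq (winv u ++ u) [::].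
Proof. by rewrite -{2}[u]winvK; apply: free_eq_catV. Qed.

Lemma free_eq_subst u v u' v' s :
  (forall l, free_eq (subst_letter u v l) (subst_letter u' v' l)) ->
  free_eq (subst u v s) (subst u' v' s).
Proof. by move=> uv; elim: s => //= l s IH; apply: free_eq_cat. Qed.

Lemma subst_cat u v s t : subst u v (s ++ t) = subst u v s ++ subst u v t.
Proof. by rewrite /subst map_cat flatten_cat. Qed.

Lemma subst_winv u v s : subst u v (winv s) = winv (subst u v s).
Proof.
elim: s => // l s IH; rewrite /winv /= rev_cons -cats1 subst_cat -/(winv s).
rewrite IH /= -/(winv _) winv_cat; congr (_ ++ _).
rewrite /subst /= cats0; case: l => [] [] [] //=;
  by rewrite /subst_letter /= winvK.
Qed.

Lemma subst_comp u v u' v' s :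
  subst u v (subst u' v' s) = subst (subst u v u') (subst u v v') s.
Proof.
elim: s => //= l s IH; rewrite subst_cat IH; congr (_ ++ _).
by case: l => [] [] []; rewrite /subst_letter /= ?subst_winv.
Qed.

Lemma free_eq_trans v u w : free_eq u v -> free_eq v w -> free_eq u w.
Proof. by move=> uv vw s rs; rewrite uv // vw. Qed.

Lemma free_eq_winv u v : free_eq u v -> free_eq (winv u) (winv v).
Proof.
move=> uv.
have e1 : free_eq (winv u) (winv u ++ (v ++ winv v)).
  rewrite -{1}[winv u]cats0; apply: free_eq_cat => //.
  exact/free_eq_sym/free_eq_catV.
apply: free_eq_trans e1 _.
apply: (@free_eq_trans (winv u ++ (u ++ winv v))).
  by apply: free_eq_cat => //; apply: free_eq_cat => //; apply: free_eq_sym.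
by rewrite catA -{2}[winv v]cat0s; apply: free_eq_cat => //;
  apply: free_eq_Vcat.
Qed.

(** It suffices to write the old pair in terms of the new one: substituting [f] and [g] into the
    words that express the generators by [u], [v] expresses them by [u'], [v']. *)
Lemma generating_pair_transfer u v u' v' f g :
  generating_pair u v ->
  free_eq (subst u' v' f) u -> free_eq (subst u' v' g) v ->
  generating_pair u' v'.
Proof.
move=> [s [t [gs gt]]] fu gv.
have key w : reduce (subst u' v' (subst f g w)) = reduce (subst u v w).
  rewrite subst_comp; apply/free_eq_reduce/free_eq_subst.
  by case=> [] [] []; rewrite /subst_letter //=; exact: free_eq_winv.
by exists (subst f g s), (subst f g t); rewrite !key.
Qed.

(** Actual words rather than classes in the free group: the holonomy is multiplicative on words and
    the moves act on homology by elementary operations, so inductions on the moves yield simple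
    curves, primitive classes and trace relations. *)
Inductive nielsen : word -> word -> Prop :=
| nielsen_base : nielsen [:: la] [:: lb]
| nielsen_swap u v : nielsen u v -> nielsen v u
| nielsen_inv u v : nielsen u v -> nielsen (winv u) v
| nielsen_mul u v : nielsen u v -> nielsen u (u ++ v).

Lemma nielsen_generating u v : nielsen u v -> generating_pair u v.
Proof.
elim=> {u v} [|u v _ IH|u v _ IH|u v _ IH].
- by exists [:: la], [:: lb].
- by apply: (generating_pair_transfer (f := [:: lb]) (g := [:: la]) IH);
    rewrite /subst /= cats0.
- apply: (generating_pair_transfer (f := [:: linv la]) (g := [:: lb]) IH);
    by rewrite /subst /= cats0 // /subst_letter /= winvK.
- apply: (generating_pair_transfer (f := [:: la]) (g := [:: linv la; lb]) IH);
    rewrite /subst /= cats0 //.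
  rewrite /subst_letter /= catA -{2}[v]cat0s; apply: free_eq_cat => //.
  exact: free_eq_Vcat.
Qed.

Lemma nielsen_simple u v : nielsen u v -> simple_curve u.
Proof. by move/nielsen_generating; exists v. Qed.

Lemma homology_cat u v : homology (u ++ v) = homology u + homology v.
Proof. by apply/rowP=> j; rewrite !mxE big_cat. Qed.

Lemma homology_winv u : homology (winv u) = - homology u.
Proof.
apply/rowP=> j; rewrite !mxE /winv (perm_big _ (permEl (perm_rev _))) /=.
rewrite big_map -sumrN; apply: eq_bigr => -[g e] _ /=.
by case: e; rewrite /= ?expr1 ?expr0 ?opprK.
Qed.

Definition hdet (u v : word) : int :=
  homology u 0 0 * homology v 0 1 - homology u 0 1 * homology v 0 0.

Lemma nielsen_det u v : nielsen u v -> hdet u v = 1 \/ hdet u v = -1.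
Proof.
elim=> {u v} [|u v _ IH|u v _ IH|u v _ IH].
- by left; rewrite /hdet /homology !mxE !big_cons !big_nil /=.
- by rewrite /hdet; move: IH; rewrite /hdet => -[e|e]; [right|left]; lia.
- by move: IH; rewrite /hdet homology_winv !mxE => -[e|e]; [right|left]; lia.
- by move: IH; rewrite /hdet homology_cat !mxE => -[e|e]; [left|right]; lia.
Qed.

Lemma nielsen_primitive u v : nielsen u v -> primitive (homology u).
Proof.
move=> /nielsen_det; rewrite /primitive /hdet => h; apply/coprimezP.
case: h => h.
  by exists (homology v 0 1, - homology v 0 0) => /=; rewrite -h; ring.
by exists (- homology v 0 1, homology v 0 0) => /=; lia.
Qed.

(** * Matrices of determinant 1 *)

Section Matrix2.
Variable R : realType.
Implicit Types M N P : 'M[R]_2.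

Lemma mx2P M N :
  [/\ M 0 0 = N 0 0, M 0 1 = N 0 1, M 1 0 = N 1 0 & M 1 1 = N 1 1] -> M = N.
Proof.
move=> [e00 e01 e10 e11]; apply/matrixP=> i j.
have ord2 (k : 'I_2) : k = 0 \/ k = 1.
  by case: k => -[|[|//]] ?; [left|right]; apply/val_inj.
by case: (ord2 i) => ->; case: (ord2 j) => ->.
Qed.

Lemma mul2E M N i j : (M * N) i j = M i 0 * N 0 j + M i 1 * N 1 j.
Proof.
rewrite -mulmxE mxE !big_ord_recl big_ord0 addr0.
by congr (_ + M i _ * N _ j); apply/val_inj.
Qed.

Lemma det2E M : \det M = M 0 0 * M 1 1 - M 0 1 * M 1 0.
Proof.
rewrite (expand_det_row _ 0) !big_ord_recl big_ord0 addr0 /cofactor.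
rewrite !det_mx11 !mxE /= expr0 expr1 mul1r mulN1r mulrN.
by congr (M 0 _ * M _ _ - M 0 _ * M _ _); apply/val_inj.
Qed.

Lemma tr2E M : \tr M = M 0 0 + M 1 1.
Proof.
rewrite /mxtrace !big_ord_recl big_ord0 addr0.
by congr (_ + M _ _); apply/val_inj.
Qed.

Lemma one2E : [/\ (1 : 'M[R]_2) 0 0 = 1, (1 : 'M[R]_2) 0 1 = 0,
                  (1 : 'M[R]_2) 1 0 = 0 & (1 : 'M[R]_2) 1 1 = 1].
Proof. by split; rewrite !mxE. Qed.

Lemma det1_unit M : \det M = 1 -> M \is a GRing.unit.
Proof. by move=> d; rewrite -[_ \is a _]/(_ \in unitmx) unitmxE d unitr1. Qed.

Lemma inv2E M : \det M = 1 ->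
  [/\ M^-1 0 0 = M 1 1, M^-1 0 1 = - M 0 1,
      M^-1 1 0 = - M 1 0 & M^-1 1 1 = M 0 0].
Proof.
move=> dM.
pose N : 'M[R]_2 := \matrix_(i, j)
  (if i == j then M (i + 1) (j + 1) else - M i j).
have MN : M * N = 1.
  have [i1 i2 i3 i4] := one2E.
  move: dM; rewrite det2E => dM.
  have e2 : 1 + 1 = 0 :> 'I_2 by apply/val_inj.
  by apply: mx2P; rewrite !mul2E !mxE /= ?add0r ?e2; split; lra.
have -> : M^-1 = N.
  by apply: (mulrI (det1_unit dM)); rewrite mulrV ?det1_unit.
have e2 : 1 + 1 = 0 :> 'I_2 by apply/val_inj.
by split; rewrite !mxE /= ?add0r ?e2.
Qed.

Lemma det1_mul M N : \det M = 1 -> \det N = 1 -> \det (M * N) = 1.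
Proof. by move=> dM dN; rewrite -mulmxE det_mulmx dM dN mulr1. Qed.

Lemma det1_inv M : \det M = 1 -> \det M^-1 = 1.
Proof.
move=> dM; have [e1 e2 e3 e4] := inv2E dM; move: dM.
rewrite !det2E e1 e2 e3 e4.
by move=> <-; ring.
Qed.

Lemma det1_word (A B : 'M[R]_2) u : \det A = 1 -> \det B = 1 -> \det (word_mx A
  B u) = 1.
Proof.
move=> dA dB; rewrite /word_mx; elim: u => [|l u IH];
  first by rewrite big_nil det1.
rewrite big_cons det1_mul //; rewrite /letter_mx.
by case: l => [] [] [] /=; rewrite ?det1_inv.
Qed.

Lemma word_mx_cat (A B : 'M[R]_2) u v : word_mx A B (u ++ v) = word_mx A B u *
  word_mx A B v.
Proof. by rewrite /word_mx big_cat. Qed.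

Lemma word_mx_winv (A B : 'M[R]_2) u : \det A = 1 -> \det B = 1 ->
  word_mx A B (winv u) = (word_mx A B u)^-1.
Proof.
move=> dA dB; elim: u => [|l u IH];
  first by rewrite /word_mx /winv !big_nil invr1.
rewrite /winv /= rev_cons -cats1 word_mx_cat -/(winv u) IH.
rewrite -(cat1s l u) [in RHS]word_mx_cat invrM; last 2 first.
- exact/det1_unit/det1_word.
- exact/det1_unit/det1_word.
congr (_ * _); rewrite /word_mx !big_seq1 /letter_mx.
by case: l => [] [] [] /=; rewrite ?invrK.
Qed.

Lemma word_mx_conj (A B g : 'M[R]_2) u : \det A = 1 -> \det B = 1 -> \det g = 1
  ->
  word_mx (g * A * g^-1) (g * B * g^-1) u = g * word_mx A B u * g^-1.
Proof.
move=> dA dB dg; have ug := det1_unit dg.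
elim: u => [|l u IH]; first by rewrite /word_mx !big_nil mulr1 mulrV.
rewrite -(cat1s l u) !word_mx_cat IH !mulrA; congr (_ * _ * _).
have cV M : \det M = 1 -> (g * M * g^-1)^-1 = g * M^-1 * g^-1.
  move=> /det1_unit uM.
  by rewrite !invrM ?unitrMl ?unitrV // invrK mulrA.
rewrite /word_mx !big_seq1 /letter_mx.
by case: l => [] [] [] /=; rewrite ?cV // -mulrA mulVr ?mulr1.
Qed.

Lemma fricke M N : \det M = 1 -> \det N = 1 ->
  \tr (M * N * M^-1 * N^-1) =
  \tr M ^+ 2 + \tr N ^+ 2 + \tr (M * N) ^+ 2 - \tr M * \tr N * \tr (M * N) - 2.
Proof.
move=> dM dN; have [m1 m2 m3 m4] := inv2E dM; have [n1 n2 n3 n4] := inv2E dN.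
rewrite !tr2E !mul2E m1 m2 m3 m4 n1 n2 n3 n4.
move: dM dN; rewrite !det2E => dM dN.
set a := M 0 0 in dM *; set b := M 0 1 in dM *.
set c := M 1 0 in dM *; set d := M 1 1 in dM *.
set p := N 0 0 in dN *; set q := N 0 1 in dN *.
set r := N 1 0 in dN *; set s := N 1 1 in dN *.
(* Homogeneous form of the identity: determinants inserted as factors restore the degree, so that
   [ring] applies without hypotheses. *)
transitivity ((a + d) ^+ 2 * (p * s - q * r) + (p + s) ^+ 2 * (a * d - b * c)
  + (a * p + b * r + (c * q + d * s)) ^+ 2
  - (a + d) * (p + s) * (a * p + b * r + (c * q + d * s))
  - 2 * (a * d - b * c) * (p * s - q * r)); first by ring.
by rewrite dM dN; ring.
Qed.

(** Cayley-Hamilton: M + M^-1 is the scalar tr M. *)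
Lemma tr_mulV M N : \det M = 1 ->
  \tr (M^-1 * N) = \tr M * \tr N - \tr (M * N).
Proof.
move=> dM; have [m1 m2 m3 m4] := inv2E dM.
by rewrite !tr2E !mul2E m1 m2 m3 m4; ring.
Qed.

Lemma tr_mulM M N : \det M = 1 ->
  \tr (M * (M * N)) = \tr M * \tr (M * N) - \tr N.
Proof.
move=> dM; rewrite !tr2E !mul2E.
move: dM; rewrite !det2E => dM.
have -> : N 0 0 + N 1 1 = (M 0 0 * M 1 1 - M 0 1 * M 1 0) * (N 0 0 + N 1 1).
  by rewrite dM mul1r.
by ring.
Qed.

Lemma tr_inv M : \det M = 1 -> \tr M^-1 = \tr M.
Proof. by move=> dM; have [m1 m2 m3 m4] := inv2E dM;
  rewrite !tr2E m1 m4 addrC. Qed.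

End Matrix2.

(** * Translation lengths *)

Section GeodesicLength.
Import ComplexField.
Local Open Scope complex_scope.
Variable R : realType.
Implicit Types (M : 'M[R]_2) (x y s t : R).

Lemma mobiusE M s t : \det M = 1 -> 0 < t ->
  let D := (M 1 0 * s + M 1 1) ^+ 2 + (M 1 0 * t) ^+ 2 in
  0 < D /\
  mobius M (s +i* t) =
  (((M 0 0 * s + M 0 1) * (M 1 0 * s + M 1 1) + M 0 0 * M 1 0 * t ^+ 2) / D
    +i* (t / D)).
Proof.
rewrite det2E => dM t0 D.
set a := M 0 0 in dM *; set b := M 0 1 in dM *.
set c := M 1 0 in dM D *; set d := M 1 1 in dM D *.
have D0 : 0 < D.
  rewrite lt0r; apply/andP; split; last by rewrite addr_ge0 // sqr_ge0.
  rewrite paddr_eq0 ?sqr_ge0 // !expf_eq0 /= mulf_eq0 (gt_eqF t0) orbF.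
  apply/negP => /andP[/eqP h /eqP c0]; move: dM h;
    rewrite c0 mulr0 mul0r subr0 add0r.
  by move=> dM d0; move: dM; rewrite d0 mulr0 => /esym/eqP; rewrite oner_eq0.
split=> //; rewrite /mobius -/a -/b -/c -/d.
set den := (c%:C * _ + _).
have den0 : den != 0.
  apply/eqP => -[] /eqP; rewrite !mul0r subr0 => /eqP h1 /eqP.
  rewrite addr0 addr0 => /eqP h2.
  by move: D0; rewrite /D h1 h2 expr0n addr0 ltxx.
apply: (mulIf den0); rewrite divfK //; apply/eqP; rewrite eq_complex /den /=.
have Dn0 : D != 0 by rewrite gt_eqF.
apply/andP; split; apply/eqP.
  transitivity ((((a * s + b) * (c * s + d) + a * c * t ^+ 2) * (c * s + d)
    - c * t ^+ 2) / D); last by field.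
  apply: (mulIf Dn0); rewrite divfK // /D.
  transitivity (((a * s + b) * (c * s + d) + a * c * t ^+ 2) * (c * s + d)
    - c * t ^+ 2 * (a * d - b * c)); last by rewrite dM mulr1.
  by ring.
transitivity ((((a * s + b) * (c * s + d) + a * c * t ^+ 2) * (c * t)
  + t * (c * s + d)) / D); last by field.
apply: (mulIf Dn0); rewrite divfK // /D.
transitivity (((a * s + b) * (c * s + d) + a * c * t ^+ 2) * (c * t)
    + t * (c * s + d) * (a * d - b * c)); last by rewrite dM mulr1.
by ring.
Qed.

Lemma displacement_identity a b c d s t D : a * d - b * c = 1 ->
  D = (c * s + d) ^+ 2 + (c * t) ^+ 2 -> D != 0 -> t != 0 ->
  1 + ((s - ((a * s + b) * (c * s + d) + a * c * t ^+ 2) / D) ^+ 2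
       + (t - t / D) ^+ 2) / (2 * t * (t / D)) =
  ((a + d) ^+ 2 - 2) / 2
  + (c * s ^+ 2 + (d - a) * s - b + c * t ^+ 2) ^+ 2 / (2 * t ^+ 2).
Proof.
move=> dM eD Dn0 tn0.
transitivity (1 + ((s * D - ((a * s + b) * (c * s + d) + a * c * t ^+ 2)) ^+ 2
   + (t * D - t) ^+ 2) / D / (2 * t ^+ 2)); first by field; rewrite Dn0 tn0.
have -> : (s * D - ((a * s + b) * (c * s + d) + a * c * t ^+ 2)) ^+ 2
   + (t * D - t) ^+ 2 = ((c * (s ^+ 2 - t ^+ 2) + (d - a) * s - b) ^+ 2
   + t ^+ 2 * (2 * c * s + d - a) ^+ 2) * D.
  have -> : t * D - t = t * D - t * (a * d - b * c) by rewrite dM mulr1.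
  by rewrite eD; ring.
rewrite mulfK //.
transitivity (((a + d) ^+ 2 - 2 * (a * d - b * c)) / 2 +
   (c * s ^+ 2 + (d - a) * s - b + c * t ^+ 2) ^+ 2 / (2 * t ^+ 2)
   + (1 - (a * d - b * c))); last by rewrite dM; ring.
by field.
Qed.

(* With Q(z) = c z^2 + (d - a) z - b, the correction to the minimum
   (tr^2 - 2) / 2 is (Q(s) + c t^2)^2 / (2 t^2). *)
Lemma hdist_mobius M s t : \det M = 1 -> 0 < t ->
  hdist (s +i* t) (mobius M (s +i* t)) =
  arcosh ((\tr M ^+ 2 - 2) / 2 +
    (M 1 0 * s ^+ 2 + (M 1 1 - M 0 0) * s - M 0 1 + M 1 0 * t ^+ 2) ^+ 2
    / (2 * t ^+ 2)).
Proof.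
move=> dM t0; have [D0 ->] := mobiusE s dM t0.
rewrite /hdist /= tr2E; congr arcosh; apply: displacement_identity.
- by rewrite -dM det2E.
- by [].
- by rewrite gt_eqF.
- by rewrite gt_eqF.
Qed.

Lemma arcosh_le x y : 1 <= x -> x <= y -> arcosh x <= arcosh y.
Proof.
move=> x1 xy; rewrite /arcosh ler_ln ?posrE.
- by rewrite lerD // ler_wsqrtr //; nra.
- by rewrite ltr_wpDr ?sqrtr_ge0 //; lra.
- by rewrite ltr_wpDr ?sqrtr_ge0 //; lra.
Qed.

Lemma arcosh_ge0 x : 1 <= x -> 0 <= arcosh x.
Proof. by move=> x1; rewrite ln_ge0 //; have := sqrtr_ge0 (x ^+ 2 - 1);
  lra. Qed.

(** The correction term vanishes on the axis of M. For c nonzero the witness is the top of this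
    half-circle, of centre (a - d) / (2 c) and squared radius (tr^2 - 4) / (4 c^2); for c = 0 the
    axis is the vertical line over b / (d - a). *)
Lemma axis_point M : \det M = 1 -> 4 < \tr M ^+ 2 -> exists s t, 0 < t /\
  M 1 0 * s ^+ 2 + (M 1 1 - M 0 0) * s - M 0 1 + M 1 0 * t ^+ 2 = 0.
Proof.
rewrite det2E tr2E.
set a := M 0 0; set b := M 0 1; set c := M 1 0; set d := M 1 1 => dM tr4.
have [c0|cn0] := eqVneq c 0.
  have da0 : d - a != 0.
    by apply/eqP => h; move: dM tr4; rewrite c0 (_ : d = a); [nra|lra].
  by exists (b / (d - a)), 1; split => //; rewrite c0; field.
have disc0 : 0 < ((a + d) ^+ 2 - 4) / (4 * c ^+ 2).
  by apply: divr_gt0; [lra | rewrite mulr_gt0 // exprn_even_gt0].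
exists ((a - d) / (2 * c)), (Num.sqrt (((a + d) ^+ 2 - 4) / (4 * c ^+ 2))).
rewrite sqrtr_gt0 disc0; split=> //; rewrite sqr_sqrtr ?ltW //.
transitivity ((a * d - b * c - 1) / c); last by rewrite dM subrr mul0r.
by field.
Qed.

(** The infimum is attained on the axis and equals arcosh((tr^2 - 2) / 2); the half-angle formula
    then gives 2 cosh(l / 2) = |tr|. *)
Lemma exp_geodesic_length (X : marked_torus R) u :
  4 < \tr (holonomy X u) ^+ 2 ->
  expR (geodesic_length X u / 2) + expR (- (geodesic_length X u / 2))
  = `|\tr (holonomy X u)|.
Proof.
move=> tr4; set M := holonomy X u in tr4 *.
have dM : \det M = 1 by apply: det1_word; [apply: mt_det_a|apply: mt_det_b].
set m := (\tr M ^+ 2 - 2) / 2.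
have m1 : 1 < m by rewrite /m; lra.
have -> : geodesic_length X u = arcosh m.
  rewrite /geodesic_length -/M; apply/eqP; rewrite eq_le; apply/andP; split.
    have [s [t [t0 e]]] := axis_point dM tr4.
    apply: ge_inf.
      exists 0 => _ [[x y] /= y0 <-]; rewrite hdist_mobius //.
      have x0 : 0 <= (M 1 0 * x ^+ 2 + (M 1 1 - M 0 0) * x - M 0 1
        + M 1 0 * y ^+ 2) ^+ 2 / (2 * y ^+ 2).
        by rewrite divr_ge0 ?sqr_ge0 // mulr_ge0 ?sqr_ge0.
      by apply: arcosh_ge0; rewrite -/m; lra.
    exists (s +i* t) => //; rewrite hdist_mobius // e expr0n mul0r addr0 //.
  apply: lb_le_inf.
    exists (hdist (0 +i* 1) (mobius M (0 +i* 1))), (0 +i* 1) => //.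
    by rewrite /upper_half /= ltr01.
  move=> _ [[x y] /= y0 <-]; rewrite hdist_mobius //; apply: arcosh_le.
    by rewrite ltW.
  by rewrite -/m lerDl divr_ge0 ?sqr_ge0 // mulr_ge0 ?sqr_ge0.
have s0 : 0 <= m ^+ 2 - 1 by nra.
set E := expR _; have E0 : 0 < E := expR_gt0 _.
have E2 : E ^+ 2 = m + Num.sqrt (m ^+ 2 - 1).
  rewrite expr2 /E -expRD -splitr lnK // posrE.
  by rewrite ltr_wpDr ?sqrtr_ge0 //; lra.
have En0 : E != 0 by rewrite gt_eqF.
have EV0 : 0 < E^-1 by rewrite invr_gt0.
rewrite expRN -/E; apply/eqP; rewrite -(eqrXn2 (n := 2)) //; last by lra.
rewrite real_normK ?num_real //; apply/eqP.
transitivity ((E ^+ 2 + E ^- 2) + 2); first by field.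
(* E^2 and E^-2 are the two roots of x^2 - 2 m x + 1. *)
have -> : E ^- 2 = m - Num.sqrt (m ^+ 2 - 1).
  apply: (mulfI (x := E ^+ 2)); first by rewrite expf_neq0.
  rewrite divff ?expf_neq0 // E2.
  by rewrite mulrC -subr_sqr sqr_sqrtr //; ring.
by rewrite E2 /m; field.
Qed.

End GeodesicLength.

(** * Trace identities *)

Section Torus.
Local Open Scope complex_scope.
Variable R : realType.
Implicit Types (X Y : marked_torus R) (M N : 'M[R]_2).

Lemma det1_holonomy X u : \det (holonomy X u) = 1.
Proof. by apply: det1_word; [apply: mt_det_a|apply: mt_det_b]. Qed.

Lemma holonomy_cat X u v : holonomy X (u ++ v) = holonomy X u * holonomy X v.
Proof. exact: word_mx_cat. Qed.

Lemma holonomy_winv X u : holonomy X (winv u) = (holonomy X u)^-1.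
Proof. by apply: word_mx_winv; [apply: mt_det_a|apply: mt_det_b]. Qed.

Lemma holonomy_a X : holonomy X [:: la] = mt_a X.
Proof. by rewrite /holonomy /word_mx big_seq1. Qed.

Lemma holonomy_b X : holonomy X [:: lb] = mt_b X.
Proof. by rewrite /holonomy /word_mx big_seq1. Qed.

(** A scalar matrix of determinant 1 fixes the point i, whereas a covering action moves it by a
    distance bounded below. *)
Lemma holonomy_not_scalar X u c : reduced u -> u != [::] ->
  holonomy X u <> c%:M.
Proof.
move=> red_u u0 e; have iH : upper_half (0 +i* (1 : R)) by rewrite /upper_half
  /= ltr01.
have [r r0 /(_ u red_u u0)] := mt_covering X iH.
rewrite -/(holonomy X u) hdist_mobius ?det1_holonomy //.
have := det1_holonomy X u; rewrite det2E tr2E e !mxE /= => cc.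
set x := (X in arcosh X).
have -> : x = 1.
  transitivity (2 * (c *+ 1 * (c *+ 1) - c *+ 0 * (c *+ 0)) - 1);
    last by rewrite cc; ring.
  by rewrite /x; field.
by rewrite /arcosh expr1n subrr sqrtr0 addr0 ln1 => /(lt_le_trans r0);
  rewrite ltxx.
Qed.

Lemma unit_translationE :
  [/\ unit_translation R 0 0 = 1, unit_translation R 0 1 = 1,
      unit_translation R 1 0 = 0 & unit_translation R 1 1 = 1].
Proof. by split; rewrite mxE. Qed.

Lemma tr_mulC M N : \tr (M * N) = \tr (N * M).
Proof. by rewrite -!mulmxE mxtrace_mulC. Qed.

(** Let C be the commutator. For P = M^-1, N and N M the product C P is conjugate to P, while the
    trace of [c *: unit_translation R * P] is c (tr P + P 1 0). *)
Lemma commutator_scaled_translation M N c : \det M = 1 -> \det N = 1 ->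
  M * N * M^-1 * N^-1 = c *: unit_translation R ->
  [/\ c * (\tr M - M 1 0) = \tr M, c * (\tr N + N 1 0) = \tr N &
      c * (\tr (M * N) + (N * M) 1 0) = \tr (M * N)].
Proof.
move=> dM dN e; have [t1 t2 t3 t4] := unit_translationE.
have [m1 m2 m3 m4] := inv2E dM.
have [uM uN] := (det1_unit dM, det1_unit dN).
have trT P : c * (\tr P + P 1 0) = \tr (c *: unit_translation R * P).
  by rewrite !tr2E !mul2E !mxE /= ?mulr1n ?mulr0n; ring.
split.
- transitivity (c * (\tr M^-1 + M^-1 1 0)); first by rewrite tr_inv // m3.
  rewrite trT -e tr_mulC !mulrA mulVr // mul1r tr_mulC mulrA mulVr // mul1r.
  exact: tr_inv.
- by rewrite trT -e mulrVK // tr_mulC mulrA mulVr // mul1r.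
- by rewrite [\tr (M * N)]tr_mulC trT -e -!mulrA mulKr // mulVr //
  mulr1 tr_mulC.
Qed.

Lemma triangular_commutator M N : \det M = 1 -> \det N = 1 ->
  M 1 0 = 0 -> N 1 0 = 0 ->
  let C := M * N * M^-1 * N^-1 in [/\ C 0 0 = 1, C 1 0 = 0 & C 1 1 = 1].
Proof.
move=> dM dN M0 N0 C.
have [m1 m2 m3 m4] := inv2E dM; have [n1 n2 n3 n4] := inv2E dN.
move: dM dN; rewrite /C !det2E !mul2E m1 m2 m3 m4 n1 n2 n3 n4 M0 N0 => dM dN.
split; last 2 first.
- by ring.
- transitivity ((M 0 0 * M 1 1 - M 0 1 * 0) * (N 0 0 * N 1 1 - N 0 1 * 0));
    by [ring|rewrite dM dN mulr1].
- transitivity ((M 0 0 * M 1 1 - M 0 1 * 0) * (N 0 0 * N 1 1 - N 0 1 * 0));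
    by [ring|rewrite dM dN mulr1].
Qed.

(* If the commutator were +T, then a and b would be upper triangular, so that
   [a, b] and [a, b^-1] would be commuting unipotents: a nontrivial reduced word
   would have trivial holonomy. *)
Lemma torus_normal_form X : exists g, [/\ \det g = 1 :> R &
  let a := g * mt_a X * g^-1 in let b := g * mt_b X * g^-1 in
  a * b * a^-1 * b^-1 = - unit_translation R].
Proof.
have [g dg e] := mt_cusp X; exists g; split => // a b.
have [da db] := (mt_det_a X, mt_det_b X).
have da' : \det a = 1 by apply: det1_mul; [apply: det1_mul|apply: det1_inv].
have db' : \det b = 1 by apply: det1_mul; [apply: det1_mul|apply: det1_inv].
have wE u : g * holonomy X u * g^-1 = word_mx a b u by rewrite word_mx_conj.
move: e; clearbody a b;
  rewrite -/(holonomy X _) wE /peripheral /word_mx !big_cons big_nil.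
rewrite /letter_mx /= mulr1 !mulrA => -[] // e; exfalso.
have [] := @commutator_scaled_translation a b 1 da' db';
  first by rewrite scale1r.
rewrite !mul1r => ha hb _.
have [a0 b0] : a 1 0 = 0 /\ b 1 0 = 0 by split; lra.
(* The word of [[a, b], [a, b^-1]], which is reduced as written. *)
pose u : word := [:: la; lb; linv la; linv lb; la; linv lb; linv la; lb;
                     lb; la; linv lb; linv la; linv lb; la; lb; linv la].
apply: (@holonomy_not_scalar X u 1) => //; have ug := det1_unit dg.
have -> : holonomy X u = g^-1 * word_mx a b u * g.
  by rewrite -wE !mulrA mulVr // mul1r mulrVK.
have -> : word_mx a b u = 1; last by rewrite mulr1 mulVr.
have [c1 c2 c3] := triangular_commutator da' db' a0 b0.
have [dbV b0V] : \det b^-1 = 1 /\ b^-1 1 0 = 0.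
  by rewrite det1_inv //; have [_ _ -> _] := inv2E db'; rewrite b0 oppr0.
have [d1 d2 d3] := triangular_commutator da' dbV a0 b0V.
set C := a * b * a^-1 * b^-1 in c1 c2 c3.
set D := a * b^-1 * a^-1 * b^-1^-1 in d1 d2 d3.
have [ua ub] := (det1_unit da', det1_unit db').
have -> : word_mx a b u = C * D * C^-1 * D^-1.
  rewrite /word_mx /u !big_cons big_nil /letter_mx /= /C /D.
  by rewrite !invrM ?unitrMl ?unitrV // !invrK mulr1 !mulrA.
have [uC uD] : C \is a GRing.unit /\ D \is a GRing.unit.
  by split; rewrite /C /D ?unitrMl ?unitrV.
clearbody C D; have -> : C * D = D * C.
  by apply: mx2P; rewrite !mul2E c1 c2 c3 d1 d2 d3; split; ring.
by rewrite mulrK ?mulrV.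
Qed.

Definition fricke_triple (x y z : R) : Prop :=
  [/\ x ^+ 2 + y ^+ 2 + z ^+ 2 = x * y * z, 4 < x ^+ 2,
    4 < y ^+ 2 & 4 < z ^+ 2].

(** Completing the square in the third variable gives (2 c - a b)^2 + 16 = (a^2 - 4) (b^2 - 4). If x
    is nonzero and x^2 <= 4, both factors are at most 0 and at least -4, the first strictly, and
    their product is below 16. *)
Lemma fricke_tripleP x y z : x != 0 ->
  x ^+ 2 + y ^+ 2 + z ^+ 2 = x * y * z -> fricke_triple x y z.
Proof.
move=> x0 e.
have key (a b c : R) : a ^+ 2 + b ^+ 2 + c ^+ 2 = a * b * c ->
    16 <= (a ^+ 2 - 4) * (b ^+ 2 - 4).
  by move=> h; have := sqr_ge0 (2 * c - a * b); nra.
have x2 : 0 < x ^+ 2 by rewrite exprn_even_gt0.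
have xy := key x y z e.
have xz : 16 <= (x ^+ 2 - 4) * (z ^+ 2 - 4) by apply: (key x z y); lra.
have y2 := sqr_ge0 y; have z2 := sqr_ge0 z.
have x4 : 4 < x ^+ 2 by rewrite ltNge; apply/negP => h; nra.
by split=> //; rewrite ltNge; apply/negP => h; nra.
Qed.

(** Trace 0 means a^2 = -1 by Cayley-Hamilton, which is trivial in PSL_2(R), while the word a a is
    reduced. *)
Lemma torus_trace_a X : \tr (mt_a X) != 0.
Proof.
apply/eqP => t0; apply: (@holonomy_not_scalar X [:: la; la] (-1)); rewrite //.
rewrite -[[:: la; la]]/([:: la] ++ [:: la]) holonomy_cat holonomy_a.
move: (mt_det_a X) t0; rewrite det2E tr2E => d t.
apply: mx2P; rewrite !mul2E !mxE /= ?mulr1n ?mulr0n.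
by split; [| | |]; nra.
Qed.

(** The commutator has trace -2, which turns Fricke's identity into the Markov equation for (a, b).
    The inverse and product moves are Vieta jumps: one trace is exchanged for the other root of its
    quadratic equation. *)
Lemma nielsen_trace X u v : nielsen u v ->
  fricke_triple (\tr (holonomy X u)) (\tr (holonomy X v)) (\tr (holonomy X (u
    ++ v))).
Proof.
elim=> {u v} [|u v _|u v _|u v _].
- rewrite holonomy_cat holonomy_a holonomy_b; apply: fricke_tripleP.
    exact: torus_trace_a.
  have [g [dg]] := torus_normal_form X; set a := g * _ * _; set b := g * _ * _.
  have ug := det1_unit dg.
  have da : \det a = 1 by apply: det1_mul; [apply: det1_mul => //;
    apply: mt_det_a|apply: det1_inv].
  have db : \det b = 1 by apply: det1_mul; [apply: det1_mul => //;
    apply: mt_det_b|apply: det1_inv].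
  have trg P : \tr (g * P * g^-1) = \tr P by rewrite tr_mulC mulrA mulVr //
    mul1r.
  have [ta tb] : \tr a = \tr (mt_a X) /\ \tr b = \tr (mt_b X) by rewrite !trg.
  have tab : \tr (a * b) = \tr (mt_a X * mt_b X).
    by rewrite -[RHS]trg /a /b !mulrA mulrVK.
  move=> /= /(congr1 mxtrace); rewrite fricke // ta tb tab.
  by rewrite [RHS]tr2E !mxE /= mulr1n => h; lra.
- by case=> e u4 v4 uv4; rewrite holonomy_cat tr_mulC -holonomy_cat;
  split=> //; lra.
- case=> e u4 v4 uv4;
  rewrite holonomy_cat holonomy_winv tr_inv ?det1_holonomy //.
  rewrite tr_mulV ?det1_holonomy // -holonomy_cat; apply: fricke_tripleP.
    by apply/eqP => h; move: u4; rewrite h; lra.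
  by lra.
- case=> e u4 v4 uv4;
  rewrite [holonomy X (u ++ u ++ v)]holonomy_cat holonomy_cat.
  rewrite tr_mulM ?det1_holonomy // -holonomy_cat; apply: fricke_tripleP.
    by apply/eqP => h; move: u4; rewrite h; lra.
  by lra.
Qed.

End Torus.

(** * Reconstruction from traces *)

Section Reconstruction.
Variable R : realType.
Implicit Types (X Y : marked_torus R) (M N a b : 'M[R]_2).

Lemma normal_form_entries a b : \det a = 1 -> \det b = 1 ->
  a * b * a^-1 * b^-1 = - unit_translation R ->
  [/\ a 1 0 = 2 * \tr a, b 1 0 = - (2 * \tr b)
    & \tr b * a 0 0 + \tr a * b 0 0 = \tr a * \tr b + \tr (a * b)].
Proof.
move=> da db e.
have [] := @commutator_scaled_translation _ a b (-1) da db;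
  first by rewrite scaleN1r.
move=> e1 e2 e3.
have [a10 b10] : a 1 0 = 2 * \tr a /\ b 1 0 = - (2 * \tr b) by split; lra.
split=> //; move: e3; rewrite (mul2E b a) a10 b10 => e3.
have -> : \tr (a * b) = - (- (2 * \tr b) * a 0 0 + b 1 1 * (2 * \tr a)) / 2 by
  lra.
by rewrite !(tr2E b); field.
Qed.

(** The commutator equation fixes the lower left entries and relates the upper left ones linearly.
    What remains free is conjugation by translations, which commute with [unit_translation]. *)
Lemma normal_form_unique a b a' b' :
  \det a = 1 -> \det b = 1 -> \det a' = 1 -> \det b' = 1 ->
  a * b * a^-1 * b^-1 = - unit_translation R ->
  a' * b' * a'^-1 * b'^-1 = - unit_translation R ->
  \tr a = \tr a' -> \tr b = \tr b' -> \tr (a * b) = \tr (a' * b') ->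
  \tr a != 0 -> \tr b != 0 ->
  exists2 t : 'M[R]_2, \det t = 1 & t * a * t^-1 = a' /\ t * b * t^-1 = b'.
Proof.
move=> da db da' db' e e' ta tb tab xn0 yn0.
have [a10 b10 ab] := normal_form_entries da db e.
have [a10' b10' ab'] := normal_form_entries da' db' e'.
(* Conjugation by the translation by s adds s M 1 0 to the upper left entry of M, and [a 1 0] is 2
   tr a. *)
pose s := (a' 0 0 - a 0 0) / (2 * \tr a).
pose t : 'M[R]_2 := \matrix_(i,
  j) (if i == j then 1 else if i == 0 then s else 0).
have [t1 t2 t3 t4] : [/\ t 0 0 = 1, t 0 1 = s, t 1 0 = 0 & t 1 1 = 1].
  by split; rewrite mxE.
have dt : \det t = 1 by rewrite det2E t1 t2 t3 t4; ring.
have [i1 i2 i3 i4] := inv2E dt.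
have conj M N : \det M = 1 -> \det N = 1 -> \tr M = \tr N -> M 1 0 = N 1 0 ->
    M 1 0 != 0 -> N 0 0 = M 0 0 + s * M 1 0 -> t * M * t^-1 = N.
  move=> dM dN tMN c c0 e0.
  have e1 : M 1 1 - s * M 1 0 = N 1 1 by move: tMN; rewrite !tr2E; lra.
  apply: mx2P; rewrite !mul2E i1 i2 i3 i4 t1 t2 t3 t4; split.
  - by rewrite e0; ring.
  - apply: (mulIf c0); move: dM dN; rewrite !det2E -c e0 -e1 => dM dN.
    transitivity ((M 0 0 + s * M 1 0) * (M 1 1 - s * M 1 0) -
      (M 0 0 * M 1 1 - M 0 1 * M 1 0)); first by ring.
    by rewrite dM -dN; ring.
  - by rewrite -c; ring.
  - by rewrite -e1; ring.
exists t => //; split; apply: conj => //.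
- by rewrite a10 a10' ta.
- by rewrite a10 mulf_neq0 // pnatr_eq0.
- by rewrite a10 /s; field; rewrite xn0.
- by rewrite b10 b10' tb.
- by rewrite b10 oppr_eq0 mulf_neq0 // pnatr_eq0.
- rewrite b10 /s; apply: (mulfI xn0).
  transitivity (\tr a * b 0 0 - \tr b * (a' 0 0 - a 0 0)); last by field.
  by rewrite -ta -tb -tab in ab'; lra.
Qed.

(** Lengths determine lifts to SL_2(R) only up to sign; the commutator does not see the choice. *)
Lemma commutator_sign M N c d : \det M = 1 -> \det N = 1 ->
  c = 1 \/ c = - 1 -> d = 1 \/ d = - 1 ->
  (c *: M) * (d *: N) * (c *: M)^-1 * (d *: N)^-1 = M * N * M^-1 * N^-1.
Proof.
move=> dM dN [] -> [] ->; rewrite ?scaleN1r ?scale1r ?invrN;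
by rewrite ?(mulNr, mulrN, opprK).
Qed.

Lemma det_sign M c : c = 1 \/ c = - 1 -> \det (c *: M) = \det M.
Proof. by move=> [] ->; rewrite !det2E !mxE; ring. Qed.

Lemma norm_eq_sign (x y : R) : `|x| = `|y| -> exists2 c,
  c = 1 \/ c = - 1 & x = c * y.
Proof.
move=> /eqP; rewrite eqr_norm2 => /orP[] /eqP ->.
  by exists 1; [left|rewrite mul1r].
by exists (-1); [right|rewrite mulN1r].
Qed.

Lemma teich_eq_traces X Y :
  `|\tr (holonomy X [:: la])| = `|\tr (holonomy Y [:: la])| ->
  `|\tr (holonomy X [:: lb])| = `|\tr (holonomy Y [:: lb])| ->
  `|\tr (holonomy X [:: la; lb])| = `|\tr (holonomy Y [:: la; lb])| ->
  teich_eq X Y.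
Proof.
move=> /norm_eq_sign[c hc ta] /norm_eq_sign[d hd tb] /norm_eq_sign[k hk tab].
have := nielsen_trace X nielsen_base; have := nielsen_trace Y nielsen_base.
rewrite /= ta tb tab => -[eY aY bY abY] [eX _ _ _].
move: ta tb tab eX eY aY bY abY; rewrite -[[:: la;
  lb]]/([:: la] ++ [:: lb]) !holonomy_cat !holonomy_a !holonomy_b.
move=> ta tb tab eX eY aY bY abY.
(* Signs leave the sum of squares unchanged but multiply the product of the traces by c d k. As this
   product is nonzero, the two Markov equations force c d k = 1. *)
have kcd : k = c * d.
  have sq (e : R) : e = 1 \/ e = -1 -> e ^+ 2 = 1 by move=> [] ->; ring.
  move: eX; rewrite !exprMn (sq c) // (sq d) // (sq k) // !mul1r eY.
  set x := \tr (mt_a Y) in eY aY *; set y := \tr _ in eY bY *;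
    set z := \tr _ in eY abY *.
  have p0 : x * y * z != 0 by apply/eqP => h; move: eY aY; rewrite h; nra.
  rewrite (_ : c * x * (d * y) * (k * z) = (c * d * k) * (x * y * z));
    last by ring.
  rewrite -{1}[x * y * z]mul1r => /(mulIf p0) h.
  by rewrite -[LHS]mul1r h -mulrA -expr2 (sq k) ?mulr1.
have [g [dg eg]] := torus_normal_form X;
  have [h [dh eh]] := torus_normal_form Y.
have [ug uh] := (det1_unit dg, det1_unit dh).
have [daX dbX] := (mt_det_a X, mt_det_b X).
have [daY dbY] := (mt_det_a Y, mt_det_b Y).
have dconj (P M : 'M[R]_2) : \det P = 1 -> \det M = 1 -> \det (P * M * P^-1) =
  1.
  by move=> dP dM; apply: det1_mul; [apply: det1_mul|apply: det1_inv].
have trconj (P M : 'M[R]_2) : \det P = 1 -> \tr (P * M * P^-1) = \tr M.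
  by move=> /det1_unit uP; rewrite tr_mulC mulrA mulVr // mul1r.
have pc (P M N : 'M[R]_2) : \det P = 1 ->
    P * M * P^-1 * (P * N * P^-1) = P * (M * N) * P^-1.
  by move=> /det1_unit uP; rewrite !mulrA mulrVK.
have trZ (e : R) M : \tr (e *: M) = e * \tr M by rewrite linearZ.
have [] := @normal_form_unique (g * mt_a X * g^-1) (g * mt_b X * g^-1)
  (c *: (h * mt_a Y * h^-1)) (d *: (h * mt_b Y * h^-1)).
- exact: dconj.
- exact: dconj.
- by rewrite det_sign //; apply: dconj.
- by rewrite det_sign //; apply: dconj.
- exact: eg.
- by rewrite commutator_sign //; apply: dconj.
- by rewrite trZ !trconj.
- by rewrite trZ !trconj.
- by rewrite -scalerAl -scalerAr scalerA trZ !pc // !trconj // tab kcd.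
- by rewrite trconj // ta; apply/eqP => t0; case: hc t0 => ->; move: aY; nra.
- by rewrite trconj // tb; apply/eqP => t0; case: hd t0 => ->; move: bY; nra.
move=> t dt [eqa eqb]; have ut := det1_unit dt.
exists (h^-1 * t * g); first by apply: det1_mul => //; apply: det1_mul => //;
  apply: det1_inv.
have key (M N : 'M[R]_2) e : e = 1 \/ e = -1 ->
   t * (g * M * g^-1) * t^-1 = e *: (h * N * h^-1) ->
   psl_eq (h^-1 * t * g * M * (h^-1 * t * g)^-1) N.
  move=> he eq1.
  have eq2 : h^-1 * t * g * M * (h^-1 * t * g)^-1 = e *: N.
    rewrite !invrM ?unitrMl ?unitrV // invrK.
    transitivity (h^-1 * (t * (g * M * g^-1) * t^-1) * h);
      first by rewrite !mulrA.
    by rewrite eq1 -scalerAr -scalerAl !mulrA mulVr // mul1r mulrVK.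
  by rewrite eq2; case: he => ->; [left; rewrite scale1r|right;
    rewrite scaleN1r].
by split; [apply: (key _ _ c)|apply: (key _ _ d)].
Qed.

End Reconstruction.

(** * The norm as a function on Markov triples *)

(** Farey neighbours together with curves that carry them, so that trace relations apply to them. *)
Definition good (u1 u2 v1 v2 : int) : Prop := exists U V, [/\ nielsen U V,
  (homology U 0 0 = u1) /\ (homology U 0 1 = u2) &
  (homology V 0 0 = v1) /\ (homology V 0 1 = v2)].

Lemma good_base : good 1 0 0 1.
Proof.
exists [:: la], [:: lb]; split; first exact: nielsen_base;
by rewrite !mxE !big_cons !big_nil.
Qed.

Lemma good_swap u1 u2 v1 v2 : good u1 u2 v1 v2 -> good v1 v2 u1 u2.
Proof. by move=> [U [V [h hu hv]]]; exists V, U; split=> //;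
  apply: nielsen_swap. Qed.

Lemma good_opp u1 u2 v1 v2 : good u1 u2 v1 v2 -> good (- u1) (- u2) v1 v2.
Proof.
move=> [U [V [h [hu1 hu2] hv]]]; exists (winv U), V; split=> //.
  exact: nielsen_inv.
by rewrite homology_winv !mxE; rewrite !mxE in hu1 hu2; rewrite hu1 hu2.
Qed.

Lemma good_add u1 u2 v1 v2 : good u1 u2 v1 v2 -> good u1 u2 (u1 + v1) (u2 + v2).
Proof.
move=> [U [V [h [hu1 hu2] [hv1 hv2]]]]; exists U, (U ++ V); split=> //.
  exact: nielsen_mul.
rewrite homology_cat !mxE; rewrite !mxE in hu1 hu2 hv1 hv2.
by rewrite hu1 hu2 hv1 hv2.
Qed.

Lemma good_det u1 u2 v1 v2 : good u1 u2 v1 v2 ->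
  u1 * v2 - u2 * v1 = 1 \/ u1 * v2 - u2 * v1 = - 1.
Proof. by move=> [U [V [/nielsen_det h [<- <-] [<- <-]]]]. Qed.

Section MarkovNorm.
Variable R : realType.

Definition trace_of (l : R) : R := expR (l / 2) + expR (- (l / 2)).

(** What the estimates keep of the torus: a seminorm in coordinates, the Markov equation, and the
    relation tr(M N) + tr(M N^-1) = tr M tr N in absolute values. [trace_of] is 2 cosh(l / 2). *)
Record markov_norm (N : R -> R -> R) : Prop := MarkovNorm {
  mn_ge0 : forall x y, 0 <= N x y;
  mn_scale : forall t x y, N (t * x) (t * y) = `|t| * N x y;
  mn_triangle : forall x y x' y', N (x + x') (y + y') <= N x y + N x' y';
  mn_markov : forall u1 u2 v1 v2, good u1 u2 v1 v2 ->
    trace_of (N u1%:~R u2%:~R) ^+ 2 + trace_of (N v1%:~R v2%:~R) ^+ 2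
    + trace_of (N (u1 + v1)%:~R (u2 + v2)%:~R) ^+ 2
    = trace_of (N u1%:~R u2%:~R) * trace_of (N v1%:~R v2%:~R)
      * trace_of (N (u1 + v1)%:~R (u2 + v2)%:~R);
  mn_sum : forall u1 u2 v1 v2, good u1 u2 v1 v2 ->
    trace_of (N (u1 + v1)%:~R (u2 + v2)%:~R)
    + trace_of (N (u1 - v1)%:~R (u2 - v2)%:~R)
    = trace_of (N u1%:~R u2%:~R) * trace_of (N v1%:~R v2%:~R) }.

Definition vec (x y : R) : 'rV[R]_2 := \row_j (if j == 0 then x else y).

Lemma vecE (v : 'rV[R]_2) : vec (v 0 0) (v 0 1) = v.
Proof.
apply/rowP=> -[[|[|//]] h]; rewrite mxE /=.
  by congr (v 0 _); apply/val_inj.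
by congr (v 0 _); apply/val_inj.
Qed.

Lemma vecD x y x' y' : vec (x + x') (y + y') = vec x y + vec x' y'.
Proof. by apply/rowP=> i; rewrite !mxE; case: eqP. Qed.

Lemma vecZ t x y : vec (t * x) (t * y) = t *: vec x y.
Proof. by apply/rowP=> i; rewrite !mxE; case: eqP. Qed.

Lemma mcshane_rivin_markov (X : marked_torus R) n : is_mcshane_rivin_norm X n ->
  markov_norm (fun x y => n (vec x y)) /\
  forall U V, nielsen U V ->
    trace_of (n (vec (homology U 0 0)%:~R (homology U 0 1)%:~R))
    = `|\tr (holonomy X U)|.
Proof.
move=> [[n0 ndef nZ nD] nX].
have trE U V : nielsen U V ->
    trace_of (n (vec (homology U 0 0)%:~R (homology U 0 1)%:~R))
    = `|\tr (holonomy X U)|.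
  move=> h; have [_ U4 _ _] := nielsen_trace X h.
  rewrite -exp_geodesic_length // /trace_of.
  rewrite -(nX (homology U) U (nielsen_primitive h) (nielsen_simple h) erefl).
  have -> : vec (homology U 0 0)%:~R (homology U 0 1)%:~R = map_mx intr
    (homology U).
    by rewrite -[RHS]vecE [map_mx _ _ 0 0]mxE [map_mx _ _ 0 1]mxE.
  by [].
split=> //; split.
- by move=> x y; apply: n0.
- by move=> t x y; rewrite vecZ nZ.
- by move=> *; rewrite vecD nD.
- move=> u1 u2 v1 v2 [U [V [h [<- <-] [<- <-]]]].
  have hm := nielsen_swap (nielsen_mul h).
  have := trE _ _ hm; rewrite homology_cat ![(homology U + _) _ _]mxE => ->.
  rewrite (trE _ _ h) (trE _ _ (nielsen_swap h)).
  have [e U4 V4 UV4] := nielsen_trace X h.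
  rewrite !real_normK ?num_real // e -!normrM ger0_norm // -e.
  by rewrite !addr_ge0 ?sqr_ge0.
- move=> u1 u2 v1 v2 [U [V [h [<- <-] [<- <-]]]].
  have hm := nielsen_swap (nielsen_mul h).
  have hV := nielsen_inv (nielsen_swap h).
  have hm' := nielsen_swap (nielsen_mul (nielsen_swap hV)).
  have := trE _ _ hm; rewrite homology_cat ![(homology U + _) _ _]mxE => ->.
  have := trE _ _ hm'; rewrite homology_cat homology_winv ![(homology U - _) _
    _]mxE.
  rewrite ![(- homology V) _ _]mxE => ->.
  rewrite (trE _ _ h) (trE _ _ (nielsen_swap h)).
  have [e U4 V4 UV4] := nielsen_trace X h.
  have [e' _ _ _] := nielsen_trace X (nielsen_swap hV).
  move: e'; rewrite !holonomy_cat holonomy_winv tr_inv ?det1_holonomy //.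
  move: e UV4; rewrite holonomy_cat tr_mulC [\tr (_ * _^-1)]tr_mulC tr_mulV
    ?det1_holonomy //.
  rewrite -holonomy_cat.
  set x := \tr _ in U4 *; set y := \tr _ in V4 *; set z := \tr _.
  move=> e z4 e'; rewrite -[in RHS]normrM [x * y]mulrC.
  (* Lengths see only the absolute values of traces. As x y z is a sum of squares, z has the sign of
     x y, and y x - z has it for the same reason; so the absolute values add up. *)
  have xy0 : x * y != 0 by apply/eqP => h0; nra.
  case: (ltrgt0P (x * y)) xy0 => // xy _.
    have z0 : 0 < z by rewrite -(pmulr_rgt0 _ xy) -e; nra.
    have z'0 : 0 < y * x - z by rewrite -(pmulr_rgt0 _ xy) -e'; nra.
    by rewrite !gtr0_norm // ?[y * x]mulrC //; ring.
  have z0 : z < 0 by rewrite -(nmulr_rgt0 _ xy) -e; nra.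
  have z'0 : y * x - z < 0 by rewrite -(nmulr_rgt0 _ xy) -e'; nra.
  by rewrite !ltr0_norm // ?[y * x]mulrC //; ring.
Qed.

End MarkovNorm.

(** * Supporting lines at rational points *)

Section Support.
Variables (R : realType) (N : R -> R -> R).
Hypothesis mn : markov_norm N.
Implicit Types (x y t l k : R) (u v : int).
Local Notation n u1 u2 := (N u1%:~R u2%:~R).
Local Notation T := trace_of.

Lemma norm_opp x y : N (- x) (- y) = N x y.
Proof. by rewrite -(mulN1r x) -(mulN1r y) (mn_scale mn) normrN normr1 mul1r.
  Qed.

Lemma norm_scale_ge0 t x y : 0 <= t -> N (t * x) (t * y) = t * N x y.
Proof. by move=> t0; rewrite (mn_scale mn) ger0_norm. Qed.

Lemma norm_int_opp (u1 u2 : int) : n (- u1) (- u2) = n u1 u2.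
Proof. by rewrite !mulrNz norm_opp. Qed.

Lemma trace_of_ge2 l : 2 <= T l.
Proof.
rewrite /trace_of expRN; have := expR_gt0 (l / 2); set e := expR _ => e0.
have en0 : e != 0 by rewrite gt_eqF.
rewrite -subr_ge0 (_ : e + e^-1 - 2 = (e - 1) ^+ 2 / e); last by field.
by rewrite divr_ge0 ?sqr_ge0 // ltW.
Qed.

Lemma trace_of_le l k : 0 <= l -> l <= k -> T l <= T k.
Proof.
move=> l0 lk; rewrite /trace_of !expRN.
have e1 : 1 <= expR (l / 2) by rewrite -[X in X <= _]expR0 ler_expR; lra.
have ek : expR (l / 2) <= expR (k / 2) by rewrite ler_expR; lra.
set e := expR (l / 2) in e1 ek *; set f := expR (k / 2) in ek *.
have [e0 f0] : e != 0 /\ f != 0 by split; rewrite gt_eqF //; lra.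
rewrite -subr_ge0 (_ : _ - _ = (f - e) * (e * f - 1) / (e * f)); last by field;
  rewrite e0 f0.
by rewrite divr_ge0 ?mulr_ge0 ?subr_ge0 //; nra.
Qed.

(** A vanishing norm would mean trace 2, whereas all traces of a Markov triple exceed 2. *)
Lemma good_norm_gt0 u1 u2 v1 v2 : good u1 u2 v1 v2 -> 0 < n u1 u2.
Proof.
move=> h; rewrite lt0r (mn_ge0 mn) andbT; apply/eqP => n0.
have := mn_markov mn h; have := trace_of_ge2 (n u1 u2).
set x := T (n u1 u2) => x2 e.
have [|_ + _ _] := @fricke_tripleP R x (T (n v1 v2)) _ _ e.
  by apply/eqP; lra.
by rewrite /x n0 /trace_of mul0r oppr0 expR0; lra.
Qed.

Definition eigen u1 u2 : R := expR (n u1 u2 / 2).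

(** The traces of v + j u satisfy a linear recurrence with characteristic roots lam and 1 / lam.
    This is the coefficient of lam^j, solved from j = 0 and j = 1; that of lam^(-j) is the same
    expression for - v. *)
Definition coef (u1 u2 v1 v2 : int) : R :=
  (T (n (u1 + v1) (u2 + v2)) - T (n v1 v2) / eigen u1 u2)
  / (eigen u1 u2 - (eigen u1 u2)^-1).

Section Pair.
Variables u1 u2 v1 v2 : int.
Hypothesis uv : good u1 u2 v1 v2.
Local Notation lam := (eigen u1 u2).
Local Notation A := (coef u1 u2 v1 v2).
Local Notation B := (coef u1 u2 (- v1) (- v2)).

Lemma eigen_gt1 : 1 < lam.
Proof. by rewrite -[X in X < _]expR0 ltr_expR divr_gt0 //
  (good_norm_gt0 uv). Qed.

Lemma trace_eigen : T (n u1 u2) = lam + lam^-1.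
Proof. by rewrite /trace_of expRN. Qed.

Lemma eigen_gap_gt0 : 0 < lam - lam^-1.
Proof.
have l1 := eigen_gt1; rewrite subr_gt0; apply: lt_trans (l1).
by rewrite invf_lt1 //; lra.
Qed.

Lemma coef_sum : A + B = T (n v1 v2).
Proof.
have := mn_sum mn uv; have d0 := eigen_gap_gt0; have l1 := eigen_gt1.
rewrite trace_eigen /coef norm_int_opp => e.
have -> : T (n (u1 - v1) (u2 - v2)) =
  (lam + lam^-1) * T (n v1 v2) - T (n (u1 + v1) (u2 + v2)) by lra.
have ln0 : lam != 0 by apply/eqP; lra.
have dn0 : lam * lam - 1 != 0 by apply/eqP; nra.
by field; rewrite ln0 dn0.
Qed.

(** The Markov equation eliminates v. The value is coth(n(u) / 2)^2. *)
Lemma coef_prod : A * B = ((lam ^+ 2 + 1) / (lam ^+ 2 - 1)) ^+ 2.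
Proof.
have := mn_sum mn uv; have := mn_markov mn uv.
have d0 := eigen_gap_gt0; have l1 := eigen_gt1.
rewrite trace_eigen /coef norm_int_opp => em es.
have -> : T (n (u1 - v1) (u2 - v2)) =
  (lam + lam^-1) * T (n v1 v2) - T (n (u1 + v1) (u2 + v2)) by lra.
have ln0 : lam != 0 by apply/eqP; lra.
have dn0 : lam * lam - 1 != 0 by apply/eqP; nra.
set t0 := T (n v1 v2) in em *; set t1 := T _ in em *.
transitivity (((lam + lam^-1) * t0 * t1 - t1 ^+ 2 - t0 ^+ 2)
  / (lam - lam^-1) ^+ 2); first by field; rewrite ln0 dn0.
by rewrite -em; field; rewrite ln0 dn0.
Qed.

Lemma coef_prod_gt1 : 1 < A * B.
Proof.
have l1 := eigen_gt1; rewrite coef_prod exprn_egt1 // ltr_pdivlMr; nra.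
Qed.

Lemma coef_gt0 : 0 < A.
Proof.
have p := coef_prod_gt1; have s := coef_sum; have t := trace_of_ge2 (n v1 v2).
by rewrite ltNge; apply/negP => A0; nra.
Qed.

Lemma good_iter j : good u1 u2 (v1 + u1 *+ j) (v2 + u2 *+ j).
Proof.
elim: j => [|j IH]; first by rewrite !mulr0n !addr0.
by rewrite !mulrSr !addrA ![_ + u1]addrC ![_ + u2]addrC; apply: good_add.
Qed.

Lemma trace_iter j :
  T (n (v1 + u1 *+ j) (v2 + u2 *+ j)) = A * lam ^+ j + B * lam ^- j.
Proof.
have d0 := eigen_gap_gt0; have l1 := eigen_gt1.
have ln0 : lam != 0 by apply/eqP; lra.
suff [] : T (n (v1 + u1 *+ j) (v2 + u2 *+ j)) = A * lam ^+ j + B * lam ^- j /\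
  T (n (v1 + u1 *+ j.+1) (v2 + u2 *+ j.+1)) = A * lam ^+ j.+1 + B * lam ^- j.+1
    by [].
elim: j => [|j [IH1 IH2]].
  rewrite !mulr0n !mulr1n !addr0 expr0 expr1 invr1 !mulr1 -coef_sum; split=> //.
  transitivity (A * (lam - lam^-1) + T (n v1 v2) / lam); last first.
    by rewrite -coef_sum; field.
  by rewrite /coef divfK ?gt_eqF // subrK addrC [v2 + _]addrC.
split=> //.
have := mn_sum mn (good_iter j.+1).
rewrite -(norm_int_opp (u1 - _)) !opprB IH2 trace_eigen.
have -> : v1 + u1 *+ j.+1 - u1 = v1 + u1 *+ j by rewrite mulrSr; ring.
have -> : v2 + u2 *+ j.+1 - u2 = v2 + u2 *+ j by rewrite mulrSr; ring.
have -> : u1 + (v1 + u1 *+ j.+1) = v1 + u1 *+ j.+2 by rewrite [in RHS]mulrSr;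
  ring.
have -> : u2 + (v2 + u2 *+ j.+1) = v2 + u2 *+ j.+2 by rewrite [in RHS]mulrSr;
  ring.
rewrite IH1 => e; apply: (addIr (A * lam ^+ j + B * lam ^- j)); rewrite e.
have lj0 : lam ^+ j != 0 by rewrite expf_neq0.
by rewrite !exprS; field; rewrite ln0 lj0.
Qed.

(** The limit of n(v + j u) - j n(u) as j grows. *)
Definition intercept : R := 2 * ln A.

(** For y = A lam^j the trace is y + A B / y, more than y + 1 / y since A B > 1. As e + 1 / e
    increases for e >= 1, exp(m / 2) cannot be below y. *)
Lemma intercept_nat j : n u1 u2 *+ j + intercept <= n (v1 + u1 *+ j) (v2 + u2
  *+ j).
Proof.
have l1 := eigen_gt1; have A0 := coef_gt0; have AB := coef_prod_gt1.
have lj : 0 < lam ^+ j by rewrite exprn_gt0 //; lra.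
have := trace_iter j; rewrite /trace_of expRN; set m := n (v1 + _) _.
have e1 : 1 <= expR (m / 2).
  by rewrite -[X in X <= _]expR0 ler_expR divr_ge0 // (mn_ge0 mn).
set e := expR _ in e1 *.
have en0 : e != 0 by apply/eqP; lra.
set y := A * lam ^+ j; have y0 : 0 < y by rewrite mulr_gt0.
have [yn0 An0 ln0] : [/\ y != 0, A != 0 & lam ^+ j != 0] by rewrite !gt_eqF.
rewrite (_ : B * lam ^- j = A * B / y); last by rewrite /y; field;
  rewrite An0 ln0.
move=> eq1.
have ye : y <= e.
  rewrite leNgt; apply/negP => ey.
  have : e + e^-1 < y + A * B / y; last by rewrite eq1 ltxx.
  apply: (@lt_trans _ _ (y + y^-1)); last first.
    by rewrite ltrD2l -[X in X < _]mul1r ltr_pM2r // invr_gt0.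
  rewrite -subr_gt0 (_ : _ - _ = (y - e) * (e * y - 1) / (e * y));
    last by field; rewrite yn0 en0.
  have e0 : 0 < e by lra.
  have ey1 : 1 < e * y by apply: (@lt_le_trans _ _ y);
    [lra | rewrite ler_peMl // ltW].
  by apply: divr_gt0; apply: mulr_gt0; rewrite ?subr_gt0.
have : ln y <= m / 2 by rewrite -[m / 2]expRK ler_ln ?posrE // expR_gt0.
rewrite /y lnM ?posrE // lnXn ?(lt_trans _ l1) // /eigen expRK /intercept.
by rewrite -[_ *+ j]mulr_natr -[n u1 u2 *+ j]mulr_natr; lra.
Qed.

End Pair.
End Support.

(** * Exponential estimates for corners and chords *)

Section SupportEstimates.
Variables (R : realType) (N : R -> R -> R).
Hypothesis mn : markov_norm N.
Implicit Types (x y t l k : R) (u v : int).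
Local Notation n u1 u2 := (N u1%:~R u2%:~R).
Local Notation T := trace_of.
Local Notation lam u1 u2 := (eigen N u1 u2).
Local Notation A := (coef N).
Local Notation c := (intercept N).

Lemma good_oppr u1 u2 v1 v2 : good u1 u2 v1 v2 -> good u1 u2 (- v1) (- v2).
Proof. by move=> h; apply/good_swap/good_opp/good_swap. Qed.

Lemma eigen_sqr u1 u2 : lam u1 u2 ^+ 2 = expR (n u1 u2).
Proof. by rewrite expr2 -expRD -splitr. Qed.

Lemma ln_ge1BV x : 0 < x -> 1 - x^-1 <= ln x.
Proof.
move=> x0; have := @le_ln1Dx R (x^-1 - 1).
have xV : 0 < x^-1 by rewrite invr_gt0.
rewrite (_ : 1 + (x^-1 - 1) = x^-1); last by ring.
by rewrite lnV ?posrE // => h; have := h ltac:(lra); lra.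
Qed.

Lemma ln_leB1 x : 0 < x -> ln x <= x - 1.
Proof.
move=> x0; have := @le_ln1Dx R (x - 1).
by rewrite (_ : 1 + (x - 1) = x); [apply; lra | ring].
Qed.

Lemma intercept_sum u1 u2 v1 v2 : good u1 u2 v1 v2 ->
  c u1 u2 v1 v2 + c u1 u2 (- v1) (- v2)
  = 4 * ln ((expR (n u1 u2) + 1) / (expR (n u1 u2) - 1)).
Proof.
move=> h; have A0 := coef_gt0 mn h; have B0 := coef_gt0 mn (good_oppr h).
have l1 := eigen_gt1 mn h.
rewrite /intercept -mulrDr -lnM ?posrE // (coef_prod mn h) lnXn; last first.
  by rewrite divr_gt0; nra.
by rewrite eigen_sqr -mulr_natl; ring.
Qed.

Lemma intercept_sum_ge u1 u2 v1 v2 : good u1 u2 v1 v2 ->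
  4 * expR (- n u1 u2) <= c u1 u2 v1 v2 + c u1 u2 (- v1) (- v2).
Proof.
move=> h; rewrite intercept_sum //; have n0 := good_norm_gt0 mn h.
have E1 : 1 < expR (n u1 u2) by rewrite -[X in X < _]expR0 ltr_expR.
rewrite expRN; set E := expR _ in E1 *.
rewrite ler_pM2l //; apply: le_trans (ln_ge1BV _); last by rewrite divr_gt0;
  lra.
rewrite invf_div -subr_ge0.
have [En0 Ep0] : E != 0 /\ E + 1 != 0 by split; apply/eqP; lra.
rewrite (_ : _ - _ = (E - 1) / (E * (E + 1))); last by field; rewrite En0 Ep0.
by apply: divr_ge0; [lra | nra].
Qed.

(** The linear form worth n(u) at u and the intercept at v stays below the norm on the half-plane of
    u containing v. [intercept_nat] gives this at v + j u; the triangle inequality along u brings it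
    back to v + s u for every real s <= j, and homogeneity does the rest. *)
Lemma support u1 u2 v1 v2 a b : good u1 u2 v1 v2 -> (0 : R) <= a ->
  b * n u1 u2 + a * c u1 u2 v1 v2
  <= N (a * v1%:~R + b * u1%:~R) (a * v2%:~R + b * u2%:~R).
Proof.
move=> h; rewrite [0 <= a]le_eqVlt => /orP[/eqP <-|a0].
  rewrite !mul0r !add0r addr0 (mn_scale mn) ler_wpM2r ?(mn_ge0 mn) //.
  exact: ler_norm.
pose s := b / a.
have es : s * n u1 u2 + c u1 u2 v1 v2
    <= N (v1%:~R + s * u1%:~R) (v2%:~R + s * u2%:~R).
  pose j := (Num.truncn `|s|).+1.
  have sj : s <= j%:R.
    by apply: le_trans (ler_norm s) _; rewrite ltW // /j truncnS_gt.
  have := intercept_nat mn h j.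
  have cE (x y : int) : (x + y *+ j)%:~R = x%:~R + j%:R * y%:~R :> R.
    by rewrite rmorphD rmorphMn /= mulr_natl.
  rewrite !cE -[n u1 u2 *+ j]mulr_natl => ej.
  have := mn_triangle mn (v1%:~R + s * u1%:~R) (v2%:~R + s * u2%:~R)
    ((j%:R - s) * u1%:~R) ((j%:R - s) * u2%:~R).
  rewrite norm_scale_ge0 ?subr_ge0 //.
  have sE x y : x + s * y + (j%:R - s) * y = x + j%:R * y by ring.
  by rewrite !sE => e; lra.
have -> : b * n u1 u2 + a * c u1 u2 v1 v2 = a * (s * n u1 u2 + c u1 u2 v1 v2).
  by rewrite /s; field; rewrite gt_eqF.
have sE x y : a * x + b * y = a * (x + s * y) by rewrite /s; field;
  rewrite gt_eqF.
by rewrite !sE norm_scale_ge0 ?(ltW a0) // ler_pM2l.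
Qed.

(* The excess a = exp(n(v)/2) satisfies (a - A)(a - B) = AB - 1, which is
   4 E / (E - 1)^2 with E = exp(n(u)). *)
Lemma intercept_gap u1 u2 v1 v2 : good u1 u2 v1 v2 ->
  n (u1 - v1) (u2 - v2) <= n (u1 + v1) (u2 + v2) ->
  1 <= n u1 u2 -> 1 <= n v1 v2 ->
  n v1 v2 - c u1 u2 v1 v2 <= 256 * expR (- (n u1 u2 + n v1 v2)).
Proof.
move=> h acute nu1 nv1.
have l1 := eigen_gt1 mn h; have d0 := eigen_gap_gt0 mn h.
have A0 := coef_gt0 mn h; have AB := coef_sum mn h; have pAB := coef_prod mn h.
set B := A u1 u2 (- v1) (- v2) in AB pAB.
(* As n(u - v) <= n(u + v), B is the smaller coefficient, at most (a + 1 / a) / 2 <= 3 a / 4. Hence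
   a - B >= a / 4, and the product formula bounds a - A. *)
have BA : B <= A u1 u2 v1 v2.
  rewrite /B /coef ler_pM2r ?invr_gt0 // norm_int_opp // lerD2r.
  by apply: trace_of_le => //; apply: (mn_ge0 mn).
rewrite eigen_sqr in pAB.
have e2 x : 1 <= x -> 2 <= expR x.
  by move=> x1; apply: le_trans (expR_ge1Dx x); lra.
have E2 := e2 _ nu1; set E := expR (n u1 u2) in pAB E2.
move: AB; rewrite /trace_of expRN.
have a2 : expR (n v1 v2 / 2) ^+ 2 = expR (n v1 v2) by rewrite expr2 -expRD
  -splitr.
have := e2 _ nv1; rewrite -a2; set a := expR _ => a22 AB.
have a1 : 1 < a by have := expR_gt0 (n v1 v2 / 2); rewrite -/a; nra.
set A' := A _ _ _ _ in A0 AB pAB BA *.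
have an0 : a != 0 by apply/eqP; lra.
have Em0 : E - 1 != 0 by apply/eqP; lra.
have En0 : E != 0 by apply/eqP; lra.
have prod : (a - A') * (a - B) = 4 * E / (E - 1) ^+ 2.
  rewrite (_ : (a - A') * (a - B) = A' * B - (A' + B) * a + a ^+ 2);
    last by ring.
  by rewrite pAB AB; field; rewrite an0 Em0.
have aV : a^-1 <= a / 2.
  by rewrite -subr_ge0 (_ : _ - _ = (a ^+ 2 - 2) / (2 * a)) ?divr_ge0 //;
    [lra|lra|field].
have aB : a / 4 <= a - B by lra.
have EE : 4 * E / (E - 1) ^+ 2 <= 16 / E.
  rewrite -subr_ge0 (_ : _ - _ = 4 * (4 * (E - 1) ^+ 2 - E ^+ 2) / (E * (E - 1)
    ^+ 2)); last first.
    by field; rewrite ?Em0 ?En0.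
  by apply: divr_ge0; [nra | apply: mulr_ge0; [lra | apply: sqr_ge0]].
have E0 : 0 < E^-1 by rewrite invr_gt0; lra.
have diff : a - A' <= 64 / (E * a).
  have [aA|aA] := leP a A'.
    by apply: (@le_trans _ _ 0); [lra | apply: divr_ge0; nra].
  have : (a - A') * (a / 4) <= 16 / E by rewrite -prod in EE; nra.
  move=> q; rewrite invfM mulrA ler_pdivlMr; lra.
have aV0 : 0 < a^-1 by rewrite invr_gt0; lra.
have A2 : a / 2 <= A' by lra.
have -> : n v1 v2 = 2 * ln a by rewrite /a expRK; lra.
have -> : 2 * ln a - c u1 u2 v1 v2 = 2 * ln (a / A').
  by rewrite /intercept lnM ?lnV ?posrE ?invr_gt0 //; [rewrite -/A';
    ring | lra].
rewrite opprD expRD.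
have -> : expR (- (2 * ln a)) = a ^- 2.
  rewrite expRN; congr (_^-1).
  by rewrite mulr_natl mulr2n expRD lnK ?posrE ?expr2 //; lra.
rewrite expRN -/E.
have : ln (a / A') <= a / A' - 1 by apply: ln_leB1; rewrite divr_gt0 //; lra.
have -> : a / A' - 1 = (a - A') / A' by field; rewrite gt_eqF.
move=> lnle.
have : (a - A') / A' <= 128 * E^-1 * a ^- 2; last by lra.
rewrite ler_pdivrMr //; apply: le_trans diff _.
rewrite (_ : 64 / (E * a) = 128 * E^-1 * a ^- 2 * (a / 2)); last by field;
  rewrite an0 En0.
by rewrite ler_pM2l // !mulr_gt0 // invr_gt0 exprn_gt0 //; lra.
Qed.

End SupportEstimates.

(** * Farey paths *)

Section Path.
Variable R : realType.
Implicit Types (x y t c k : R).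

Lemma sqr1_norm (s : R) : s ^+ 2 = 1 -> `|s| = 1.
Proof.
by move=> s1; apply/eqP;
  rewrite -(eqrXn2 (n := 2)) // real_normK ?num_real // s1 expr1n.
Qed.

Definition irrational_point (p1 p2 : R) : Prop :=
  forall w1 w2 : int, (w1, w2) != (0, 0) -> p1 * w2%:~R - p2 * w1%:~R != 0.

Lemma good_neq0 u1 u2 v1 v2 : good u1 u2 v1 v2 -> (u1, u2) != (0, 0).
Proof. by move=> /good_det h; apply/eqP => -[e1 e2]; move: h;
  rewrite e1 e2 => -[]; lia. Qed.

Section Functional.
Variables (p1 p2 l1 l2 s : R).
Hypothesis irr : irrational_point p1 p2.
Hypothesis lp : l1 * p1 + l2 * p2 = 1.
Hypothesis s1 : s ^+ 2 = 1.

Local Notation m u1 u2 := (l1 * u1%:~R + l2 * u2%:~R).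
Local Notation X u1 u2 := (s * (p1 * u2%:~R - p2 * u1%:~R)).

(* A Farey pair whose cone contains p, with v on the side of p selected by s. *)
Definition enclosing c (u1 u2 v1 v2 : int) : Prop :=
  [/\ good u1 u2 v1 v2, X u1 u2 < 0, 0 < X v1 v2, c <= m u1 u2 & c <= m v1 v2].

Lemma side_neq0 u1 u2 v1 v2 : good u1 u2 v1 v2 -> X u1 u2 != 0.
Proof.
move=> /good_neq0 /irr h; rewrite mulf_neq0 //.
by apply/eqP => s0; move: s1; rewrite s0 expr0n /= => /esym/eqP;
  rewrite oner_eq0.
Qed.

(** The left side is s l(p) det(u, v), hence 1 or -1, and the signs required by [enclosing] make it
    positive. *)
Lemma enclosing_det c u1 u2 v1 v2 : 0 < c -> enclosing c u1 u2 v1 v2 ->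
  m u1 u2 * X v1 v2 - X u1 u2 * m v1 v2 = 1.
Proof.
move=> c0 [/good_det h Xu Xv mu mv].
have e : m u1 u2 * X v1 v2 - X u1 u2 * m v1 v2
    = s * (l1 * p1 + l2 * p2) * (u1 * v2 - u2 * v1)%:~R.
  by rewrite rmorphB !rmorphM /=; ring.
have pos : 0 < m u1 u2 * X v1 v2 - X u1 u2 * m v1 v2.
  by rewrite subr_gt0; apply: (@lt_trans _ _ 0);
    [rewrite nmulr_rlt0|rewrite mulr_gt0]; lra.
have sq : (m u1 u2 * X v1 v2 - X u1 u2 * m v1 v2) ^+ 2 = 1.
  rewrite e lp mulr1 exprMn s1 mul1r.
  by case: h => ->; rewrite ?mulrN1z ?sqrrN expr1n.
by move: sq => /eqP; rewrite sqrf_eq1 => /orP[/eqP -> //|/eqP e']; lra.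
Qed.

Lemma good_addl u1 u2 v1 v2 : good u1 u2 v1 v2 -> good (u1 + v1) (u2 + v2) v1
  v2.
Proof.
by move=> /good_swap/good_add/good_swap; rewrite [v1 + _]addrC [v2 + _]addrC.
Qed.

Lemma enclosing_mediant c u1 u2 v1 v2 : 0 < c -> enclosing c u1 u2 v1 v2 ->
  0 < X (u1 + v1) (u2 + v2) /\ enclosing c u1 u2 (u1 + v1) (u2 + v2) \/
  X (u1 + v1) (u2 + v2) < 0 /\ enclosing c (u1 + v1) (u2 + v2) v1 v2.
Proof.
move=> c0 [h Xu Xv mu mv].
have := side_neq0 (good_addl h); rewrite neq_lt => /orP[] Xw; [right|left].
  by split=> //; split=> //; [exact: good_addl|rewrite !rmorphD /=; lra].
by split=> //; split=> //; [exact: good_add|rewrite !rmorphD /=; lra].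
Qed.

(** Stern-Brocot descent towards p, stopped when a mediant on the side of v falls below the ray of
    slope t. It stops because m u + m v grows by at least c at each step, while t m u m v <= m u X v
    <= 1. *)
Lemma crossing c t u1 u2 v1 v2 : 0 < c -> 0 < t -> enclosing c u1 u2 v1 v2 ->
  t * m v1 v2 <= X v1 v2 ->
  exists u1' u2' v1' v2', [/\ enclosing c u1' u2' v1' v2',
    enclosing c u1' u2' (u1' + v1') (u2' + v2'),
    m u1 u2 <= m u1' u2' /\ m v1 v2 <= m v1' v2',
    t * m v1' v2' <= X v1' v2' &
    X (u1' + v1') (u2' + v2') < t * m (u1' + v1') (u2' + v2')].
Proof.
move=> c0 t0 enc tv.
apply: contrapT => nogoal.
suff key (k : nat) : exists u1' u2' v1' v2', [/\ enclosing c u1' u2' v1' v2',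
    m u1 u2 <= m u1' u2' /\ m v1 v2 <= m v1' v2', t * m v1' v2' <= X v1' v2' &
    k.+2%:R * c <= m u1' u2' + m v1' v2'].
  have tc : 0 < t * c ^+ 2 by rewrite mulr_gt0 ?exprn_gt0.
  have [u1' [u2' [v1' [v2' [enc' _ tv' big]]]]] :=
    key (Num.truncn (2 / (t * c ^+ 2))).
  have := enclosing_det c0 enc'; case: enc' => _ Xu Xv mu mv.
  set k := Num.truncn _ in big.
  have : 2 / (t * c ^+ 2) < k.+2%:R.
    by apply: lt_le_trans (truncnS_gt _) _; rewrite ler_nat.
  have : 2 <= k.+2%:R :> R by rewrite ler_nat.
  rewrite ltr_pdivrMr //; move: (k.+2%:R) big => K big K2 Kc.
  set a := m u1' u2' in mu big *; set b := m v1' v2' in mv tv' big *.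
  have ab : c * (K * c - c) <= a * b.
    have : 0 <= (a - c) * (b - c) by rewrite mulr_ge0; lra.
    by nra.
  move=> e.
  have h1 : t * (a * b) < 1 by nra.
  have h2 : t * (c * (K * c - c)) <= t * (a * b) by rewrite ler_wpM2l // ltW.
  have h3 : 0 <= (K - 2) * (t * c ^+ 2) by rewrite mulr_ge0; lra.
  by lra.
elim: k => [|k [a1 [a2 [b1 [b2 [enc' [mu mv] tb big]]]]]].
  exists u1, u2, v1, v2; split=> //; case: enc => *; lra.
have [[Xw enc2]|[Xw enc2]] := enclosing_mediant c0 enc'.
  have [tw|tw] := leP (t * m (a1 + b1) (a2 + b2)) (X (a1 + b1) (a2 + b2)).
    exists a1, a2, (a1 + b1), (a2 + b2); split=> //.
    - by split=> //; case: enc' => *; rewrite !rmorphD /=; lra.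
    - by case: enc' => *; rewrite !rmorphD /= -natr1; lra.
  by exfalso; apply: nogoal; exists a1, a2, b1, b2.
exists (a1 + b1), (a2 + b2), b1, b2; split=> //.
- by split=> //; case: enc' => *; rewrite !rmorphD /=; lra.
- by case: enc' => *; rewrite !rmorphD /= -natr1; lra.
Qed.

Lemma grow c K u1 u2 v1 v2 : 0 < c -> enclosing c u1 u2 v1 v2 ->
  exists u1' u2' v1' v2', [/\ enclosing c u1' u2' v1' v2',
    m u1 u2 <= m u1' u2' & K <= m v1' v2'].
Proof.
move=> c0 enc.
suff [k kK key] : exists2 k : nat, K <= k%:R * c &
   forall k : nat, exists u1' u2' v1' v2', [/\ enclosing c u1' u2' v1' v2',
    m u1 u2 <= m u1' u2' & k%:R * c <= m v1' v2'].
  have [a1 [a2 [b1 [b2 [e1 e2 e3]]]]] := key k.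
  by exists a1, a2, b1, b2; split=> //; lra.
exists (Num.truncn (K / c)).+1.
  by rewrite -ler_pdivrMr // ltW // truncnS_gt.
elim=> [|k [a1 [a2 [b1 [b2 [e1 e2 e3]]]]]].
  by exists u1, u2, v1, v2; split=> //; case: enc => *; lra.
have [_ _ Xb _ mb] := e1.
(* With the slope of the current v as t, [crossing] returns a mediant, whose value of m exceeds that
   of v by at least c. *)
have t0 : 0 < X b1 b2 / m b1 b2 by rewrite divr_gt0 //; lra.
have tb : X b1 b2 / m b1 b2 * m b1 b2 <= X b1 b2 by rewrite divfK // gt_eqF //;
  lra.
have [a1' [a2' [b1' [b2' [f1 f2 [f3 f4] f5 f6]]]]] := crossing c0 t0 e1 tb.
exists a1', a2', (a1' + b1'), (a2' + b2'); split=> //; first by lra.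
by case: f1 => *; rewrite !rmorphD /= -natr1; lra.
Qed.

(** Replacing u by u + v adds the fixed positive number X v to the negative X u, so this can be
    repeated only finitely often before the mediant changes side. *)
Lemma slide c u1 u2 v1 v2 : 0 < c -> enclosing c u1 u2 v1 v2 ->
  exists u1' u2', [/\ enclosing c u1' u2' v1 v2, 0 < X (u1' + v1) (u2' + v2) &
    m u1 u2 <= m u1' u2'].
Proof.
move=> c0 enc.
apply: contrapT => nogoal.
suff key (k : nat) : exists u1' u2', [/\ enclosing c u1' u2' v1 v2,
    X u1' u2' = X u1 u2 + k%:R * X v1 v2 & m u1 u2 <= m u1' u2'].
  have [a1 [a2 [[_ + Xv _ _] e _]]] :=
    key (Num.truncn (- X u1 u2 / X v1 v2)).+1.
  have := truncnS_gt (- X u1 u2 / X v1 v2).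
  by rewrite ltr_pdivrMr // e; lra.
elim: k => [|k [a1 [a2 [e1 e2 e3]]]].
  by exists u1, u2; rewrite mul0r addr0.
have [[Xw _]|[Xw enc2]] := enclosing_mediant c0 e1.
  by exfalso; apply: nogoal; exists a1, a2.
exists (a1 + v1), (a2 + v2); split=> //.
  by rewrite -natr1 mulrDl mul1r addrA -e2 !rmorphD /=; ring.
by case: e1 => *; rewrite !rmorphD /=; lra.
Qed.

End Functional.
End Path.

(** * Farey pairs of large height around an irrational point *)

Section Start.
Variable R : realType.
Implicit Types (x y t c k p l h s K : R).

Lemma enclosing_sym p1 p2 l1 l2 s c u1 u2 v1 v2 :
  enclosing p1 p2 l1 l2 s c u1 u2 v1 v2 ->
  enclosing p1 p2 l1 l2 (- s) c v1 v2 u1 u2.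
Proof.
move=> [h Xu Xv mu mv]; split=> //; first exact: good_swap.
- by rewrite mulNr oppr_lt0.
- by rewrite mulNr oppr_gt0.
Qed.

Lemma irrational_coord p1 p2 : irrational_point p1 p2 -> p1 != 0 /\ p2 != 0.
Proof.
move=> irr; split.
  by have := irr 0 1 isT; rewrite mulr0 subr0 mulr1.
by have := irr 1 0 isT; rewrite mulr0 sub0r mulr1 oppr_eq0.
Qed.

(** Start of the descent: the signed coordinate vectors of the quadrant of p, with the form (e1 x +
    e2 y) / (|p1| + |p2|), worth 1 at p. *)
Lemma enclosing_quadrant p1 p2 s : irrational_point p1 p2 -> s ^+ 2 = 1 ->
  exists h1 h2 c u1 u2 v1 v2, [/\ h1 * p1 + h2 * p2 = 1, 0 < c &
    enclosing p1 p2 h1 h2 s c u1 u2 v1 v2].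
Proof.
move=> irr s1; have [p10 p20] := irrational_coord irr.
have [e1 g1 a1] : exists2 e : int, e = 1 \/ e = -1 & e%:~R * p1 = `|p1|.
  case: (ltrP 0 p1) => [/ltW h|h].
    by exists 1; [left|rewrite mul1r ger0_norm].
  by exists (-1); [right|rewrite mulN1r ler0_norm].
have [e2 g2 a2] : exists2 e : int, e = 1 \/ e = -1 & e%:~R * p2 = `|p2|.
  case: (ltrP 0 p2) => [/ltW h|h].
    by exists 1; [left|rewrite mul1r ger0_norm].
  by exists (-1); [right|rewrite mulN1r ler0_norm].
have g : good e1 0 0 e2.
  have b := good_base; have b1 := good_opp b; have b2 := good_oppr b.
  have b3 := good_oppr b1; move: b1 b2 b3; rewrite !oppr0.
  by case: g1 => ->; case: g2 => ->.
have sq (e : int) : e = 1 \/ e = -1 -> (e%:~R : R) ^+ 2 = 1.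
  by case=> ->; rewrite ?mulrN1z ?sqrrN expr1n.
have [n10 n20] : 0 < `|p1| /\ 0 < `|p2| by rewrite !normr_gt0.
set d := `|p1| + `|p2|; have d0 : 0 < d by rewrite addr_gt0.
have hp : e1%:~R / d * p1 + e2%:~R / d * p2 = 1.
  transitivity ((e1%:~R * p1 + e2%:~R * p2) / d); first by ring.
  by rewrite a1 a2 divff // gt_eqF.
have m1 : d^-1 <= e1%:~R / d * e1%:~R + e2%:~R / d * 0%:~R.
  by rewrite mulr0 addr0 mulrAC -expr2 sq // mul1r.
have m2 : d^-1 <= e1%:~R / d * 0%:~R + e2%:~R / d * e2%:~R.
  by rewrite mulr0 add0r mulrAC -expr2 sq // mul1r.
pose a := s * (p1 * e2%:~R); pose b := s * (p2 * e1%:~R).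
have ab : 0 < a * b.
  rewrite (_ : a * b = s ^+ 2 * (e1%:~R * p1) * (e2%:~R * p2));
    last by rewrite /a /b; ring.
  by rewrite s1 mul1r a1 a2 mulr_gt0.
exists (e1%:~R / d), (e2%:~R / d), d^-1.
have dV0 : 0 < d^-1 by rewrite invr_gt0.
have [a0|a0|a0] := ltrgt0P a.
- have b0 : 0 < b by rewrite -(pmulr_rgt0 _ a0).
  exists e1, 0, 0, e2; split=> //; split=> //.
    by rewrite mulr0 sub0r mulrN oppr_lt0.
  by rewrite mulr0 subr0.
- have b0 : b < 0 by rewrite -(nmulr_rgt0 _ a0).
  exists 0, e2, e1, 0; split=> //; split=> //; first exact: good_swap.
    by rewrite mulr0 subr0.
  by rewrite mulr0 sub0r mulrN oppr_gt0.
- by move: ab; rewrite a0 mul0r ltxx.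
Qed.

Lemma enclosing_large p1 p2 l1 l2 s K : irrational_point p1 p2 ->
  l1 * p1 + l2 * p2 = 1 -> s ^+ 2 = 1 ->
  exists u1 u2 v1 v2, enclosing p1 p2 l1 l2 s K u1 u2 v1 v2.
Proof.
move=> irr lp s1.
have [h1 [h2 [c [u1 [u2 [v1 [v2 [hp c0 enc]]]]]]]] := enclosing_quadrant irr s1.
(* Two forms worth 1 at p differ at w by det(p, w) times a constant of absolute value q. The summand
   q pays for this, and K1 >= 1 keeps the determinants at most 1 in absolute value. *)
pose q := `|l2 * h1 - l1 * h2|; pose K1 := `|K| + q + 1.
have [q0 nK] : 0 <= q /\ 0 <= `|K| by rewrite !normr_ge0.
have [a1 [a2 [b1 [b2 [enc1 _ mb]]]]] := grow irr hp s1 K1 c0 enc.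
have sN1 : (- s) ^+ 2 = 1 by rewrite sqrrN.
have [b1' [b2' [a1' [a2' [enc2 mb' ma']]]]] :=
  grow irr hp sN1 K1 c0 (enclosing_sym enc1).
have := enclosing_sym enc2; rewrite opprK => enc3.
have det := enclosing_det hp s1 c0 enc3.
case: enc3 => g Xa Xb mca mcb; exists a1', a2', b1', b2'.
have hb : K1 <= h1 * b1'%:~R + h2 * b2'%:~R by lra.
set A := s * _ in Xa det; set B := s * _ in Xb det.
set ha := _ + _ in ma' mca det; set hb' := _ + _ in hb mcb det.
have K11 : 1 <= K1 by rewrite /K1; lra.
have A1 : - 1 <= A by nra.
have B1 : B <= 1 by nra.
have conv w1 w2 : K1 <= h1 * w1 + h2 * w2 -> `|s * (p1 * w2 - p2 * w1)| <= 1 ->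
    K <= l1 * w1 + l2 * w2.
  move=> hw Xw.
  have -> : l1 * w1 + l2 * w2 = (h1 * w1 + h2 * w2) * (l1 * p1 + l2 * p2)
      + (p1 * w2 - p2 * w1) * (l2 * h1 - l1 * h2)
      + (1 - (h1 * p1 + h2 * p2)) * (l1 * w1 + l2 * w2) by ring.
  rewrite hp lp subrr mul0r addr0 mulr1.
  have ns : `|s| = 1 by exact: sqr1_norm.
  rewrite normrM ns mul1r in Xw.
  have : `|(p1 * w2 - p2 * w1) * (l2 * h1 - l1 * h2)| <= q.
    by rewrite normrM -/q -[X in _ <= X]mul1r ler_wpM2r.
  by rewrite ler_norml => /andP[h _]; have := ler_norm K; move: hw;
    rewrite /K1; lra.
split=> //; apply: conv => //; rewrite ler_norml; apply/andP; rewrite -/A -/B;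
  split; lra.
Qed.

End Start.

(** * Boundary behaviour and Diophantine approximation *)

Section LowerBound.
Variables (R : realType) (N : R -> R -> R) (p1 p2 l1 l2 : R).
Hypothesis mn : markov_norm N.
Hypothesis irr : irrational_point p1 p2.
Hypothesis Np : N p1 p2 = 1.
Hypothesis lN : forall x y, l1 * x + l2 * y <= N x y.
Hypothesis lp : l1 * p1 + l2 * p2 = 1.
Implicit Types (x y t c k s K M C : R).
Local Notation n u1 u2 := (N u1%:~R u2%:~R).
Local Notation m u1 u2 := (l1 * u1%:~R + l2 * u2%:~R).
Local Notation X u1 u2 := (p1 * u2%:~R - p2 * u1%:~R).

(* The height of the unit sphere over the supporting line, along the rays. *)
Definition height (t : R) : R := N (p1 - t * l2) (p2 + t * l1) - 1.

(** The height is O(|t|^K), written with exp and ln so that estimates become linear in logarithms;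
    [approx_order] is logarithmic for the same reason. *)
Definition height_order K : Prop := exists C d, 0 < d /\
  forall t, t != 0 -> `|t| < d -> height t <= expR (C + K * ln `|t|).

Definition approx_order M : Prop := exists C e, 0 < e /\
  forall u1 u2 v1 v2 : int, good u1 u2 v1 v2 -> `|X u1 u2| < e ->
    - (M * ln `|X u1 u2|) <= n u1 u2 + C.

Lemma decompose1 x y : (l1 * x + l2 * y) * p1 - (p1 * y - p2 * x) * l2 = x.
Proof. by rewrite -[RHS]mul1r -lp; ring. Qed.

Lemma decompose2 x y : (l1 * x + l2 * y) * p2 + (p1 * y - p2 * x) * l1 = y.
Proof. by rewrite -[RHS]mul1r -lp; ring. Qed.

Lemma height_ge0 t : 0 <= height t.
Proof.
rewrite subr_ge0; apply: le_trans (lN _ _).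
rewrite -subr_ge0 (_ : _ - 1 = l1 * p1 + l2 * p2 - 1); last by ring.
by rewrite lp subrr.
Qed.

(** m and X are the coordinates in the basis p, (- l2, l1); if both were small, a nonzero integer
    vector would have entries below 1. *)
Lemma integer_far : exists c e, [/\ 0 < c, 0 < e &
  forall u1 u2 v1 v2 : int,
    good u1 u2 v1 v2 -> `|X u1 u2| < e -> c <= `|m u1 u2|].
Proof.
have small a b x y : `|x| < (2 * (`|a| + `|b| + 1))^-1 ->
    `|x * a| < 2^-1 /\ `|x * b| < 2^-1.
  have [a0 b0] : 0 <= `|a| /\ 0 <= `|b| by rewrite !normr_ge0.
  have d0 : 0 < 2 * (`|a| + `|b| + 1) by lra.
  rewrite -[_^-1]mul1r ltr_pdivlMr // => h; rewrite !normrM.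
  have := normr_ge0 x; move: h; set z := `|x| => h z0; split; nra.
have pos a b : 0 < (2 * (`|a| + `|b| + 1))^-1 :> R.
  by rewrite invr_gt0; have := normr_ge0 a; have := normr_ge0 b; lra.
exists (2 * (`|p1| + `|p2| + 1))^-1, (2 * (`|l1| + `|l2| + 1))^-1.
split=> // u1 u2 v1 v2 g /small; move=> /(_ 0)[xl1 xl2].
rewrite leNgt; apply/negP => /small; move=> /(_ 0)[mp1 mp2].
have int0 (w : int) : `|w%:~R : R| < 1 -> w = 0.
  by rewrite -intr_norm -[1]/(1%:~R) ltr_int; lia.
have u10 : u1 = 0.
  apply: int0; rewrite -(decompose1 u1%:~R u2%:~R).
  by apply: le_lt_trans (ler_normB _ _) _; lra.
have u20 : u2 = 0.
  apply: int0; rewrite -(decompose2 u1%:~R u2%:~R).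
  by apply: le_lt_trans (ler_normD _ _) _; lra.
by have := good_neq0 g; rewrite u10 u20 eqxx.
Qed.

(* p and p + 2 t tau lie on opposite sides of the ray of u, whose corner makes
   the average of N at these points exceed N at their midpoint. *)
Lemma corner_height u1 u2 v1 v2 : good u1 u2 v1 v2 -> 0 < m u1 u2 ->
  4 * `|X u1 u2| * expR (- n u1 u2) <= height (2 * (X u1 u2 / m u1 u2)).
Proof.
move=> g m0.
(* The sign of v is chosen so that p lies on its side of u: p = z v + y0 u with z = |X u|. *)
wlog [e ed Xe] : v1 v2 g / exists2 e : R,
  e = (u1 * v2 - u2 * v1)%:~R & 0 < - (X u1 u2 * e).
  move=> wl; have X0 := irr (good_neq0 g).
  have dt : (u1 * v2 - u2 * v1)%:~R != 0 :> R.
    by rewrite intr_eq0; case: (good_det g) => ->.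
  have := mulf_neq0 X0 dt; rewrite neq_lt => /orP[] h.
    by apply: (wl v1 v2 g); exists (u1 * v2 - u2 * v1)%:~R; rewrite // oppr_gt0.
  apply: (wl _ _ (good_oppr g)); exists (- (u1 * v2 - u2 * v1)%:~R).
    by rewrite -rmorphN /=; congr (_%:~R); ring.
  by rewrite mulrN opprK.
have e2 : e ^+ 2 = 1.
  by rewrite ed; case: (good_det g) => ->; rewrite ?mulrN1z ?sqrrN expr1n.
have eE : e = u1%:~R * v2%:~R - u2%:~R * v1%:~R by rewrite ed rmorphB !rmorphM.
set x := X u1 u2 in Xe *; set z := - (x * e).
have zx : `|x| = z.
  apply/eqP; rewrite -(eqrXn2 (n := 2)) // ?ltW // real_normK ?num_real //.
  by rewrite /z sqrrN exprMn e2 mulr1.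
(* The second point is - z v + y2 u, so that the two points add up to (2 / m u) u. The supporting
   forms for v and - v, evaluated at them, add up to the corner term. *)
pose y0 := e * X v1 v2; pose y2 := 2 / m u1 u2 - y0.
have mn0 : m u1 u2 != 0 by rewrite gt_eqF.
have P01 : z * v1%:~R + y0 * u1%:~R = p1.
  transitivity (e * (u1%:~R * v2%:~R - u2%:~R * v1%:~R) * p1).
    by rewrite /z /y0 /x; ring.
  by rewrite -eE -expr2 e2 mul1r.
have P02 : z * v2%:~R + y0 * u2%:~R = p2.
  transitivity (e * (u1%:~R * v2%:~R - u2%:~R * v1%:~R) * p2).
    by rewrite /z /y0 /x; ring.
  by rewrite -eE -expr2 e2 mul1r.
have := support mn y0 g (ltW Xe); rewrite -/z P01 P02 Np => low0.
have := support mn y2 (good_oppr g) (ltW Xe); rewrite -/z !mulrNz.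
have -> : z * - v1%:~R + y2 * u1%:~R = p1 - 2 * (x / m u1 u2) * l2.
  transitivity (2 / m u1 u2 * u1%:~R - (z * v1%:~R + y0 * u1%:~R));
    first by rewrite /y2; ring.
  by rewrite P01 -{2}(decompose1 u1%:~R u2%:~R) -/x; field.
have -> : z * - v2%:~R + y2 * u2%:~R = p2 + 2 * (x / m u1 u2) * l1.
  transitivity (2 / m u1 u2 * u2%:~R - (z * v2%:~R + y0 * u2%:~R));
    first by rewrite /y2; ring.
  by rewrite P02 -{2}(decompose2 u1%:~R u2%:~R) -/x; field.
rewrite /height; set N2 := N _ _ => low2.
have := intercept_sum_ge mn g; set cc := intercept _ _ _ _ _ + _ => hc.
have nm : 2 <= 2 / m u1 u2 * n u1 u2.
  rewrite -mulrA ler_peMr // mulrC ler_pdivlMr // mul1r; exact: lN.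
have : z * (4 * expR (- n u1 u2)) <= z * cc by rewrite ler_wpM2l // ltW.
have y2E : y2 * n u1 u2 = 2 / m u1 u2 * n u1 u2 - y0 * n u1 u2 by rewrite /y2
  mulrBl.
rewrite zx [z * cc]mulrDr; move: low0 low2 nm; rewrite y2E.
move: (2 / _ * _) (y0 * _) (z * intercept _ _ _ _ _) (z * intercept _ _ _ _ _)
  => q1 q2 q3 q4.
by lra.
Qed.

(** The corner of u is seen at the parameter 2 X / m, which is O(|X|) since m stays away from 0.
    Cancelling the factor |X| of the corner bound leaves the exponent K - 1. *)
Lemma height_approx K : 0 <= K -> height_order K -> approx_order (K - 1).
Proof.
move=> K0 [C [d [d0 hK]]]; have [c [e [c0 e0 far]]] := integer_far.
exists (C + K * ln 2 - K * ln c - ln 4), (Num.min e (d * c / 2)).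
split; first by rewrite lt_min e0 /= divr_gt0 ?mulr_gt0.
move=> u1 u2 v1 v2 g; rewrite lt_min => /andP[Xe Xd].
have cm := far _ _ _ _ g Xe.
wlog m0 : u1 u2 g Xe Xd cm / 0 < m u1 u2.
  move=> wl; have [|m0] := ltP 0 (m u1 u2); first exact: (wl u1 u2).
  have XN : X (- u1) (- u2) = - X u1 u2 by rewrite !mulrNz; ring.
  have mN : m (- u1) (- u2) = - m u1 u2 by rewrite !mulrNz; ring.
  have := wl _ _ (good_opp g); rewrite XN mN !normrN norm_int_opp //;
    apply=> //.
  rewrite oppr_gt0 lt_neqAle m0 andbT; apply/eqP => mm.
  by move: cm; rewrite mm normr0; lra.
rewrite gtr0_norm // in cm.
have X0 := irr (good_neq0 g).
have := corner_height g m0; set t := 2 * (_ / _) => corner.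
have X0' : 0 < `|X u1 u2| by rewrite normr_gt0.
have nt : `|t| = 2 * `|X u1 u2| / m u1 u2.
  by rewrite /t normrM normf_div (gtr0_norm m0) (ger0_norm (x := 2)) // mulrA.
have t0 : t != 0 by rewrite -normr_gt0 nt divr_gt0 // mulr_gt0.
have td : `|t| < d.
  rewrite nt ltr_pdivrMr //; apply: (@lt_le_trans _ _ (d * c)); first by lra.
  by rewrite ler_pM2l.
have := le_trans corner (hK t t0 td).
have -> : 4 * `|X u1 u2| * expR (- n u1 u2)
    = expR (ln 4 + ln `|X u1 u2| - n u1 u2).
  by rewrite !expRD !lnK ?posrE.
rewrite ler_expR nt lnM ?lnV ?lnM ?posrE ?invr_gt0 ?mulr_gt0 //.
have : K * ln c <= K * ln (m u1 u2) by rewrite ler_wpM2l // ler_ln ?posrE.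
by lra.
Qed.

End LowerBound.

(** Arithmetic of the chord estimate, for a Farey pair a, b, a mediant w and another neighbour c of
    w. The point of parameter t is a combination of w and b; its height H is at most the combination
    of the defects n - m, each exponentially small. *)
Lemma mediant_estimate (R : realType) (na nb nw nc mb mw mc xw xb xc t H : R) :
  0 < t -> 1 <= mw -> 1 <= mc -> mw <= nw -> mc <= nc -> nw <= na + nb ->
  nb - mb <= 256 * expR (- (na + nb)) -> nw - mw <= 256 * expR (- (nc + nw)) ->
  mc * xw - xc * mw = 1 -> mw * xb - xw * mb = 1 ->
  0 <= mb -> 0 < xw -> 0 < xc + xw -> xw <= t * mw -> t * mb <= xb ->
  H + 1 <= (xb - t * mb) * nw + (t * mw - xw) * nb ->
  H <= 512 * t * nw * expR (- nw).
Proof.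
move=> t0 mw1 mc1 mnw mnc nwab defv defw detc detw mb0 xw0 xcw xwt tb hN.
set a := xb - t * mb in hN; set b := t * mw - xw in hN.
have a0 : 0 <= a by rewrite subr_ge0.
have b0 : 0 <= b by rewrite subr_ge0.
have ab1 : a * mw + b * mb = 1 by rewrite -[RHS]detw /a /b; ring.
set ew := expR (- nw); have ew0 : 0 < ew := expR_gt0 _.
have dv : nb - mb <= 256 * ew.
  by apply: le_trans defv _; rewrite ler_pM2l ?ltr0n // ler_expR lerN2.
have mw0 : 0 < mw by apply: lt_le_trans mw1.
have tm : 0 < t * mw by rewrite mulr_gt0.
(* The determinant of (c, w) and xc > - xw give 1 <= xw (mc + mw). With xw <= t mw this bounds exp(-
   nc) <= 1 / (1 + mc) by t mw^2. *)
have dw : nw - mw <= 256 * (t * mw ^+ 2) * ew.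
  apply: le_trans defw _;
    rewrite opprD expRD -/ew mulrA ler_pM2r // ler_pM2l ?ltr0n //.
  have mc2 : 0 < 1 + mc by apply: addr_gt0 => //; exact: lt_le_trans mc1.
  apply: (@le_trans _ _ (1 + mc)^-1).
    rewrite expRN lef_pV2 ?posrE ?expR_gt0 //.
    by apply: le_trans (expR_ge1Dx _) _; rewrite ler_expR.
  rewrite -[X in X <= _]mul1r ler_pdivrMr //.
  have h1 : 1 <= xw * (mc + mw) by rewrite -[X in X <= _]detc mulrDr [xw *
    mc]mulrC lerD2l -mulNr ler_pM2r // -subr_ge0 opprK addrC ltW.
  have h2 : xw * (mc + mw) <= t * mw * (mc + mw).
    by rewrite ler_wpM2r // addr_ge0 // ltW // (lt_le_trans _ mc1).
  apply: le_trans h1 _; apply: le_trans h2 _.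
  rewrite expr2 mulrA -[X in _ <= X]mulrA ler_pM2l //;
    rewrite -subr_ge0 (_ : _ - _ = mc * (mw - 1)); last by ring.
  by rewrite mulr_ge0 ?subr_ge0 //; apply: le_trans mc1.
have am : a * mw <= 1 by rewrite -ab1 lerDl mulr_ge0.
have bm : b <= t * mw by rewrite /b gerBl ltW.
have p256 : 0 <= 256 * ew by rewrite mulr_ge0 ?ler0n // ltW.
have e1 : b * (nb - mb) <= t * mw * (256 * ew).
  by apply: (@le_trans _ _ (b * (256 * ew)));
    [rewrite ler_wpM2l|rewrite ler_wpM2r].
have e2 : a * (nw - mw) <= t * mw * (256 * ew).
  apply: (@le_trans _ _ (a * (256 * (t * mw ^+ 2) * ew)));
    first by rewrite ler_wpM2l.
  rewrite (_ : a * _ = a * mw * (t * mw * (256 * ew))); last by ring.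
  exact: ler_piMl (mulr_ge0 (ltW tm) p256) am.
have e3 : t * mw * (256 * ew) <= t * nw * (256 * ew) by rewrite ler_wpM2r //
  ler_pM2l.
have e4 : H + 1 <= a * (nw - mw) + b * (nb - mb) + 1.
  by apply: le_trans hN _; rewrite -[in X in _ <= X]ab1 le_eqVlt; apply/orP;
    left; apply/eqP; ring.
have -> : 512 * t * nw * ew = 2 * (t * nw * (256 * ew)) by ring.
by clear - e1 e2 e3 e4; lra.
Qed.

(** * Upper bounds for the height *)

Section UpperBound.
Variables (R : realType) (N : R -> R -> R) (p1 p2 l1 l2 : R).
Hypothesis mn : markov_norm N.
Hypothesis irr : irrational_point p1 p2.
Hypothesis Np : N p1 p2 = 1.
Hypothesis lN : forall x y, l1 * x + l2 * y <= N x y.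
Hypothesis lp : l1 * p1 + l2 * p2 = 1.
Implicit Types (x y t c k s K M C : R).
Local Notation n u1 u2 := (N u1%:~R u2%:~R).
Local Notation m u1 u2 := (l1 * u1%:~R + l2 * u2%:~R).
Local Notation X u1 u2 := (p1 * u2%:~R - p2 * u1%:~R).
Local Notation ht := (height N p1 p2 l1 l2).
Local Notation enclosing := (enclosing p1 p2 l1 l2).

Section Enclosing.
Variables (s K : R).
Hypotheses (s1 : s ^+ 2 = 1) (K1 : 1 <= K) (Ktau : N (- l2) l1 <= K ^+ 2).

(** Write u - v = a p + b (- l2, l1). Then |a| <= m u + m v - 2 K, and the determinant relation
    gives K |b| <= 1, so that by [Ktau] the second term has norm at most K. The sum is below l(u +
    v). *)
Lemma enclosing_acute u1 u2 v1 v2 : enclosing s K u1 u2 v1 v2 ->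
  n (u1 - v1) (u2 - v2) <= n (u1 + v1) (u2 + v2).
Proof.
move=> enc; have K1_ := K1; have K0 : 0 < K by apply: lt_le_trans K1;
  rewrite ltr01.
have det := enclosing_det lp s1 K0 enc; case: enc => g Xu Xv mu mv.
have ns : `|s| = 1 by exact: sqr1_norm.
have := lN (u1 + v1)%:~R (u2 + v2)%:~R; rewrite !rmorphD /= => low.
apply: le_trans low; rewrite !rmorphN /=.
rewrite -{1}(decompose1 lp (u1%:~R - v1%:~R) (u2%:~R - v2%:~R)).
rewrite -{3}(decompose2 lp (u1%:~R - v1%:~R) (u2%:~R - v2%:~R)).
set a := l1 * _ + _; set b := p1 * _ - _.
rewrite -[- (b * l2)]mulrN; apply: le_trans (mn_triangle mn _ _ _ _) _.
rewrite !(mn_scale mn) Np mulr1.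
have aE : a = m u1 u2 - m v1 v2 by rewrite /a; ring.
have bE : `|b| = s * X v1 v2 - s * X u1 u2.
  have -> : `|b| = `|s * b| by rewrite normrM ns mul1r.
  rewrite (_ : s * b = s * X u1 u2 - s * X v1 v2); last by rewrite /b; ring.
  by rewrite ltr0_norm ?opprB //; lra.
have bK : K * `|b| <= 1 by rewrite bE; nra.
have bt : `|b| * N (- l2) l1 <= K.
  apply: (@le_trans _ _ (`|b| * K ^+ 2)); first by rewrite ler_wpM2l.
  by rewrite expr2; nra.
have : `|a| <= m u1 u2 + m v1 v2 - 2 * K.
  by rewrite aE ler_norml; apply/andP; split; lra.
by lra.
Qed.

(** p is a positive combination of u and v, and the supporting form of the pair is at most N p = 1 =
    l(p) there. Being n(u) >= l(u) at u, it is at most l(v) at v; so the defect is at most the gap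
    between n(v) and the intercept. *)
Lemma enclosing_defect u1 u2 v1 v2 : enclosing s K u1 u2 v1 v2 ->
  n v1 v2 - m v1 v2 <= 256 * expR (- (n u1 u2 + n v1 v2)).
Proof.
move=> enc; have K1_ := K1; have K0 : 0 < K by apply: lt_le_trans K1;
  rewrite ltr01.
have acute := enclosing_acute enc.
have det := enclosing_det lp s1 K0 enc; case: enc => g Xu Xv mu mv.
have lu := lN u1%:~R u2%:~R; have lv := lN v1%:~R v2%:~R.
apply: le_trans (intercept_gap mn g acute _ _); [|lra|lra].
rewrite lerD2l lerN2.
have := support mn (s * X v1 v2) g (ltW (_ : 0 < - (s * X u1 u2))).
rewrite oppr_gt0 => /(_ Xu).
have dblE x y : - (s * X u1 u2) * x + s * X v1 v2 * y
   = s * (X v1 v2 * y - X u1 u2 * x) by ring.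
rewrite !dblE.
have dE : s * (u1%:~R * v2%:~R - u2%:~R * v1%:~R) = 1.
  rewrite -[RHS]det.
  transitivity (s * (l1 * p1 + l2 * p2) * (u1%:~R * v2%:~R - u2%:~R * v1%:~R)).
    by rewrite lp mulr1.
  by ring.
have -> : s * (X v1 v2 * u1%:~R - X u1 u2 * v1%:~R) = p1.
  by rewrite -[RHS]mulr1 -[Z in _ = _ * Z]dE; ring.
have -> : s * (X v1 v2 * u2%:~R - X u1 u2 * v2%:~R) = p2.
  by rewrite -[RHS]mulr1 -[Z in _ = _ * Z]dE; ring.
rewrite Np -[Z in _ <= Z]det => h.
have h2 : s * X v1 v2 * m u1 u2 <= s * X v1 v2 * n u1 u2 by rewrite ler_pM2l.
have : - (s * X u1 u2) * intercept N u1 u2 v1 v2 <= - (s * X u1 u2) * m v1 v2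
  by lra.
by rewrite ler_pM2l // oppr_gt0.
Qed.

(** The ray of parameter s t passes between the mediant w found by [crossing] and its parent;
    [slide] supplies a second pair containing w, which controls the defect of w. *)
Lemma height_le u1 u2 v1 v2 t : enclosing s K u1 u2 v1 v2 -> 0 < t ->
  t * m v1 v2 <= s * X v1 v2 ->
  exists w1 w2 z1 z2, [/\ good w1 w2 z1 z2, m v1 v2 <= m w1 w2,
    0 < s * X w1 w2 /\ s * X w1 w2 <= t * m w1 w2, K * (s * X w1 w2) <= 1 &
    ht (s * t) <= 512 * t * n w1 w2 * expR (- n w1 w2)].
Proof.
move=> enc0 t0 tv0; have K1_ := K1; have K0 : 0 < K by apply: lt_le_trans K1;
  rewrite ltr01.
have [a1 [a2 [b1 [b2 [encv encw [_ mvb] tb wt]]]]] :=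
  crossing irr lp s1 K0 t0 enc0 tv0.
have [c1 [c2 [encc Xcw _]]] := slide irr s1 K0 encw.
have defv := enclosing_defect encv; have defw := enclosing_defect encc.
have detv := enclosing_det lp s1 K0 encv;
  have detc := enclosing_det lp s1 K0 encc.
have tri := mn_triangle mn a1%:~R a2%:~R b1%:~R b2%:~R.
rewrite -!rmorphD /= in tri.
have lw := lN (a1 + b1)%:~R (a2 + b2)%:~R.
have lc := lN c1%:~R c2%:~R.
have mwE : m (a1 + b1) (a2 + b2) = m a1 a2 + m b1 b2 by rewrite !rmorphD /=;
  ring.
have XwE : s * X (a1 + b1) (a2 + b2) = s * X a1 a2 + s * X b1 b2.
  by rewrite !rmorphD /=; ring.
have XcE : s * X (c1 + (a1 + b1)) (c2 + (a2 + b2))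
   = s * X c1 c2 + s * X (a1 + b1) (a2 + b2) by rewrite !rmorphD /=; ring.
rewrite XcE in Xcw.
case: encv => _ Xa Xb ma mb; case: encw => gw _ Xw _ mw;
  case: encc => _ Xc _ mc _.
exists (a1 + b1), (a2 + b2), a1, a2.
split; [exact: good_swap | by rewrite mwE; apply: le_trans mvb _;
  rewrite lerDr; exact: le_trans (ltW K0) ma | by split=> //; exact: ltW | |].
  have q1 : K * (s * X (a1 + b1) (a2 + b2)) <= m c1 c2 * (s * X (a1 + b1) (a2 +
    b2)).
    by rewrite ler_wpM2r // ltW.
  have q2 : 0 <= - (s * X c1 c2) * m (a1 + b1) (a2 + b2).
    by apply: mulr_ge0; [rewrite oppr_ge0;
      exact: ltW | exact: le_trans (ltW K0) mw].
  by lra.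
set w1 := a1 + b1 in tri lw XcE Xcw detc defw wt mwE XwE Xw mw *.
set w2 := a2 + b2 in tri lw XcE Xcw detc defw wt mwE XwE Xw mw *.
have detw : m w1 w2 * (s * X b1 b2) - s * X w1 w2 * m b1 b2 = 1.
  by rewrite mwE XwE -[RHS]detv; ring.
(* Coordinates, both nonnegative, of the point of parameter s t in the basis (w, b). *)
set a := s * X b1 b2 - t * m b1 b2; set b := t * m w1 w2 - s * X w1 w2.
have [a0 b0] : 0 <= a /\ 0 <= b by rewrite !subr_ge0; split=> //; exact: ltW.
have ab1 : a * m w1 w2 + b * m b1 b2 = 1 by rewrite -[RHS]detw /a /b; ring.
have abt : a * (s * X w1 w2) + b * (s * X b1 b2) = t.
  by rewrite -[RHS]mulr1 -[Z in _ = _ * Z]detw /a /b; ring.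
have ss : s * s = 1 by rewrite -expr2.
have P1 : p1 - s * t * l2 = a * w1%:~R + b * b1%:~R.
  rewrite -(decompose1 lp w1%:~R w2%:~R) -(decompose1 lp b1%:~R b2%:~R).
  transitivity ((a * m w1 w2 + b * m b1 b2) * p1
    - s * (a * (s * X w1 w2) + b * (s * X b1 b2)) * l2);
      first by rewrite ab1 abt mul1r.
  transitivity ((a * m w1 w2 + b * m b1 b2) * p1
    - (s * s) * (a * X w1 w2 + b * X b1 b2) * l2); first by ring.
  by rewrite ss; ring.
have P2 : p2 + s * t * l1 = a * w2%:~R + b * b2%:~R.
  rewrite -(decompose2 lp w1%:~R w2%:~R) -(decompose2 lp b1%:~R b2%:~R).
  transitivity ((a * m w1 w2 + b * m b1 b2) * p2
    + s * (a * (s * X w1 w2) + b * (s * X b1 b2)) * l1);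
      first by rewrite ab1 abt mul1r.
  transitivity ((a * m w1 w2 + b * m b1 b2) * p2
    + (s * s) * (a * X w1 w2 + b * X b1 b2) * l1); first by ring.
  by rewrite ss; ring.
rewrite /height P1 P2.
have := mn_triangle mn (a * w1%:~R) (a * w2%:~R) (b * b1%:~R) (b * b2%:~R).
rewrite !norm_scale_ge0 // => hN.
apply: (mediant_estimate (na := n a1 a2) (nb := n b1 b2) (nc := n c1 c2)
  (mb := m b1 b2) (mw := m w1 w2) (mc := m c1 c2) (xw := s * X w1 w2)
  (xb := s * X b1 b2) (xc := s * X c1 c2)) => //.
- exact: le_trans K1_ mw.
- exact: le_trans K1_ mc.
- exact: le_trans (ltW K0) mb.
- exact: ltW.
- by rewrite subrK.
Qed.

End Enclosing.
End UpperBound.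

(** * Differentiability at irrational points, and flatness from approximation *)

Section SmallHeight.
Variables (R : realType) (N : R -> R -> R) (p1 p2 l1 l2 : R).
Hypothesis mn : markov_norm N.
Hypothesis irr : irrational_point p1 p2.
Hypothesis Np : N p1 p2 = 1.
Hypothesis lN : forall x y, l1 * x + l2 * y <= N x y.
Hypothesis lp : l1 * p1 + l2 * p2 = 1.
Implicit Types (x y t c k s K M C : R).
Local Notation n u1 u2 := (N u1%:~R u2%:~R).
Local Notation m u1 u2 := (l1 * u1%:~R + l2 * u2%:~R).
Local Notation X u1 u2 := (p1 * u2%:~R - p2 * u1%:~R).
Local Notation ht := (height N p1 p2 l1 l2).

Lemma two_sided (P : R -> Prop) :
  (forall s, s ^+ 2 = 1 -> exists2 d, 0 < d & forall t,
    0 < t -> t < d -> P (s * t)) ->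
  exists2 d, 0 < d & forall t, t != 0 -> `|t| < d -> P t.
Proof.
move=> h; have [d1 d10 h1] := h 1 (expr1n _ _).
have [d2 d20 h2] := h (-1) ltac:(by rewrite sqrrN expr1n).
exists (Num.min d1 d2); first by rewrite lt_min d10.
move=> t t0; rewrite lt_min => /andP[td1 td2].
have [tp|tp|tp] := ltrgt0P t.
- by rewrite -[t]mul1r; apply: h1 => //; rewrite gtr0_norm in td1.
- rewrite -[t]opprK -mulN1r; apply: h2; first by rewrite oppr_gt0.
  by rewrite ltr0_norm in td2.
- by rewrite tp eqxx in t0.
Qed.

Lemma height_at (K s : R) : s ^+ 2 = 1 -> exists2 d, 0 < d &
  forall t, 0 < t -> t < d -> exists w1 w2 z1 z2 : int, [/\ good w1 w2 z1 z2,
    K <= n w1 w2, `|X w1 w2| <= t * n w1 w2, K * `|X w1 w2| <= 1 &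
    ht (s * t) <= 512 * t * n w1 w2 * expR (- n w1 w2)].
Proof.
move=> s1; pose K0 := Num.max K (Num.max 1 (N (- l2) l1)).
have K01 : 1 <= K0 by rewrite /K0 !le_max lexx orbT.
have KK0 : K <= K0 by rewrite /K0 le_max lexx.
have Ktau : N (- l2) l1 <= K0 ^+ 2.
  apply: (@le_trans _ _ K0); first by rewrite /K0 !le_max lexx !orbT.
  by rewrite expr2 ler_peMl // (le_trans _ K01).
have [u1 [u2 [v1 [v2 enc]]]] := enclosing_large K0 irr lp s1.
have [_ _ Xv _ mv] := enc.
have m0 : 0 < m v1 v2 by apply: lt_le_trans mv; apply: lt_le_trans K01.
exists (s * X v1 v2 / m v1 v2); first by rewrite divr_gt0.
move=> t t0; rewrite ltr_pdivlMr // => /ltW tv.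
have [w1 [w2 [z1 [z2 [g mw [Xw0 Xw] KX hh]]]]] :=
  height_le mn irr Np lN lp s1 K01 Ktau enc t0 tv.
have ns : `|s| = 1 by exact: sqr1_norm.
have XE : `|X w1 w2| = s * X w1 w2 by rewrite -(gtr0_norm Xw0) normrM ns mul1r.
have mnw := lN w1%:~R w2%:~R.
exists w1, w2, z1, z2; rewrite XE; split=> //.
- exact: le_trans KK0 (le_trans mv (le_trans mw mnw)).
- by apply: le_trans Xw _; rewrite ler_pM2l.
- by apply: le_trans KX; rewrite ler_wpM2r // ltW.
Qed.

(** This is differentiability of the sphere at p. The threshold 1024 / e for y = n(w) comes from
    exp(y) >= y^2 / 2, which gives 512 y exp(- y) <= 1024 / y. *)
Lemma height_small (e : R) : 0 < e -> exists2 d, 0 < d &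
  forall t, `|t| < d -> ht t <= e * `|t|.
Proof.
move=> e0; have [|d d0 h] := @two_sided (fun t => ht t <= e * `|t|).
  move=> s s1; have [d d0 h] := height_at (Num.max 1 (1024 / e)) s1.
  exists d => // t t0 td; have [w1 [w2 [_ [_ [_ + _ _ hh]]]]] := h t t0 td.
  rewrite /=; set y := n w1 w2 in hh *; rewrite ge_max => /andP[y1 ye].
  apply: le_trans hh _.
  have y0 : 0 < y by apply: lt_le_trans y1.
  have ns : `|s| = 1 by exact: sqr1_norm.
  rewrite normrM ns mul1r gtr0_norm //.
  rewrite (_ : 512 * t * y * expR (- y) = 512 * y * expR (- y) * t);
    last by ring.
  rewrite ler_pM2r //.
  have ey : y ^+ 2 / 2 <= expR y.
    apply: le_trans (expR_ge1Dxn 1 (ltW y0)).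
    by rewrite (_ : (2`!)%:R = 2 :> R) // lerDr.
  rewrite ler_pdivrMr // in ye.
  rewrite expRN ler_pdivrMr ?expR_gt0 //.
  apply: le_trans (ler_wpM2l (ltW e0) ey).
  have h1 : 0 <= (y * e - 1024) * y by rewrite mulr_ge0 ?subr_ge0 // ltW.
  lra.
exists d => // t td; have [->|t0] := eqVneq t 0; last exact: h.
by rewrite /height !mul0r subr0 addr0 Np subrr normr0 mulr0.
Qed.

(** In the bound 512 t y exp(- y), y = n(w), the share 1 - k = (K - 1) / M of the exponential is
    traded, through |X| <= t y, for (t y)^(K - 1). The rest exp(- k y), where k > 0 because K < M +
    1, absorbs y^K. *)
Lemma approx_height M K : 1 < K -> K < M + 1 ->
  approx_order N p1 p2 M -> height_order N p1 p2 l1 l2 K.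
Proof.
move=> K1 KM [C [e [e0 hM]]].
have M0 : 0 < M by lra.
pose k := 1 - (K - 1) / M.
have k0 : 0 < k by rewrite /k subr_gt0 ltr_pdivrMr //; lra.
have K0 : 0 < K by lra.
have kK0 : 0 < k / K by rewrite divr_gt0.
exists (ln 512 + (K - 1) / M * C - K - K * ln (k / K)).
suff [d d0 h] : exists2 d, 0 < d & forall t, t != 0 -> `|t| < d ->
    ht t <= expR (ln 512 + (K - 1) / M * C - K - K * ln (k / K) + K * ln `|t|).
  by exists d.
apply: two_sided => s s1; have [d d0 h] := height_at (Num.max 1 (2 / e)) s1.
exists d => // t t0 td; have [w1 [w2 [z1 [z2 [g + Xw KX hh]]]]] := h t t0 td.
rewrite /=.
set y := n w1 w2 in Xw hh *; rewrite ge_max => /andP[y1 ye].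
have y0 : 0 < y by apply: lt_le_trans y1.
have X0 : 0 < `|X w1 w2| by rewrite normr_gt0; exact: irr (good_neq0 g).
have Xe : `|X w1 w2| < e.
  have : 2 / e * `|X w1 w2| <= 1.
    by apply: le_trans KX; rewrite ler_pM2r // le_max lexx orbT.
  rewrite mulrAC ler_pdivrMr //; set x := `|_| in X0 *; move: x X0 => x X0; lra.
have := hM _ _ _ _ g Xe; rewrite -/y => hn.
have ns : `|s| = 1 by exact: sqr1_norm.
rewrite normrM ns mul1r gtr0_norm //; apply: le_trans hh _.
have -> : 512 * t * y * expR (- y) = expR (ln 512 + ln t + ln y - y).
  by rewrite !expRD !lnK ?posrE ?ltr0n.
rewrite ler_expR.
have lX : ln `|X w1 w2| <= ln t + ln y by rewrite -lnM ?posrE //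
  ler_ln ?posrE // mulr_gt0.
have lyk : ln (k / K) + ln y <= k / K * y - 1.
  by rewrite -lnM ?posrE //; apply: ln_leB1; rewrite mulr_gt0.
have h1 : - (ln t + ln y) <= (y + C) / M.
  rewrite ler_pdivlMr //; apply: le_trans hn;
    rewrite mulrC mulrN lerN2 ler_pM2l //.
have h2 : (K - 1) * - (ln t + ln y) <= (K - 1) * ((y + C) / M).
  by rewrite ler_pM2l // subr_gt0.
have h3 : K * (ln (k / K) + ln y) <= K * (k / K * y - 1) by rewrite ler_pM2l.
have e3 : K * (k / K * y - 1) = k * y - K by field; rewrite gt_eqF.
have e2 : (K - 1) * ((y + C) / M) = (1 - k) * y + (K - 1) / M * C.
  by rewrite /k; ring.
rewrite e2 in h2; rewrite e3 in h3.
move: (ln (k / K)) h3 => q h3; move: ((K - 1) / M * C) h2 => q2 h2.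

lra.
Qed.

End SmallHeight.

(** * Flatness *)

Section SupportingLine.
Variables (R : realType) (N : R -> R -> R) (p1 p2 : R).
Hypothesis mn : markov_norm N.
Hypothesis irr : irrational_point p1 p2.
Hypothesis Np : N p1 p2 = 1.

Definition supporting l1 l2 : Prop :=
  (forall x y, l1 * x + l2 * y <= N x y) /\ l1 * p1 + l2 * p2 = 1.

(** Hahn-Banach in the plane: [g] is the left derivative at p of the norm along the vertical line
    through p. *)
Lemma supporting_exists : exists l1 l2, supporting l1 l2.
Proof.
have [p10 _] := irrational_coord irr.
pose S := [set ((N p1 (p2 + s) - 1) / s) | s in [set s : R | s < 0]].
have slopes s t : s < 0 -> 0 < t ->
    (N p1 (p2 + s) - 1) / s <= (N p1 (p2 + t) - 1) / t.
  move=> s0 t0; rewrite ler_ndivrMr // mulrAC ler_pdivrMr //.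
  have := mn_triangle mn (- s * p1) (- s * (p2 + t)) (t * p1) (t * (p2 + s)).
  rewrite !(norm_scale_ge0 mn) //; [|exact: ltW|by rewrite oppr_ge0 ltW].
  have -> : - s * p1 + t * p1 = (t - s) * p1 by ring.
  have -> : - s * (p2 + t) + t * (p2 + s) = (t - s) * p2 by ring.
  rewrite (norm_scale_ge0 mn) ?Np //; last by lra.
  by lra.
have supS : has_sup S.
  split; first by exists ((N p1 (p2 + -1) - 1) / -1), (-1) => //=;
    rewrite ltrN10.
  exists ((N p1 (p2 + 1) - 1) / 1) => _ [s /= s0 <-]; exact: slopes.
pose g := sup S.
have sub s : 1 + g * s <= N p1 (p2 + s).
  have [s0|s0|->] := ltrgt0P s; last by rewrite mulr0 !addr0 Np.
    have : g <= (N p1 (p2 + s) - 1) / s.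
      by apply: ge_sup; [case: supS|move=> _ [t /= t0 <-]; exact: slopes].
    by rewrite ler_pdivlMr //; lra.
  have : (N p1 (p2 + s) - 1) / s <= g.
    by apply: ub_le_sup; [case: supS|exists s].
  by rewrite ler_ndivrMr //; lra.
exists ((1 - g * p2) / p1), g; split; last by field.
move=> x y; set a := x / p1.
have -> : (1 - g * p2) / p1 * x + g * y = a + g * (y - a * p2) by rewrite /a;
  field.
set b := y - a * p2.
have [xE yE] : x = a * p1 /\ y = a * p2 + b by rewrite /b /a; split;
  [field|ring].
have [a0|a0] := ltP 0 a.
  have := sub (b / a); rewrite -(ler_pM2l a0) -(norm_scale_ge0 mn _ _ (ltW a0)).
  rewrite -xE (_ : a * (p2 + b / a) = y); last by rewrite yE; field;
    rewrite gt_eqF.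
  by rewrite (_ : a * (1 + g * (b / a)) = a + g * b) //; field; rewrite gt_eqF.
(* For a <= 0, adding the nonnegative multiple (1 - a) p leads back to the vertical line through
   p. *)
have := mn_triangle mn x y ((1 - a) * p1) ((1 - a) * p2).
rewrite (norm_scale_ge0 mn) ?Np; last by lra.
rewrite {1}xE {1}yE (_ : a * p1 + (1 - a) * p1 = p1); last by ring.
rewrite (_ : a * p2 + b + (1 - a) * p2 = p2 + b); last by ring.
by have := sub b; lra.
Qed.

(** Along the supporting line of l another form k has constant slope k(- l2, l1), and it stays below
    the height, which is o(t) on both sides. *)
Lemma supporting_unique l1 l2 k1 k2 :
  supporting l1 l2 -> supporting k1 k2 -> k1 = l1 /\ k2 = l2.
Proof.
move=> [lN lp] [kN kp].
have small e : 0 < e -> `|k2 * l1 - k1 * l2| <= e.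
  move=> e0; have [d d0 h] := height_small mn irr Np lN lp e0.
  have d2 : 0 < d / 2 by rewrite divr_gt0.
  have one t : `|t| < d -> t * (k2 * l1 - k1 * l2) <= e * `|t|.
    move=> td; apply: le_trans (h t td); rewrite /height.
    have := kN (p1 - t * l2) (p2 + t * l1).
    rewrite (_ : k1 * _ + _ = (k1 * p1 + k2 * p2) + t * (k2 * l1 - k1 * l2));
      last by ring.
    by rewrite kp; lra.
  have n2 : `|d / 2| = d / 2 by rewrite gtr0_norm.
  have := one (d / 2); rewrite n2 => /(_ ltac:(lra)) h1.
  have := one (- (d / 2)); rewrite normrN n2 => /(_ ltac:(lra)) h2.
  by rewrite ler_norml; apply/andP; split; rewrite -(ler_pM2l d2); lra.
have z : k2 * l1 - k1 * l2 = 0.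
  apply/eqP; rewrite -normr_le0 leNgt; apply/negP => h.
  by have := small (`|k2 * l1 - k1 * l2| / 2) ltac:(lra); lra.
split.
- transitivity (k1 * (l1 * p1 + l2 * p2) + (k2 * l1 - k1 * l2) * p2);
  first by rewrite lp z; ring.
  transitivity (l1 * (k1 * p1 + k2 * p2)); first by ring.
  by rewrite kp mulr1.
- transitivity (k2 * (l1 * p1 + l2 * p2) - (k2 * l1 - k1 * l2) * p1);
  first by rewrite lp z; ring.
  transitivity (l2 * (k1 * p1 + k2 * p2)); first by ring.
  by rewrite kp mulr1.
Qed.

End SupportingLine.

(** * From rays to Euclidean coordinates *)

Section AdaptedCoordinates.
Variables (R : realType) (N : R -> R -> R) (p1 p2 l1 l2 : R).
Hypothesis mn : markov_norm N.
Hypothesis irr : irrational_point p1 p2.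
Hypothesis Np : N p1 p2 = 1.
Hypothesis lN : forall x y, l1 * x + l2 * y <= N x y.
Hypothesis lp : l1 * p1 + l2 * p2 = 1.
Local Notation ht := (height N p1 p2 l1 l2).

Definition slope_norm : R := Num.sqrt (l1 ^+ 2 + l2 ^+ 2).
Local Notation rho := slope_norm.
Local Notation om := (p1 * l2 - p2 * l1).

(* N in the Euclidean coordinates (x, y) adapted to the supporting line. *)
Definition adapted (x y : R) : R :=
  N (p1 - x / rho * l2 - y / rho * l1) (p2 + x / rho * l1 - y / rho * l2).

(** Flatness without a graph function: the point of abscissa x and ordinate |x|^K lies in the unit
    ball. *)
Definition graph_flat (K : R) : Prop := exists2 d, 0 < d &
  forall x, `|x| < d -> adapted x (`|x| `^ K) <= 1.

Lemma slope_norm_gt0 : 0 < rho.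
Proof.
rewrite /slope_norm sqrtr_gt0 lt0r addr_ge0 ?sqr_ge0 // andbT.
rewrite paddr_eq0 ?sqr_ge0 // !sqrf_eq0; apply/negP => /andP[/eqP a /eqP b].
by move: lp; rewrite a b !mul0r addr0 => /esym/eqP; rewrite oner_eq0.
Qed.

Lemma slope_norm_sqr : rho ^+ 2 = l1 ^+ 2 + l2 ^+ 2.
Proof. by rewrite sqr_sqrtr // addr_ge0 ?sqr_ge0. Qed.

(** The form l is 1 - rho y at the point (x, y), which is therefore this multiple of a point of the
    supporting line. The shift [om] is there because the normal at p need not pass through 0. *)
Lemma adapted_height x y : 0 < 1 - rho * y ->
  adapted x y = (1 - rho * y) * (1 + ht ((x - om * y) / rho / (1 - rho * y))).
Proof.
move=> a0; rewrite /height /adapted addrCA subrr addr0 -(norm_scale_ge0 mn _ _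
  (ltW a0)).
have r0 := slope_norm_gt0; have rn0 : rho != 0 by rewrite gt_eqF.
have an0 : 1 - rho * y != 0 by rewrite gt_eqF.
have key c k : c * k = 0 -> forall z, z - c * k = z by move=> -> z;
  rewrite subr0.
congr N.
  transitivity ((1 - rho * y) * p1 - (x - om * y) / rho * l2); last by field;
    rewrite rn0 an0.
  transitivity (p1 - x / rho * l2 - y / rho * l1 * (l1 * p1 + l2 * p2)).
    by rewrite lp mulr1.
  transitivity (p1 - (l1 ^+ 2 + l2 ^+ 2) / rho * y * p1 - (x - om * y) / rho *
    l2).
    by field.
  by rewrite -slope_norm_sqr; field.
transitivity ((1 - rho * y) * p2 + (x - om * y) / rho * l1); last by field;
  rewrite rn0 an0.
transitivity (p2 + x / rho * l1 - y / rho * l2 * (l1 * p1 + l2 * p2)).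
  by rewrite lp mulr1.
transitivity (p2 - (l1 ^+ 2 + l2 ^+ 2) / rho * y * p2 + (x - om * y) / rho *
  l1).
  by field.
by rewrite -slope_norm_sqr; field.
Qed.

Lemma power_small K c : 1 < K -> 0 < c -> exists2 d, 0 < d &
  forall x : R, 0 < x -> x < d -> x `^ K <= c * x.
Proof.
move=> K1 c0; exists (expR (ln c / (K - 1))); first exact: expR_gt0.
move=> x x0 xd; rewrite /powR gt_eqF //
  -[X in _ <= _ * X](lnK x0) -[X in _ <= X * _](lnK c0).
rewrite -expRD ler_expR.
have : ln x < ln c / (K - 1) by rewrite -[X in _ < X]expRK ltr_ln ?posrE
  ?expR_gt0.
by rewrite ltr_pdivlMr; lra.
Qed.

Lemma height_scale_le (c t : R) : 0 <= c -> c <= 1 -> ht (c * t) <= ht t.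
Proof.
move=> c0 c1; apply: (@le_trans _ _ (c * ht t)); last first.
  by rewrite ler_piMl // height_ge0.
rewrite /height mulrBr mulr1 lerBlDr.
have := mn_triangle mn ((1 - c) * p1) ((1 - c) * p2) (c * (p1 - t * l2)) (c *
  (p2 + t * l1)).
rewrite !(norm_scale_ge0 mn) ?subr_ge0 // Np mulr1.
have -> : (1 - c) * p1 + c * (p1 - t * l2) = p1 - c * t * l2 by ring.
have -> : (1 - c) * p2 + c * (p2 + t * l1) = p2 + c * t * l1 by ring.
by lra.
Qed.

Lemma graph_flat_height K : 1 < K -> graph_flat K -> height_order N p1 p2 l1 l2
  K.
Proof.
move=> K1 [d d0 hd]; have r0 := slope_norm_gt0.
have K0 : 0 < K by apply: lt_trans K1.
(* With y = |x|^K <= c |x| and |x| <= 1, this gives |om y| <= |x| / 2 and rho y <= 1 / 2. *)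
pose c := (2 * (`|om| + rho + 1))^-1.
have b0 : 0 < `|om| + rho + 1 by rewrite addr_gt0 // ltr_wpDl.
have c0 : 0 < c by rewrite invr_gt0 mulr_gt0.
have [d1 d10 hd1] := power_small K1 c0.
pose e := Num.min 1 (Num.min d d1).
exists (ln (2 * rho) + K * ln (2 * rho)), (e / (2 * rho)).
split; first by rewrite divr_gt0 ?mulr_gt0 // !lt_min ltr01 d0 d10.
move=> t t0; rewrite ltr_pdivlMr ?mulr_gt0 // => te.
(* The factor 2 compensates the shift om y, at most half of x: the ray through (x, y) has its
   parameter beyond t, on the same side. *)
pose x := 2 * rho * t.
have nx : `|x| = `|t| * (2 * rho).
  by rewrite /x normrM gtr0_norm ?mulr_gt0 // mulrC.
have nx0 : 0 < `|x| by rewrite nx mulr_gt0 ?mulr_gt0 // normr_gt0.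
rewrite -nx !lt_min in te; case/and3P: te => x1 xd xd1.
have ycx := hd1 _ nx0 xd1; have := hd x xd.
set y := `|x| `^ K in ycx *; have y0 : 0 <= y := powR_ge0 _ _.
have yb : y * (2 * (`|om| + rho + 1)) <= `|x|.
  have : y * (2 * (`|om| + rho + 1)) <= c * `|x| * (2 * (`|om| + rho + 1)).
    by rewrite ler_pM2r // mulr_gt0.
  by rewrite mulrAC /c mulVf ?mul1r // gt_eqF // mulr_gt0.
have omy : `|om * y| <= `|x| / 2.
  rewrite normrM (ger0_norm y0);
    have : 0 <= y * (rho + 1) by rewrite mulr_ge0 // addr_ge0 // ltW.
  by move: yb; set w := `|om|; set v := `|x|; move: w v => w v; lra.
have ry : rho * y <= 1 / 2.
  have h1 : 0 <= y * (`|om| + 1) by rewrite mulr_ge0 // addr_ge0.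
  by move: yb x1 h1; set w := `|om|; set v := `|x|; move: w v => w v; lra.
have ry0 : 0 <= rho * y by rewrite mulr_ge0 // ltW.
have a0 : 0 < 1 - rho * y by lra.
rewrite adapted_height // => hN.
set t' := (x - om * y) / rho / (1 - rho * y) in hN.
have hp : ht t' <= 2 * rho * y.
  have : (1 - rho * y) * ht t' <= rho * y by lra.
  have := height_ge0 lN lp t'; rewrite -/ht.
  rewrite -[2 * rho * y]mulrA;
    move: (ht t') (rho * y) ry ry0 => h r r2 r00 h0 hr.
  have : 0 <= (1 / 2 - r) * h by rewrite mulr_ge0 // subr_ge0.
  by lra.
have le1 : ht t <= ht t'.
  have xx : 0 < x / t by rewrite /x mulfK // mulr_gt0.
  have q : 1 <= t' / t.
    rewrite /t' (_ : _ / t = (x / t / rho - om * y / t / rho) / (1 - rho * y));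
      last first.
      by field; rewrite t0 gt_eqF //= gt_eqF.
    rewrite ler_pdivlMr // mul1r.
    have -> : x / t / rho = 2 by rewrite /x; field; rewrite t0 gt_eqF.
    have : `|om * y / t / rho| <= 1.
      rewrite !normf_div (gtr0_norm r0) ler_pdivrMr //
        ler_pdivrMr ?normr_gt0 //.
      by apply: le_trans omy _; rewrite nx; set v := `|t|; lra.
    by rewrite ler_norml => /andP[_ h]; lra.
  have q0 : 0 < t' / t by apply: lt_le_trans q.
  have -> : t = (t' / t)^-1 * t'.
    have t'0 : t' != 0 by apply/eqP => z; move: q0; rewrite z mul0r ltxx.
    by field; rewrite t0 t'0.
  apply: height_scale_le; first by rewrite invr_ge0 ltW.
  by rewrite invf_le1.
apply: le_trans le1 _; apply: le_trans hp _.
have r20 : 0 < 2 * rho by rewrite mulr_gt0.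
have nt0 : 0 < `|t| by rewrite normr_gt0.
rewrite -[X in X * y](lnK r20) /y /powR gt_eqF // -expRD ler_expR nx.
have -> : ln (`|t| * (2 * rho)) = ln `|t| + ln (2 * rho).
  by rewrite [LHS]lnM ?posrE.
by lra.
Qed.

Lemma height_graph_flat K K0 : 1 < K -> K < K0 ->
  height_order N p1 p2 l1 l2 K0 -> graph_flat K.
Proof.
move=> K1 KK0 [C [d [d0 hd]]]; have r0 := slope_norm_gt0.
pose c := (2 * (`|om| + rho + 1))^-1.
have b0 : 0 < `|om| + rho + 1 by rewrite addr_gt0 // ltr_wpDl.
have c0 : 0 < c by rewrite invr_gt0 mulr_gt0.
have [d1 d10 hd1] := power_small K1 c0.
(* |x| < exp(q) amounts to exp(C) (4 |x| / rho)^K0 < rho |x|^K: the gap K0 - K absorbs the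
   constants. *)
pose q := (ln rho - C - K0 * ln (4 / rho)) / (K0 - K).
exists (Num.min 1 (Num.min d1 (Num.min (d * rho / 4) (expR q)))).
  by rewrite !lt_min ltr01 d10 expR_gt0 divr_gt0 ?mulr_gt0.
move=> x; rewrite !lt_min => /and4P[x1 xd1 xd xq].
have [->|xn0] := eqVneq x 0.
  rewrite normr0 powR0; last by rewrite gt_eqF // (lt_trans _ K1).
  by rewrite /adapted !mul0r !subr0 addr0 Np.
have nx0 : 0 < `|x| by rewrite normr_gt0.
have ycx := hd1 _ nx0 xd1.
have yE : `|x| `^ K = expR (K * ln `|x|) by rewrite /powR gt_eqF.
set y := `|x| `^ K in ycx yE *; have y0 : 0 <= y := powR_ge0 _ _.
have yb : y * (2 * (`|om| + rho + 1)) <= `|x|.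
  have : y * (2 * (`|om| + rho + 1)) <= c * `|x| * (2 * (`|om| + rho + 1)).
    by rewrite ler_pM2r // mulr_gt0.
  by rewrite mulrAC /c mulVf ?mul1r // gt_eqF // mulr_gt0.
have omy : `|om * y| <= `|x| / 2.
  rewrite normrM (ger0_norm y0);
    have : 0 <= y * (rho + 1) by rewrite mulr_ge0 // addr_ge0 // ltW.
  by move: yb; set w := `|om|; set v := `|x|; move: w v => w v; lra.
have ry : rho * y <= 1 / 2.
  have h1 : 0 <= y * (`|om| + 1) by rewrite mulr_ge0 // addr_ge0.
  by move: yb x1 h1; set w := `|om|; set v := `|x|; move: w v => w v; lra.
have ry0 : 0 <= rho * y by rewrite mulr_ge0 // ltW.
have a0 : 0 < 1 - rho * y by lra.
rewrite adapted_height //; set t' := (x - om * y) / rho / (1 - rho * y).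
have xom : `|x - om * y| <= 2 * `|x|.
  by apply: le_trans (ler_normB _ _) _; move: omy nx0;
    move: `|x| `|om * y| => v w; lra.
have xom0 : x - om * y != 0.
  apply/eqP => /eqP; rewrite subr_eq0 => /eqP z.
  by move: omy nx0; rewrite -z; move: `|x| => v; lra.
have t'x : `|t'| <= 4 / rho * `|x|.
  rewrite /t' !normf_div (gtr0_norm r0) (gtr0_norm a0) ler_pdivrMr //
    ler_pdivrMr //.
  have -> : 4 / rho * `|x| * (1 - rho * y) * rho = 4 * `|x| * (1 - rho * y).
    by field; rewrite gt_eqF.
  by apply: le_trans xom _; have : 0 <= `|x| * (1 / 2 - rho * y);
    [rewrite mulr_ge0 // subr_ge0|
    move: `|x| (rho * y) => v w; lra].
have t'0 : t' != 0 by rewrite /t' !mulf_neq0 // invr_eq0;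
  [rewrite (gt_eqF r0)|rewrite (gt_eqF a0)].
have t'd : `|t'| < d.
  apply: le_lt_trans t'x _; rewrite mulrAC ltr_pdivrMr //; move: xd;
    move: `|x| => v; lra.
have := hd t' t'0 t'd.
have K00 : 0 < K0 by apply: lt_trans KK0; apply: lt_trans K1.
have r4 : 0 < 4 / rho by rewrite divr_gt0.
have nt'0 : 0 < `|t'| by rewrite normr_gt0.
have hle : expR (C + K0 * ln `|t'|) <= rho * y.
  rewrite yE -[X in _ <= X * _](lnK r0) -expRD ler_expR.
  have l1' : ln `|t'| <= ln (4 / rho) + ln `|x|.
    by rewrite -lnM ?posrE // ler_ln ?posrE // mulr_gt0.
  have : ln `|x| < q by rewrite -[X in _ < X]expRK ltr_ln ?posrE ?expR_gt0.
  rewrite /q ltr_pdivlMr ?subr_gt0 //.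
  have : K0 * ln `|t'| <= K0 * (ln (4 / rho) + ln `|x|) by rewrite ler_pM2l.
  by lra.
move=> /le_trans/(_ hle) hh.
have : (1 - rho * y) * (1 + ht t') <= (1 - rho * y) * (1 + rho * y).
  by rewrite ler_pM2l // lerD2l.
by move: (ht t') (rho * y) => h r; have := sqr_ge0 r; lra.
Qed.

End AdaptedCoordinates.

Lemma lipschitz_continuous (R : realType) (f : R -> R) (k : R) :
  (forall x y, `|f x - f y| <= k * `|x - y|) -> continuous f.
Proof.
move=> h x; apply/cvgrPdist_lt => e e0.
have k0 : 0 < `|k| + 1 by rewrite ltr_wpDl.
near=> y; apply: le_lt_trans (h x y) _.
apply: (@le_lt_trans _ _ ((`|k| + 1) * `|x - y|)).
  by rewrite ler_wpM2r // (le_trans (ler_norm k)) // lerDl.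
rewrite mulrC -ltr_pdivlMr //; near: y.
by exists (e / (`|k| + 1)); [exact: divr_gt0|].
Unshelve. all: by end_near.
Qed.

(** * The unit sphere as a graph *)

Section BoundaryGraph.
Variables (R : realType) (N : R -> R -> R) (p1 p2 l1 l2 : R).
Hypothesis mn : markov_norm N.
Hypothesis irr : irrational_point p1 p2.
Hypothesis Np : N p1 p2 = 1.
Hypothesis lN : forall x y, l1 * x + l2 * y <= N x y.
Hypothesis lp : l1 * p1 + l2 * p2 = 1.
Local Notation rho := (slope_norm l1 l2).
Local Notation adp := (adapted N p1 p2 l1 l2).

Lemma adapted00 : adp 0 0 = 1.
Proof. by rewrite /adapted !mul0r !subr0 addr0. Qed.

Lemma adapted_x0 x : 1 <= adp x 0.
Proof.
apply: le_trans (lN _ _); rewrite -subr_ge0.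
rewrite (_ : _ - 1 = l1 * p1 + l2 * p2 - 1); last by ring.
by rewrite lp subrr.
Qed.

Lemma adapted_convex x y z c : 0 <= c -> c <= 1 ->
  adp x (c * y + (1 - c) * z) <= c * adp x y + (1 - c) * adp x z.
Proof.
move=> c0 c1; rewrite /adapted -!(norm_scale_ge0 mn) ?subr_ge0 //.
apply: le_trans (mn_triangle mn _ _ _ _).
by rewrite le_eqVlt; apply/orP; left; apply/eqP; congr N; ring.
Qed.

Lemma adapted_lipschitz_x x y :
  adp x y <= adp 0 y + `|x| * N (- (l2 / rho)) (l1 / rho).
Proof.
rewrite /adapted -(mn_scale mn); apply: le_trans (mn_triangle mn _ _ _ _).
by rewrite le_eqVlt; apply/orP; left; apply/eqP; congr N; ring.
Qed.

Lemma adapted_lipschitz_y x y z :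
  `|adp x y - adp x z| <= N (l1 / rho) (l2 / rho) * `|y - z|.
Proof.
have one u v : adp x u <= adp x v + `|u - v| * N (l1 / rho) (l2 / rho).
  rewrite distrC /adapted -(mn_scale mn);
    apply: le_trans (mn_triangle mn _ _ _ _).
  by rewrite le_eqVlt; apply/orP; left; apply/eqP; congr N; ring.
have := one y z; have := one z y; rewrite [`|z - y|]distrC mulrC => h1 h2.
by rewrite ler_norml; apply/andP; split; lra.
Qed.

(** Moving inwards by Y gains rho Y but changes the ray by about om Y / rho; [e] is chosen so that
    the height on that ray stays strictly below the gain. *)
Lemma adapted_below : exists2 Y0, 0 < Y0 &
  forall Y, 0 < Y -> Y < Y0 -> adp 0 Y < 1.
Proof.
have r0 := slope_norm_gt0 lp.
set om := p1 * l2 - p2 * l1.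
pose e := rho ^+ 2 / (`|om| + 1).
have om1 : 0 < `|om| + 1 by rewrite ltr_wpDl.
have e0 : 0 < e by rewrite divr_gt0 // exprn_gt0.
have [d d0 hd] := height_small mn irr Np lN lp e0.
exists (Num.min (2 * rho)^-1 (d * rho / (2 * (`|om| + 1)))).
  by rewrite lt_min invr_gt0 divr_gt0 ?mulr_gt0.
move=> Y Y0; rewrite lt_min -[(2 * rho)^-1]mul1r => /andP[].
rewrite ltr_pdivlMr ?mulr_gt0 // => Yr; rewrite ltr_pdivlMr ?mulr_gt0 // => Yd.
have a0 : 0 < 1 - rho * Y by lra.
have a12 : 1 / 2 < 1 - rho * Y by lra.
rewrite (adapted_height mn lp) // -/om add0r.
set t := _ / _ / _.
have tE : `|t| = `|om| * Y / rho / (1 - rho * Y).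
  by rewrite /t !mulNr normrN !normf_div normrM (gtr0_norm r0) (gtr0_norm a0)
    (gtr0_norm Y0).
have td : `|t| < d.
  rewrite tE ltr_pdivrMr // ltr_pdivrMr //.
  have h1 : 0 <= d * rho * (1 - rho * Y - 1 / 2) by rewrite !mulr_ge0 //
    ?ltW // subr_gt0.
  by lra.
have hY := hd t td.
apply: (@le_lt_trans _ _ ((1 - rho * Y) * (1 + e * `|t|))).
  by rewrite ler_pM2l // lerD2l.
have -> : (1 - rho * Y) * (1 + e * `|t|) = 1 - rho * Y + rho * Y * (`|om| /
  (`|om| + 1)).
  by rewrite tE /e; field; rewrite !gt_eqF.
have q : `|om| / (`|om| + 1) < 1 by rewrite ltr_pdivrMr // mul1r ltrDl.
have : rho * Y * (`|om| / (`|om| + 1)) < rho * Y.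
  by rewrite -[X in _ < X]mulr1 ltr_pM2l // mulr_gt0.
by lra.
Qed.

Lemma adapted_root x b : 0 <= b -> adp x b <= 1 ->
  exists y, [/\ 0 <= y, y <= b & adp x y = 1].
Proof.
move=> b0 hb; have [||y] := @IVT R (adp x) 0 b 1 b0.
- apply: continuous_subspaceT; apply: lipschitz_continuous;
  exact: adapted_lipschitz_y.
- by rewrite ge_min hb orbT le_max adapted_x0.
by rewrite in_itv /= => /andP[y0 yb] e; exists y.
Qed.

Lemma adapted_between x y z Y : adp x y <= 1 -> adp x Y < 1 ->
  y < z -> z <= Y -> adp x z < 1.
Proof.
move=> hy hY yz zY; have Yy : 0 < Y - y by lra.
pose c := (Y - z) / (Y - y).
have c0 : 0 <= c by rewrite divr_ge0 ?(ltW Yy) // subr_ge0.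
have c1 : c < 1 by rewrite ltr_pdivrMr // mul1r; lra.
have -> : z = c * y + (1 - c) * Y by rewrite /c; field; rewrite gt_eqF.
apply: le_lt_trans (adapted_convex _ _ _ c0 (ltW c1)) _.
have h1 : c * adp x y <= c by rewrite ler_piMr.
have h2 : (1 - c) * adp x Y < 1 - c by rewrite -[X in _ < X]mulr1 ltr_pM2l //
  subr_gt0.
by lra.
Qed.

(** A whole segment of ordinate Y is interior. As r <= Y, ordinates below r lie under it, where
    convexity leaves at most one boundary point. *)
Lemma adapted_strip : exists r Y, [/\ 0 < r, r <= Y &
  forall x, `|x| < r -> adp x Y < 1].
Proof.
have [Y0 Y00 hY] := adapted_below.
pose Y := Y0 / 2; have [Yp YY0] : 0 < Y /\ Y < Y0 by rewrite /Y; lra.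
have h := hY Y Yp YY0; set b := N (- (l2 / rho)) (l1 / rho).
have b0 : 0 <= b by exact: mn_ge0 mn _ _.
have b1 : 0 < b + 1 by rewrite ltr_wpDl.
exists (Num.min Y ((1 - adp 0 Y) / (b + 1))), Y.
split; first by rewrite lt_min Yp divr_gt0 ?subr_gt0.
  by rewrite ge_min lexx.
move=> x; rewrite lt_min => /andP[_]; rewrite ltr_pdivlMr // => hx.
apply: le_lt_trans (adapted_lipschitz_x _ _) _; rewrite -/b.
by have := normr_ge0 x; move: hx; move: `|x| (adp 0 Y) => v w; lra.
Qed.

Lemma graph_exists : exists f : R -> R, f 0 = 0 /\
  (exists2 r, 0 < r & forall x y,
    `|x| < r -> `|y| < r -> (adp x y = 1 <-> y = f x)) /\
  forall K, 1 < K -> graph_flat N p1 p2 l1 l2 K ->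
    exists2 d, 0 < d & forall x, `|x| < d -> f x <= `|x| `^ K.
Proof.
have [r [Y [r0 rY hY]]] := adapted_strip.
have uniq x y z : `|x| < r -> `|y| < r -> `|z| < r ->
    adp x y = 1 -> adp x z = 1 -> y = z.
  move=> xr yr zr.
  wlog yz : y z yr zr / y < z.
    by move=> wl hy hz; have [h|h|//] := ltgtP y z; [exact: wl|apply/esym;
      exact: wl].
  move=> hy hz; have : adp x z < 1.
    apply: (@adapted_between x y z Y) => //; [by rewrite hy|exact: hY|].
    by rewrite (le_trans (ler_norm z)) // (le_trans (ltW zr)).
  by rewrite hz ltxx.
pose P x y := `|y| < r /\ adp x y = 1.
(* The default value r violates |y| < r, so it creates no spurious solution of y = f x. *)
pose f x := if pselect (exists y, P x y) is left h then projT1 (cid h) else r.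
have fP x y : P x y -> `|x| < r -> f x = y.
  rewrite /f => Py xr; case: pselect => [h|[]]; last by exists y.
  case: (cid h) => z [zr hz] /=; case: Py => yr hy; exact: uniq xr zr yr hz hy.
exists f; split; last split.
- by apply: fP; rewrite /P ?normr0 // adapted00.
- exists r => // x y xr yr; split; first by move=> h; rewrite (fP x y).
  rewrite /f; case: pselect => [h|_ yE]; last first.
    by move: yr; rewrite yE gtr0_norm // ltxx.
  by case: (cid h) => z [zr hz] /= ->.
- move=> K K1 [d d0 hd]; have [d1 d10 hd1] := power_small K1 (ltr01).
  exists (Num.min d (Num.min r d1)); first by rewrite !lt_min d0 r0.
  move=> x; rewrite !lt_min => /and3P[xd xr xd1].
  have [y [y0 yb hy]] := adapted_root (powR_ge0 _ _) (hd x xd).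
  rewrite (fP x y) //; split=> //; rewrite ger0_norm //.
  have [x0|xn0] := eqVneq x 0.
    move: yb; rewrite x0 normr0 powR0;
      last by rewrite gt_eqF // (lt_trans _ K1).
    by move=> h; apply: le_lt_trans h r0.
  apply: le_lt_trans yb _; apply: le_lt_trans xr.
  by have := hd1 `|x|; rewrite mul1r normr_gt0; apply.
Qed.

Lemma graph_flat_of_graph (f : R -> R) (K r d : R) : 1 < K -> 0 < r -> 0 < d ->
  f 0 = 0 ->
  (forall x y, `|x| < r -> `|y| < r -> (adp x y = 1 <-> y = f x)) ->
  (forall x, `|x| < d -> f x <= `|x| `^ K) -> graph_flat N p1 p2 l1 l2 K.
Proof.
move=> K1 r0 d0 f0 hf fK.
have [Y0 Y00 hY] := adapted_below.
pose Y := Num.min Y0 r / 2.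
have m0 : 0 < Num.min Y0 r by rewrite lt_min Y00.
have [Yp Ym] : 0 < Y /\ Y < Num.min Y0 r by rewrite /Y; lra.
move: Ym; rewrite lt_min => /andP[YY0 Yr].
have h := hY Y Yp YY0; set b := N (- (l2 / rho)) (l1 / rho).
have b0 : 0 <= b by exact: mn_ge0 mn _ _.
have b1 : 0 < b + 1 by rewrite ltr_wpDl.
have [d1 d10 hd1] := power_small K1 (ltr01).
exists (Num.min (Num.min d r) (Num.min (Num.min d1 Y) ((1 - adp 0 Y) / (b +
  1)))).
  by rewrite !lt_min d0 r0 d10 Yp divr_gt0 ?subr_gt0.
move=> x; rewrite !lt_min => /andP[/andP[xd xr] /andP[/andP[xd1 xY]]].
rewrite ltr_pdivlMr // => hx.
have hxY : adp x Y < 1.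
  apply: le_lt_trans (adapted_lipschitz_x _ _) _; rewrite -/b.
  by have := normr_ge0 x; move: hx; move: `|x| (adp 0 Y) => v w; lra.
have [x0|xn0] := eqVneq x 0.
  rewrite x0 normr0 powR0; last by rewrite gt_eqF // (lt_trans _ K1).
  by rewrite adapted00.
have [y [y0 yY hy]] := adapted_root (ltW Yp) (ltW hxY).
have yf : y = f x.
  by apply/(hf x y) => //; rewrite ger0_norm //; apply: le_lt_trans Yr.
have yK : y <= `|x| `^ K by rewrite yf; exact: fK.
move: yK; rewrite le_eqVlt => /orP[/eqP <-|yK]; first by rewrite hy.
apply/ltW/(adapted_between (y := y) (Y := Y)) => //; first by rewrite hy.
apply/ltW; apply: le_lt_trans xY.
by have := hd1 `|x|; rewrite mul1r normr_gt0; apply.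
Qed.

End BoundaryGraph.

(** * The flatness exponent in terms of heights *)

Section FlatnessExponent.
Variables (R : realType) (n : 'rV[R]_2 -> R) (p1 p2 l1 l2 : R).
Local Notation N := (fun x y => n (vec x y)).
Hypothesis norm_n : is_norm n.
Hypothesis mn : markov_norm N.
Hypothesis irr : irrational_point p1 p2.
Hypothesis Np : n (vec p1 p2) = 1.
Hypothesis lN : forall x y, l1 * x + l2 * y <= n (vec x y).
Hypothesis lp : l1 * p1 + l2 * p2 = 1.
Local Notation rho := (slope_norm l1 l2).
Local Notation p := (vec p1 p2).

Lemma dotE (u v : 'rV[R]_2) : dot u v = u 0 0 * v 0 0 + u 0 1 * v 0 1.
Proof.
rewrite /dot mxE !big_ord_recl big_ord0 addr0 !mxE.
by congr (_ + u 0 _ * v 0 _); apply/val_inj.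
Qed.

Lemma vec0 x y : vec x y 0 0 = x :> R. Proof. by rewrite mxE. Qed.
Lemma vec1 x y : vec x y 0 1 = y :> R. Proof. by rewrite mxE. Qed.

Definition inward : 'rV[R]_2 := vec (- (l1 / rho)) (- (l2 / rho)).

Lemma adaptedE x y :
  n (p + x *: tangent inward + y *: inward) = adapted N p1 p2 l1 l2 x y.
Proof.
rewrite /adapted; congr n; rewrite -[LHS]vecE.
by rewrite /inward /tangent !mxE /=; congr vec; ring.
Qed.

Lemma inward_supporting : supporting_normal n p inward.
Proof.
have r0 := slope_norm_gt0 lp; have rn0 : rho != 0 by rewrite gt_eqF.
split.
  rewrite dotE vec0 vec1.
  transitivity ((l1 ^+ 2 + l2 ^+ 2) / rho ^+ 2); first by field.
  by rewrite -slope_norm_sqr divff // expf_neq0.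
move=> q nq; rewrite dotE vec0 vec1 mxE [(q - p) 0 1]mxE !mxE /=.
rewrite (_ : _ + _ = (l1 * p1 + l2 * p2 - (l1 * q 0 0 + l2 * q 0 1)) / rho);
  last by ring.
rewrite lp divr_ge0 ?(ltW r0) // subr_ge0; apply: le_trans (lN _ _) _.
by rewrite vecE.
Qed.

(** nu divided by d = dot p nu < 0 is a supporting form, hence l; the unit length then forces d = -
    1 / rho. *)
Lemma inward_unique nu : supporting_normal n p nu -> nu = inward.
Proof.
have [n0 nsep nZ nD] := norm_n.
have r0 := slope_norm_gt0 lp; have rn0 : rho != 0 by rewrite gt_eqF.
move=> [nu1 hnu].
have dotZ t u : dot (t *: u) nu = t * dot u nu by rewrite !dotE !mxE; ring.
have dotB u v : dot (u - v) nu = dot u nu - dot v nu by rewrite !dotE !mxE;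
  ring.
set d := dot p nu.
have d0 : d < 0.
  have k0 : 0 < n nu + 1 by rewrite ltr_wpDl.
  have kV : 0 < (n nu + 1)^-1 by rewrite invr_gt0.
  have := hnu (- (n nu + 1)^-1 *: nu).
  rewrite nZ normrN (gtr0_norm kV) dotB dotZ nu1 -/d mulr1 => h.
  have : (n nu + 1)^-1 * n nu <= 1 by rewrite mulrC ler_pdivrMr // mul1r lerDl.
  by move=> /h; move: kV; move: (_^-1) => k; lra.
have dn0 : d != 0 by rewrite lt_eqF.
have low q : d * n q <= dot q nu.
  have [q0|qn0] := eqVneq (n q) 0.
    by rewrite (nsep _ q0) -(scale0r nu) dotZ nZ normr0 !mul0r mulr0.
  have qp : 0 < n q by rewrite lt0r qn0 n0.
  have := hnu ((n q)^-1 *: q);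
    rewrite nZ gtr0_norm ?invr_gt0 // mulVf // lexx => /(_ isT).
  by rewrite dotB dotZ -/d subr_ge0 mulrC ler_pdivlMr.
have [e1 e2] : nu 0 0 / d = l1 /\ nu 0 1 / d = l2.
  apply: (supporting_unique mn irr Np); first by split.
  split; last first.
    rewrite -[RHS](divff dn0) {3}/d dotE vec0 vec1; ring.
  move=> x y; have := low (vec x y); rewrite dotE vec0 vec1.
  rewrite (_ : nu 0 0 / d * x + nu 0 1 / d * y = (x * nu 0 0 + y * nu 0 1) /
    d); last by ring.
  by rewrite ler_ndivrMr // mulrC.
have f1 : nu 0 0 = d * l1 by rewrite -e1; field.
have f2 : nu 0 1 = d * l2 by rewrite -e2; field.
have dr : d * rho = - 1.
  have : (d * rho) ^+ 2 = 1.
    by rewrite exprMn slope_norm_sqr -nu1 dotE f1 f2; ring.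
  move=> /eqP; rewrite sqrf_eq1 => /orP[/eqP h|/eqP//].
  by have : d * rho < 0; [rewrite nmulr_rlt0|rewrite h ltr10].
have dE : d = - rho^-1 by apply: (mulIf rn0); rewrite dr mulNr mulVf.
by rewrite -[nu]vecE /inward f1 f2 dE; congr vec; ring.
Qed.

Lemma flat_to_orderP K : 1 < K ->
  flat_to_order n p K <-> graph_flat N p1 p2 l1 l2 K.
Proof.
move=> K1; split.
  move=> [nu [/inward_unique -> _ [f [[r r0 hf] f0 [d d0 fK]]]]].
  apply: (graph_flat_of_graph mn irr Np lN lp K1 r0 d0 f0 _ fK) => x y xr yr.
  by rewrite -adaptedE; apply: hf.
move=> flat; exists inward; split; first exact: inward_supporting.
  by move=> nu'; exact: inward_unique.
have [f [f0 [[r r0 hf] hK]]] := graph_exists mn irr Np lN lp.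
exists f; split=> //; last exact: hK.
by exists r => // x y xr yr; rewrite adaptedE; exact: hf.
Qed.

Lemma height_order_le K K' : K <= K' -> height_order N p1 p2 l1 l2 K' ->
  height_order N p1 p2 l1 l2 K.
Proof.
move=> KK [C [d [d0 h]]]; exists C, (Num.min d 1); split;
  first by rewrite lt_min d0 ltr01.
move=> t t0; rewrite lt_min => /andP[td t1]; apply: le_trans (h t t0 td) _.
rewrite ler_expR lerD2l ler_wnM2r // -ln1 ler_ln ?posrE // ?normr_gt0 //.
exact: ltW.
Qed.

Lemma flatnessP A : 1 < A -> flatness n p = A%:E <->
  (forall K, 1 < K -> K < A -> height_order N p1 p2 l1 l2 K) /\
  (forall K, A < K -> ~ height_order N p1 p2 l1 l2 K).
Proof.
move=> A1; have flat_height K : 1 < K -> flat_to_order n p K ->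
    height_order N p1 p2 l1 l2 K.
  by move=> K1 /(flat_to_orderP K1); apply: (graph_flat_height mn Np lN lp K1).
have height_flat K K' : 1 < K -> K < K' -> height_order N p1 p2 l1 l2 K' ->
    flat_to_order n p K.
  by move=> K1 KK h; apply/(flat_to_orderP K1);
    exact: (height_graph_flat mn Np lp K1 KK h).
split.
  move=> fA; split.
    move=> K K1 KA; have : (K%:E < flatness n p)%E by rewrite fA lte_fin.
    move=> /ereal_sup_gt[_ [M [M0 hM] <-]]; rewrite lte_fin => KM.
    apply: (height_order_le (ltW KM)); apply: flat_height => //.
    exact: lt_trans KM.
  move=> K AK h; pose M := (A + K) / 2.
  have [AM MK] : A < M /\ M < K by rewrite /M; split; lra.
  have M1 := lt_trans A1 AM.
  have : (M%:E <= flatness n p)%E.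
    apply: ereal_sup_ubound; exists M => //; split; first by lra.
    exact: height_flat M1 MK h.
  by rewrite fA lee_fin leNgt AM.
move=> [hlow hhigh]; apply/eqP; rewrite eq_le; apply/andP; split.
  apply: ge_ereal_sup => _ [M [M0 hM] <-]; rewrite lee_fin leNgt;
    apply/negP => AM.
  by apply: (hhigh _ AM); apply: flat_height => //; exact: lt_trans AM.
apply/lee_addgt0Pr => e e0.
pose K := Num.max ((1 + A) / 2) (A - e / 2).
have [K1 KA] : 1 < K /\ K < A.
  by rewrite /K lt_max gt_max; split; [apply/orP; left|apply/andP; split]; lra.
pose K' := (K + A) / 2.
have [KK' K'A] : K < K' /\ K' < A by rewrite /K'; split; lra.
have hK : (K%:E <= flatness n p)%E.
  apply: ereal_sup_ubound; exists K => //; split; first by lra.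
  apply: (height_flat _ _ K1 KK'); apply: hlow => //; exact: lt_trans KK'.
apply: le_trans (leeD2r _ hK); rewrite -EFinD lee_fin.
have : A - e / 2 <= K by rewrite /K le_max lexx orbT.
by lra.
Qed.

End FlatnessExponent.

(** * Exponents of a direction *)

Section ApproximationExponent.
Variable R : realType.
Implicit Types (N : R -> R -> R) (p r M A B : R).

Lemma approx_order_scale N p1 p2 r M : irrational_point p1 p2 -> r != 0 ->
  approx_order N p1 p2 M -> approx_order N (r * p1) (r * p2) M.
Proof.
move=> irr r0 [C [e [e0 h]]]; have nr0 : 0 < `|r| by rewrite normr_gt0.
exists (C - M * ln `|r|), (`|r| * e); split; first by rewrite mulr_gt0.
move=> u1 u2 v1 v2 g.
rewrite (_ : r * p1 * _ - _ = r * (p1 * u2%:~R - p2 * u1%:~R)); last by ring.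
have X0 : 0 < `|p1 * u2%:~R - p2 * u1%:~R| by rewrite normr_gt0 (irr _ _
  (good_neq0 g)).
rewrite normrM ltr_pM2l // => /(h _ _ _ _ g) hn.
by rewrite lnM ?posrE // mulrDr; lra.
Qed.

Lemma irrational_point_scale p1 p2 r : irrational_point p1 p2 -> r != 0 ->
  irrational_point (r * p1) (r * p2).
Proof.
by move=> irr r0 w1 w2 w0; rewrite -!mulrA -mulrBr mulf_neq0 // irr.
Qed.

(** For w close to the line of p both norms are governed by the same multiple a p, up to O(|X|). If
    M N2(p) < M' N1(p), the order M' for N2 would thus give the order M for N1. *)
Lemma approx_order_ratio N1 N2 p1 p2 M M' : markov_norm N1 -> markov_norm N2 ->
  irrational_point p1 p2 -> 0 < M -> 0 < M' ->
  ~ approx_order N1 p1 p2 M -> approx_order N2 p1 p2 M' ->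
  M' * N1 p1 p2 <= M * N2 p1 p2.
Proof.
move=> mn1 mn2 irr M0 M'0 no [C2 [e [e0 h]]].
have [p10 _] := irrational_coord irr.
have dec (w1 w2 : R) : w1 = w1 / p1 * p1 + (p1 * w2 - p2 * w1) * 0 /\
    w2 = w1 / p1 * p2 + (p1 * w2 - p2 * w1) * p1^-1 by split; field.
set q1 := N1 0 p1^-1; set q2 := N2 0 p1^-1.
have [q10 q20] : 0 <= q1 /\ 0 <= q2 by split;
  [exact: mn_ge0 mn1 _ _|exact: mn_ge0 mn2 _ _].
rewrite leNgt; apply/negP => lt.
apply: no; exists (M / M' * (q2 + C2) + q1), (Num.min e 1).
split; first by rewrite lt_min e0 ltr01.
move=> u1 u2 v1 v2 g; rewrite lt_min => /andP[Xe X1].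
have := h _ _ _ _ g Xe; set X := p1 * u2%:~R - p2 * u1%:~R in Xe X1 *.
set a : R := u1%:~R / p1; set L := ln `|X| => hn.
have [d1 d2] := dec u1%:~R u2%:~R; rewrite -/a -/X in d1 d2.
have up : N2 u1%:~R u2%:~R <= `|a| * N2 p1 p2 + `|X| * q2.
  by rewrite d1 d2 -!(mn_scale mn2); apply: mn_triangle.
have low : `|a| * N1 p1 p2 <= N1 u1%:~R u2%:~R + `|X| * q1.
  rewrite -(normrN X) -!(mn_scale mn1);
    apply: le_trans (mn_triangle mn1 _ _ _ _).
  rewrite le_eqVlt; apply/orP; left; apply/eqP; congr N1.
    by rewrite d1; ring.
  by rewrite d2; ring.
have Xq1 : `|X| * q1 <= q1 by rewrite ler_piMl // ltW.
have Xq2 : `|X| * q2 <= q2 by rewrite ler_piMl // ltW.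
have key : M' * - (M * L) <= M * (`|a| * N2 p1 p2 + q2 + C2).
  by rewrite (_ : M' * - (M * L) = M * - (M' * L)) ?ler_pM2l //; [lra|ring].
have ha : M * (`|a| * N2 p1 p2) <= M' * (`|a| * N1 p1 p2).
  by rewrite mulrCA [M' * _]mulrCA ler_wpM2l // ltW.
rewrite -(ler_pM2l M'0).
have -> : M' * (N1 u1%:~R u2%:~R + (M / M' * (q2 + C2) + q1))
   = M' * (N1 u1%:~R u2%:~R + q1) + M * (q2 + C2) by field; rewrite gt_eqF.
have : M' * (`|a| * N1 p1 p2) <= M' * (N1 u1%:~R u2%:~R + q1) by rewrite
  ler_pM2l //; lra.
by move: key ha; rewrite !mulrDr; lra.
Qed.

(** A is the critical exponent of approximation, that is, the flatness minus 1. *)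
Definition flat_exponents N p1 p2 A : Prop :=
  (forall M, 0 < M -> M < A -> approx_order N p1 p2 M) /\
  (forall M, A < M -> ~ approx_order N p1 p2 M).

Lemma flat_exponents_ratio N1 N2 p1 p2 A B : markov_norm N1 -> markov_norm N2 ->
  irrational_point p1 p2 -> 0 < A -> 0 < B ->
  flat_exponents N1 p1 p2 A -> flat_exponents N2 p1 p2 B ->
  B * N1 p1 p2 <= A * N2 p1 p2.
Proof.
move=> mn1 mn2 irr A0 B0 [_ h1] [h2 _].
have [n10 n20] : 0 <= N1 p1 p2 /\ 0 <= N2 p1 p2.
  by split; [exact: mn_ge0 mn1 _ _|exact: mn_ge0 mn2 _ _].
rewrite leNgt; apply/negP => lt.
set a := N1 p1 p2 in n10 lt; set b := N2 p1 p2 in n20 lt.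
have ab0 : 0 < a + b + 1 by lra.
pose e := Num.min (B / 2) ((B * a - A * b) / (a + b + 1)).
have e0 : 0 < e by rewrite /e lt_min divr_gt0 // divr_gt0 // subr_gt0.
have eB : e <= B / 2 by rewrite /e ge_min lexx.
have e2 : e * (a + b + 1) <= B * a - A * b.
  by rewrite -ler_pdivlMr // /e ge_min lexx orbT.
have := approx_order_ratio mn1 mn2 irr (M := A + e) (M' := B - e).
rewrite -/a -/b => h.
have Ae : 0 < A + e by lra.
have Be : 0 < B - e by lra.
have AA : A < A + e by lra.
have BB : B - e < B by lra.
have := h Ae Be (h1 _ AA) (h2 _ Be BB).
by clearbody e; lra.
Qed.

Lemma flatness_exponents (n : 'rV[R]_2 -> R) p1 p2 A :
  is_norm n -> markov_norm (fun x y => n (vec x y)) -> irrational_point p1 p2 ->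
  n (vec p1 p2) = 1 -> 1 < A ->
  flatness n (vec p1 p2) = A%:E <->
  flat_exponents (fun x y => n (vec x y)) p1 p2 (A - 1).
Proof.
move=> norm_n mn irr Np A1.
have [l1 [l2 [lN lp]]] := supporting_exists mn irr Np.
have fP := flatnessP norm_n mn irr Np lN lp A1; split.
  move=> /fP[hlow hhigh]; split.
    move=> M M0 MA; rewrite -[M](addrK 1).
    by apply: (height_approx mn irr Np lN lp); [lra|apply: hlow; lra].
  move=> M AM hM; pose K := (A + M + 1) / 2.
  apply: (hhigh K); first by rewrite /K; lra.
  by apply: (approx_height mn irr Np lN lp _ _ hM); rewrite /K; lra.
move=> [hlow hhigh]; apply/fP; split.
  move=> K K1 KA; pose M := (A + K) / 2 - 1.
  by apply: (approx_height mn irr Np lN lp (M := M)); rewrite /M;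
    [lra|lra|apply: hlow; lra].
move=> K AK hK; apply: (hhigh (K - 1)); first by lra.
by apply: (height_approx mn irr Np lN lp _ hK); lra.
Qed.

Lemma line_irrational (v : 'rV[R]_2) : irrational_point (v 0 0) (v 0 1) <->
  irrationals (line v).
Proof.
split.
  move=> irr; split.
    exists v => //; apply/eqP => v0; move: (irr 1 0 isT).
    by rewrite v0 !mxE !mul0r subrr eqxx.
  move=> [q /= q0 e].
  have [t _ vt] : line (map_mx ratr q) v by rewrite e; exists 1 => //;
    rewrite scale1r.
  pose w1 := numq (q 0 0) * denq (q 0 1);
    pose w2 := numq (q 0 1) * denq (q 0 0).
  have w0 : (w1, w2) != (0, 0).
    apply: contra q0 => /eqP[/eqP + /eqP].
    rewrite !mulf_eq0 !denq_eq0 !orbF !numq_eq0 => /eqP h1 /eqP h2.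
    have hz k : q 0 k = 0.
      case: k => -[|[|//]] hk.
        by rewrite -[RHS]h1; congr (q 0 _); apply/val_inj.
      by rewrite -[RHS]h2; congr (q 0 _); apply/val_inj.
    by apply/eqP/rowP => k; rewrite hz mxE.
  have qE k : ratr (q 0 k) = (numq (q 0 k))%:~R / (denq (q 0 k))%:~R :> R by [].
  have d0 k : (denq (q 0 k))%:~R != 0 :> R by rewrite intr_eq0 denq_eq0.
  have := irr w1 w2 w0; rewrite -vt !mxE !qE /w1 /w2 !rmorphM /=.
  rewrite (_ : _ - _ = 0) ?eqxx //; field.
  by rewrite !d0.
move=> [[v' /= v'0 e] notQ].
have v0 : v != 0.
  have [t _ vt] : line v v' by rewrite -e; exists 1 => //; rewrite scale1r.
  by apply: contra v'0 => /eqP z; rewrite -vt z scaler0.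
move=> w1 w2 w0; apply/eqP => h; apply: notQ.
pose q : 'rV[rat]_2 := \row_j (if j == 0 then w1%:~R else w2%:~R).
have qE : map_mx ratr q = vec w1%:~R w2%:~R :> 'rV[R]_2.
  by apply/rowP => j; rewrite !mxE; case: ifP => _; rewrite ratr_int.
exists q.
  apply: contra w0 => /eqP z.
  have z1 : q 0 0 = 0 by rewrite z mxE.
  have z2 : q 0 1 = 0 by rewrite z mxE.
  move: z1 z2; rewrite !mxE /= => /eqP + /eqP; rewrite !intr_eq0.
  by move=> /eqP -> /eqP ->.
rewrite qE.
have [c c0 vc] : exists2 c, c != 0 & v = c *: vec w1%:~R w2%:~R.
  have [w10|w1n] := eqVneq w1 0.
    have w2n : w2%:~R != 0 :> R.
      by rewrite intr_eq0; apply: contra w0 => /eqP z; rewrite w10 z.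
    have v00 : v 0 0 = 0.
      move: h; rewrite w10 mulr0 subr0 => /eqP;
        rewrite mulf_eq0 (negbTE w2n) orbF.
      by move/eqP.
    have vE : v = (v 0 1 / w2%:~R) *: vec w1%:~R w2%:~R.
      by rewrite -[LHS]vecE -vecZ v00 w10 mulr0 divfK.
    exists (v 0 1 / w2%:~R) => //; apply: contra v0 => /eqP z.
    by rewrite vE z scale0r.
  have w1n' : w1%:~R != 0 :> R by rewrite intr_eq0.
  have vE : v = (v 0 0 / w1%:~R) *: vec w1%:~R w2%:~R.
    rewrite -[LHS]vecE -vecZ divfK //; congr vec.
    by apply: (mulIf w1n'); rewrite mulrAC divfK //; lra.
  exists (v 0 0 / w1%:~R) => //; apply: contra v0 => /eqP z.
  by rewrite vE z scale0r.
rewrite vc; apply/seteqP; split => _ [t _ <-].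
  by exists (t / c) => //; rewrite scalerA divfK.
by exists (t * c) => //; rewrite scalerA.
Qed.

End ApproximationExponent.

(** * Directions with a prescribed exponent *)

Section Alternating.
Variables (R : realType) (h y c : nat -> R).
Hypotheses (h0 : h 0 = 1) (h1 : h 1 = 1) (y0 : y 0 = 0) (y1 : y 1 = 1).
Hypothesis hS : forall k, h k.+2 = h k + c k * h k.+1.
Hypothesis yS : forall k, y k.+2 = y k + c k * y k.+1.
Hypothesis c1 : forall k, 1 <= c k.

Lemma denominator_ge k : 1 <= h k /\ k.+1%:R <= h k.+1.
Proof.
elim: k => [|k [IH1 IH2]]; first by rewrite h0 h1.
have a1 : 1 <= h k.+1 by apply: le_trans IH2; rewrite ler1n.
split=> //; rewrite hS -natr1.
have : h k.+1 <= c k * h k.+1 by rewrite ler_peMl // (le_trans _ a1).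
by lra.
Qed.

Lemma denominator_gt0 k : 0 < h k.
Proof. by have [a _] := denominator_ge k; apply: lt_le_trans a. Qed.

Lemma denominator_le k : h k.+1 <= h k.+2.
Proof.
rewrite hS; have : h k.+1 <= c k * h k.+1 by rewrite ler_peMl // ltW //
  denominator_gt0.
by have := denominator_gt0 k; lra.
Qed.

Lemma convergents_det k : y k.+1 * h k - y k * h k.+1 = (-1) ^+ k.
Proof.
elim: k => [|k IH]; first by rewrite h0 h1 y0 y1 expr0; ring.
by rewrite exprS -IH hS yS; ring.
Qed.

(** y / h are the convergents of a continued fraction with partial quotients c, started from 0 / 1
    and 1 / 1. The even ones increase, the odd ones decrease and stay above them; r is the supremum
    of the even ones. *)
Lemma alternating_limit : exists r, forall k, (-1) ^+ k * (y k - r * h k) <= 0.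
Proof.
have hp := denominator_gt0.
have sg k : ((-1) ^+ k : R) ^+ 2 = 1 by rewrite sqrr_sign.
pose q k := y k / h k.
have qS k : (-1) ^+ k * (q k.+1 - q k) = (h k * h k.+1)^-1.
  have [a b] : h k != 0 /\ h k.+1 != 0 by rewrite !gt_eqF.
  transitivity ((-1) ^+ k * (y k.+1 * h k - y k * h k.+1) / (h k * h k.+1)).
    by rewrite /q; field; rewrite a b.
  by rewrite convergents_det -expr2 sg mul1r.
have qSS k : 0 <= (-1) ^+ k * (q k.+2 - q k).
  have e : q k.+2 - q k = c k * h k.+1 / h k.+2 * (q k.+1 - q k).
    have [[a b] d] : (h k != 0 /\ h k.+1 != 0) /\ h k.+2 != 0 by rewrite
      !gt_eqF.
    transitivity ((y k.+2 * h k - y k * h k.+2) / (h k * h k.+2)).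
      by rewrite /q; field; rewrite a d.
    transitivity (c k * (y k.+1 * h k - y k * h k.+1) / (h k * h k.+2)).
      by congr (_ / _); rewrite hS yS; ring.
    by rewrite /q; field; rewrite a b d.
  have ck0 : 0 <= c k by apply: le_trans (c1 k).
  have hge j : 0 <= h j by apply/ltW/hp.
  rewrite e mulrCA qS; apply: mulr_ge0; last by rewrite invr_ge0 mulr_ge0.
  by rewrite divr_ge0 // mulr_ge0.
have ev k : (-1) ^+ k.*2 = 1 :> R by rewrite -signr_odd odd_double.
have od k : (-1) ^+ k.*2.+1 = -1 :> R by rewrite exprS ev mulr1.
have up : {homo (fun k => q k.*2) : m n / (m <= n)%N >-> m <= n}.
  apply: homo_leq => [k|k m n|k]; [exact: lexx|exact: le_trans|].
  by have := qSS k.*2; rewrite ev mul1r subr_ge0.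
have down : {homo (fun k => q k.*2.+1) : m n / (m <= n)%N >-> n <= m}.
  apply: homo_leq => [k|k m n a b|k]; [exact: lexx|exact: le_trans b a|].
  by have := qSS k.*2.+1; rewrite od mulN1r oppr_ge0 subr_le0.
have sep j k : q j.*2 <= q k.*2.+1.
  apply: le_trans (up _ _ (leq_maxl j k)) _.
  apply: le_trans (down _ _ (leq_maxr j k)).
  have := qS (maxn j k).*2; rewrite ev mul1r => e.
  by rewrite -subr_ge0 e invr_ge0 mulr_ge0 // ltW.
pose S := [set q k.*2 | k in [set: nat]].
have Sne : S !=set0 by exists (q 0%N), 0%N.
exists (sup S) => k; rewrite -[k]odd_double_half; case: (odd k).
  rewrite add1n od mulN1r oppr_le0 subr_ge0 -ler_pdivlMr //.
  by apply: ge_sup => // _ [j _ <-]; exact: sep.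
rewrite add0n ev mul1r subr_le0 -ler_pdivrMr //; apply: ub_le_sup.
  by exists (q 1%N) => _ [j _ <-]; exact: (sep j 0%N).
by exists k./2.
Qed.

Section Remainders.
Variable r : R.
Hypothesis alt : forall k, (-1) ^+ k * (y k - r * h k) <= 0.
Local Notation D k := (y k - r * h k).

Lemma remainder_abs k : `|D k| = - ((-1) ^+ k * D k).
Proof.
by rewrite -(ler0_norm (alt k)) normrM normrX normrN1 expr1n mul1r.
Qed.

Lemma remainder_sum k : `|D k| * h k.+1 + `|D k.+1| * h k = 1.
Proof.
rewrite !remainder_abs exprS.
transitivity ((-1) ^+ k * (y k.+1 * h k - y k * h k.+1)); first by ring.
by rewrite convergents_det -expr2 sqrr_sign.
Qed.

Lemma remainder_upper k : `|D k| <= (h k.+1)^-1.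
Proof.
have hp := denominator_gt0; rewrite -[X in _ <= X]mul1r ler_pdivlMr //.
by rewrite -[X in _ <= X](remainder_sum k) lerDl mulr_ge0 // ltW.
Qed.

Lemma remainder_le k : `|D k.+1| <= `|D k|.
Proof.
have e : `|D k.+2| = `|D k| - c k * `|D k.+1|.
  by rewrite !remainder_abs !exprS hS yS; ring.
have : `|D k.+1| <= c k * `|D k.+1| by rewrite ler_peMl.
by have := normr_ge0 (D k.+2); rewrite e; lra.
Qed.

(** Of the two terms in [remainder_sum] the first is the larger, hence at least 1 / 2. *)
Lemma remainder_lower k : (2 * h k.+2)^-1 <= `|D k.+1|.
Proof.
have hp := denominator_gt0.
rewrite -[X in X <= _]mul1r ler_pdivrMr ?mulr_gt0 //
  -[X in X <= _](remainder_sum k.+1).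
have l1 : `|D k.+2| * h k.+1 <= `|D k.+1| * h k.+2.
  apply: ler_pM => //; [exact: ltW|exact: remainder_le|exact: denominator_le].
by lra.
Qed.

(* Best approximation: combinations x w_k + z w_{k+1} either are large or have
   coefficients of opposite signs. *)
Lemma best_approximation k (x z : int) : x != 0 \/ z != 0 ->
  `|x%:~R * h k + z%:~R * h k.+1| < h k.+1 ->
  `|D k| <= `|x%:~R * D k + z%:~R * D k.+1|.
Proof.
move=> xz0 small; have [hk hk1] := (denominator_gt0 k, denominator_gt0 k.+1).
have int1 (v : int) : v != 0 -> 1 <= `|v%:~R : R|.
  by move=> v0; rewrite -intr_norm -[1]/(1%:~R) ler_int; lia.
have x0 : x != 0.
  apply/eqP => x0; move: small xz0;
    rewrite x0 mul0r add0r normrM (gtr0_norm hk1).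
  move=> small [/eqP//|z0]; move: small; rewrite ltNge => /negP[].
  by rewrite ler_peMl ?(ltW hk1) // int1.
have [/eqP ->|z0] := boolP (z == 0).
  by rewrite mul0r addr0 normrM ler_peMl // int1.
have [xz|xz] := ltP 0 (x%:~R * z%:~R : R).
  exfalso; move: small; rewrite ltNge => /negP[].
  have -> : `|x%:~R * h k + z%:~R * h k.+1| = `|x%:~R| * h k + `|z%:~R| * h
    k.+1.
    have [xp|xn] := ltP 0 (x%:~R : R).
      have zp : 0 < z%:~R :> R by rewrite -(pmulr_rgt0 _ xp).
      by rewrite !gtr0_norm // addr_gt0 // mulr_gt0.
    have xn' : x%:~R < 0 :> R by rewrite lt_neqAle intr_eq0 x0.
    have zn : z%:~R < 0 :> R by rewrite -(nmulr_rgt0 _ xn').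
    rewrite (ltr0_norm xn') (ltr0_norm zn) ltr0_norm; first by ring.
    by rewrite -oppr_gt0 opprD -!mulNr addr_gt0 // mulr_gt0 // oppr_gt0.
  have : h k.+1 <= `|z%:~R| * h k.+1 by rewrite ler_peMl ?(ltW hk1) // int1.
  have : 0 <= `|x%:~R| * h k by rewrite mulr_ge0 // ltW.
  by lra.
have opp : `|x%:~R * D k + z%:~R * D k.+1| = `|x%:~R| * `|D k| + `|z%:~R| * `|D
  k.+1|.
  have a0 := alt k; have a1 := alt k.+1;
    rewrite exprS mulN1r mulNr oppr_le0 in a1.
  rewrite !remainder_abs exprS; set s := (-1) ^+ k in a0 a1 *.
  transitivity (`|x%:~R * (s * D k) + z%:~R * (s * D k.+1)|).
    rewrite (_ : x%:~R * (s * _) + _ = s * (x%:~R * D k + z%:~R * D k.+1));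
      last by ring.
    by rewrite normrM normrX normrN1 expr1n mul1r.
  rewrite (_ : - (-1 * s * D k.+1) = s * D k.+1); last by ring.
  have [xp|xn] := ltP 0 (x%:~R : R).
    have zn : z%:~R <= 0 :> R by rewrite -(pmulr_rle0 _ xp).
    rewrite (gtr0_norm xp) (ler0_norm zn) ler0_norm; first by ring.
    have q1 : 0 <= x%:~R * - (s * D k) by rewrite mulr_ge0 ?(ltW xp) ?oppr_ge0.
    have q2 : 0 <= - z%:~R * (s * D k.+1) by rewrite mulr_ge0 ?oppr_ge0.
    by lra.
  have xn' : x%:~R < 0 :> R by rewrite lt_neqAle intr_eq0 x0.
  have zp : 0 <= z%:~R :> R by rewrite -(nmulr_rle0 _ xn').
  rewrite (ltr0_norm xn') (ger0_norm zp) ger0_norm; first by ring.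
  have q1 : 0 <= - x%:~R * - (s * D k) by rewrite mulr_ge0 ?oppr_ge0 ?(ltW xn').
  have q2 : 0 <= z%:~R * (s * D k.+1) by rewrite mulr_ge0.
  by lra.
rewrite opp; have : `|D k| <= `|x%:~R| * `|D k| by rewrite ler_peMl // int1.
have : 0 <= `|z%:~R| * `|D k.+1| by rewrite mulr_ge0.
by lra.
Qed.

Lemma remainder_nonzero k : D k != 0 \/ D k.+1 != 0.
Proof.
have [e|e] := eqVneq (D k) 0; [right|by left].
apply/eqP => e'; have := remainder_sum k.
by rewrite e e' normr0 !mul0r addr0 => /eqP; rewrite eq_sym oner_eq0.
Qed.

End Remainders.
End Alternating.

(** * The continued fraction driven by the norm *)

Section Construction.
Variables (R : realType) (N : R -> R -> R) (E : R) (u1 u2 w1 w2 : int).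
Hypothesis mn : markov_norm N.
Hypothesis Ndef : forall x y, N x y = 0 -> x = 0 /\ y = 0.
Hypothesis E0 : 0 < E.
Hypothesis uw : good u1 u2 w1 w2.

Definition quotient (b : int * int) : nat :=
  (Num.truncn (expR (N b.1%:~R b.2%:~R / E))).+1.

Fixpoint convergent_pair (k : nat) : (int * int) * (int * int) :=
  if k is k'.+1 then
    let ab := convergent_pair k' in
    (ab.2, (ab.1.1 + ab.2.1 *+ quotient ab.2, ab.1.2 + ab.2.2 *+ quotient ab.2))
  else ((u1, u2), (w1, w2)).

Definition convergent k : int * int := (convergent_pair k).1.
Local Notation W := convergent.

Lemma convergent_good k :
  good (W k).1 (W k).2 (W k.+1).1 (W k.+1).2.
Proof.
rewrite /convergent; elim: k => [//|k IH].
exact: (good_iter (good_swap IH)).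
Qed.

Local Notation e := (u1 * w2 - u2 * w1).
(** Denominator and numerator of a vector: [hgt] is 1 at u and at w, [abs] is 0 at u and 1 at w, so
    that z = (hgt - abs) u + abs w. *)
Let hgt (z1 z2 : int) : int := e * ((w2 - u2) * z1 + (u1 - w1) * z2).
Let abs (z1 z2 : int) : int := e * (u1 * z2 - u2 * z1).
Let h k : R := (hgt (W k).1 (W k).2)%:~R.
Let y k : R := (abs (W k).1 (W k).2)%:~R.
Let c k : R := (quotient (W k.+1))%:R.

Lemma base_sqr : e * e = 1.
Proof. by case: (good_det uw) => ->. Qed.

Lemma convergent_init : [/\ h 0 = 1, h 1 = 1, y 0 = 0 & y 1 = 1].
Proof.
rewrite /h /y /hgt /abs /=; have s := base_sqr; split.
- rewrite (_ : e * _ = 1) //; rewrite -[RHS]s; ring.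
- rewrite (_ : e * _ = 1) //; rewrite -[RHS]s; ring.
- rewrite (_ : e * _ = 0) //; ring.
- by rewrite s.
Qed.

Lemma convergentSS k : (W k.+2).1 = (W k).1 + (W k.+1).1 *+ quotient (W k.+1) /\
  (W k.+2).2 = (W k).2 + (W k.+1).2 *+ quotient (W k.+1).
Proof. by []. Qed.

Lemma convergent_h k : h k.+2 = h k + c k * h k.+1.
Proof.
rewrite /h /c; have [-> ->] := convergentSS k.
rewrite -[(quotient _)%:R]/((quotient _)%:~R) -rmorphM -rmorphD /=;
  congr (_%:~R).
by rewrite /hgt -(mulr_natl (W k.+1).1) -(mulr_natl (W k.+1).2) !natz; ring.
Qed.

Lemma convergent_y k : y k.+2 = y k + c k * y k.+1.
Proof.
rewrite /y /c; have [-> ->] := convergentSS k.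
rewrite -[(quotient _)%:R]/((quotient _)%:~R) -rmorphM -rmorphD /=;
  congr (_%:~R).
by rewrite /abs -(mulr_natl (W k.+1).1) -(mulr_natl (W k.+1).2) !natz; ring.
Qed.

Lemma quotient_ge1 k : 1 <= c k.
Proof. by rewrite /c /quotient ler1n. Qed.

Let h0 : h 0 = 1. Proof. by case: convergent_init. Qed.
Let h1 : h 1 = 1. Proof. by case: convergent_init. Qed.
Let y0 : y 0 = 0. Proof. by case: convergent_init. Qed.
Let y1 : y 1 = 1. Proof. by case: convergent_init. Qed.

Section Limit.
Variable r : R.
Hypothesis alt : forall k, (-1) ^+ k * (y k - r * h k) <= 0.
Let p1 : R := (1 - r) * u1%:~R + r * w1%:~R.
Let p2 : R := (1 - r) * u2%:~R + r * w2%:~R.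
Let l1 : R := (e * (w2 - u2))%:~R.
Let l2 : R := (e * (u1 - w1))%:~R.
Local Notation X z1 z2 := (p1 * z2%:~R - p2 * z1%:~R).
Local Notation D k := (y k - r * h k).

Let eR : (e%:~R : R) * e%:~R = 1.
Proof. by rewrite -rmorphM /= base_sqr. Qed.

Let eE : e%:~R = u1%:~R * w2%:~R - u2%:~R * w1%:~R :> R.
Proof. by rewrite rmorphB !rmorphM. Qed.

Let l1E : l1 = e%:~R * (w2%:~R - u2%:~R).
Proof. by rewrite /l1 rmorphM [Z in _ * Z]rmorphB. Qed.
Let l2E : l2 = e%:~R * (u1%:~R - w1%:~R).
Proof. by rewrite /l2 rmorphM [Z in _ * Z]rmorphB. Qed.

Lemma limit_normalized : l1 * p1 + l2 * p2 = 1.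
Proof.
rewrite l1E l2E /p1 /p2 -[RHS]eR.
transitivity (e%:~R * (u1%:~R * w2%:~R - u2%:~R * w1%:~R) : R); first by ring.
by rewrite -eE.
Qed.

Lemma limit_hgt z1 z2 : (hgt z1 z2)%:~R = l1 * z1%:~R + l2 * z2%:~R.
Proof. by rewrite /hgt /l1 /l2 !(rmorphM, rmorphD, rmorphB) /=; ring. Qed.

Lemma limit_det z1 z2 :
  X z1 z2 = e%:~R * ((abs z1 z2)%:~R - r * (hgt z1 z2)%:~R).
Proof.
have aE : (abs z1 z2)%:~R = e%:~R * (u1%:~R * z2%:~R - u2%:~R * z1%:~R) :> R.
  by rewrite /abs rmorphM [Z in _ * Z]rmorphB !rmorphM.
rewrite aE limit_hgt l1E l2E /p1 /p2.
transitivity (e%:~R * e%:~R * ((u1%:~R * z2%:~R - u2%:~R * z1%:~R) - r *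
  ((w2%:~R - u2%:~R) * z1%:~R + (u1%:~R - w1%:~R) * z2%:~R)) : R); last by ring.
by rewrite eR mul1r; ring.
Qed.

Lemma norm_e : `|e%:~R| = 1 :> R.
Proof. by case: (good_det uw) => ->; rewrite ?mulrN1z ?normrN normr1. Qed.

Lemma convergent_side k : `|X (W k).1 (W k).2| = `|D k|.
Proof. by rewrite limit_det normrM norm_e mul1r. Qed.

Lemma limit_best k (z1 z2 : int) : (z1, z2) != (0, 0) ->
  `|(hgt z1 z2)%:~R| < h k.+1 -> `|D k| <= `|X z1 z2|.
Proof.
move=> z0 small; have := good_det (convergent_good k).
set a1 := (W k).1; set a2 := (W k).2; set b1 := (W k.+1).1;
  set b2 := (W k.+1).2.
set d := a1 * b2 - a2 * b1 => hd.
have dd : d * d = 1 by case: hd => ->.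
(* Integer coordinates of the vector in the basis of two consecutive convergents. *)
pose x := d * (z1 * b2 - z2 * b1); pose z := d * (a1 * z2 - a2 * z1).
have E1 : z1 = x * a1 + z * b1.
  by rewrite -[LHS]mul1r -dd /x /z /d; ring.
have E2 : z2 = x * a2 + z * b2.
  by rewrite -[LHS]mul1r -dd /x /z /d; ring.
have hE : (hgt z1 z2)%:~R = x%:~R * h k + z%:~R * h k.+1.
  by rewrite /h -!rmorphM -rmorphD /=; congr (_%:~R); rewrite E1 E2 /hgt; ring.
have XE : `|X z1 z2| = `|x%:~R * D k + z%:~R * D k.+1|.
  rewrite limit_det normrM norm_e mul1r; congr (`|_|).
  rewrite hE (_ : (abs z1 z2)%:~R = x%:~R * y k + z%:~R * y k.+1);
    first by ring.
  by rewrite /y -!rmorphM -rmorphD /=; congr (_%:~R); rewrite E1 E2 /abs; ring.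
rewrite XE; apply: (best_approximation h0 h1 convergent_h quotient_ge1 alt).
  have [x0|x0] := eqVneq x 0; [right|by left].
  by apply: contra z0 => /eqP q0; rewrite E1 E2 x0 q0 !mul0r !addr0.
by rewrite -hE.
Qed.

Lemma limit_irrational : irrational_point p1 p2.
Proof.
move=> z1 z2 z0; apply/eqP => X0.
pose k := Num.truncn `|(hgt z1 z2)%:~R : R|.
have hk : `|(hgt z1 z2)%:~R : R| < h k.+1.
  have [_ b] := denominator_ge h0 h1 convergent_h quotient_ge1 k.
  by apply: lt_le_trans b; exact: truncnS_gt.
have hk1 : `|(hgt z1 z2)%:~R : R| < h k.+2.
  exact: lt_le_trans hk (denominator_le h0 h1 convergent_h quotient_ge1 k).
have := limit_best z0 hk; have := limit_best z0 hk1.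
rewrite X0 normr0 !normr_le0 => /eqP a /eqP b.
have := remainder_nonzero h0 h1 y0 y1 convergent_h convergent_y alt k.
by rewrite a b eqxx => -[].
Qed.

Let Npos : 0 < N p1 p2.
Proof.
rewrite lt0r (mn_ge0 mn) andbT; apply/eqP => /Ndef[a b].
by have := limit_normalized; rewrite a b !mulr0 addr0 => /eqP;
  rewrite eq_sym oner_eq0.
Qed.

Let t := N (- l2) l1.
Let t0 : 0 <= t. Proof. exact: mn_ge0 mn _ _. Qed.

Lemma limit_norm z1 z2 :
  N z1%:~R z2%:~R <= `|(hgt z1 z2)%:~R| * N p1 p2 + `|X z1 z2| * t /\
  `|(hgt z1 z2)%:~R| * N p1 p2 <= N z1%:~R z2%:~R + `|X z1 z2| * t.
Proof.
rewrite limit_hgt.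
have d1 := decompose1 limit_normalized z1%:~R z2%:~R.
have d2 := decompose2 limit_normalized z1%:~R z2%:~R.
set m := l1 * _ + _ in d1 d2 *; set x := X z1 z2 in d1 d2 *.
have up : N z1%:~R z2%:~R <= `|m| * N p1 p2 + `|x| * t.
  rewrite -d1 -d2 -[- (x * l2)]mulrN -!(mn_scale mn); exact: mn_triangle.
split; first exact: up.
rewrite -(normrN x) -!(mn_scale mn).
apply: le_trans (mn_triangle mn _ _ _ _).
by rewrite -d1 -d2 le_eqVlt; apply/orP; left; apply/eqP; congr N; ring.
Qed.

(** The convergents are too close: |X| <= 1 / h, where the next denominator h is at least exp(n(w) /
    E), so that E (- ln |X|) >= n(w). *)
Lemma limit_not_approx M : E < M -> ~ approx_order N p1 p2 M.
Proof.
move=> EM [C [d [d0 hM]]].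
have hS k : k.+1%:R <= h k.+1 by case: (denominator_ge h0 h1 convergent_h
  quotient_ge1 k).
have hpos := denominator_gt0 h0 h1 convergent_h quotient_ge1.
pose B := Num.max d^-1 (expR (`|C| / (M - E))).
pose k := Num.truncn B.
have Bh : B < h k.+2.
  apply: lt_le_trans (truncnS_gt _) _.
  exact: le_trans (hS k) (denominator_le h0 h1 convergent_h quotient_ge1 k).
have up := remainder_upper h0 h1 y0 y1 convergent_h convergent_y quotient_ge1
  alt k.+1.
have Xk := convergent_side k.+1.
set x := `|X (W k.+1).1 (W k.+1).2| in Xk; rewrite -Xk in up.
have x0 : 0 < x.
  by rewrite /x normr_gt0; apply: limit_irrational;
    apply: good_neq0 (convergent_good k.+1).
have lx : ln (h k.+2) <= - ln x.
  by rewrite lerNr -lnV ?posrE // ler_ln ?posrE ?invr_gt0.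
have := Bh; rewrite /B gt_max => /andP[hd hC].
have xd : x < d.
  apply: le_lt_trans up _; rewrite -[d]invrK ltf_pV2 ?posrE ?invr_gt0 //.
have := hM _ _ _ _ (convergent_good k.+1) xd; rewrite -/x.
set m := N _ _ => hn.
have mh : m / E <= ln (h k.+2).
  rewrite -[m / E]expRK ler_ln ?posrE ?expR_gt0 // convergent_h.
  have q1 : expR (m / E) <= c k by rewrite /c /quotient ltW // truncnS_gt.
  have q2 : c k <= c k * h k.+1.
    by rewrite ler_peMr //; apply: le_trans (hS k); rewrite ler1n.
  by have := hpos k; lra.
have Ch : `|C| / (M - E) < ln (h k.+2).
  by rewrite -[_ / _]expRK ltr_ln ?posrE ?expR_gt0.
rewrite ltr_pdivrMr ?subr_gt0 // in Ch; rewrite ler_pdivrMr // in mh.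
have h5 : ln (h k.+2) * (M - E) <= - ln x * (M - E) by rewrite ler_pM2r //
  subr_gt0.
have h6 : ln (h k.+2) * E <= - ln x * E by rewrite ler_pM2r.
by have := ler_norm C; lra.
Qed.

(** A vector with [hgt] between two consecutive denominators is no closer to p than the convergent w
    of the smaller one, so - ln |X| is at most n(w) / E + ln h up to a constant. Here n(w) exceeds
    the norm of the vector by at most a constant. *)
Lemma limit_approx M : 0 < M -> M < E -> approx_order N p1 p2 M.
Proof.
move=> M0 ME.
have hpos := denominator_gt0 h0 h1 convergent_h quotient_ge1.
have hS k : k.+1%:R <= h k.+1 by case: (denominator_ge h0 h1 convergent_h
  quotient_ge1 k).
have hmono j : h j <= h j.+1.
  case: j => [|j]; first by rewrite h0 h1.
  exact: denominator_le h0 h1 convergent_h quotient_ge1 j.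
have k0 : 0 < 1 - M / E by rewrite subr_gt0 ltr_pdivrMr // mul1r.
(* M kap / N p = 1 - M / E, so that ln x <= x - 1, applied at kap x, fits the term M ln h into the
   share of the norm left over by M / E. *)
pose kap := (1 - M / E) * N p1 p2 / M.
have kap0 : 0 < kap by rewrite divr_gt0 // mulr_gt0.
pose C := M * ln 6 + M / E * (2 * t) + M * (kap * (t / N p1 p2) - 1 - ln kap).
exists C, 1; split=> // a1 a2 b1 b2 g X1.
have a0 := good_neq0 g.
have X0 : 0 < `|X a1 a2| by rewrite normr_gt0; exact: limit_irrational.
set H : R := `|(hgt a1 a2)%:~R|.
have H1 : 1 <= H.
  rewrite /H -intr_norm -[1]/(1%:~R) ler_int.
  suff : hgt a1 a2 != 0 by rewrite -normr_gt0 gtz0_ge1.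
  apply/eqP => z; move: X1; rewrite limit_det normrM norm_e mul1r z mulr0 subr0.
  rewrite -intr_norm -[1]/(1%:~R) ltr_int => z'.
  have az : abs a1 a2 = 0 by lia.
  have := limit_irrational a0; rewrite limit_det z az.
  by rewrite mulr0z mulr0 subr0 mulr0 eqxx.
have [k hk1 hk2] : exists2 k, h k.+1 <= H & H < h k.+2.
  have ex : exists j, H < h j.+1.
    exists (Num.truncn H); apply: lt_le_trans (hS _); exact: truncnS_gt.
  case: (ex_minnP ex) => -[|j] hj hmin; first by move: hj; rewrite h1 ltNge H1.
  exists j => //; rewrite leNgt; apply/negP => hlt.
  by have := hmin _ hlt; rewrite ltnn.
have best := limit_best a0 hk2.
have low := remainder_lower h0 h1 y0 y1 convergent_h convergent_y quotient_ge1
  alt k.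
set x := `|X a1 a2| in X0 X1 best *.
have hx : (2 * h k.+2)^-1 <= x by apply: le_trans low best.
have [upz lowz] := limit_norm a1 a2; rewrite -/H -/x in upz lowz.
have [upw _] := limit_norm (W k.+1).1 (W k.+1).2.
rewrite convergent_side -[(hgt _ _)%:~R]/(h k.+1) (gtr0_norm (hpos _)) in upw.
set m := N (W k.+1).1%:~R _ in upw; set nz := N a1%:~R a2%:~R in upz lowz *.
have Dt : `|D k.+1| * t <= t.
  by rewrite ler_piMl //; apply: le_trans best _; exact: ltW.
have xt : x * t <= t by rewrite ler_piMl // ltW.
have mz : m <= nz + 2 * t.
  have : h k.+1 * N p1 p2 <= H * N p1 p2 by rewrite ler_pM2r.
  by lra.
have hk2E : h k.+2 <= 3 * expR (m / E) * h k.+1.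
  rewrite convergent_h.
  have q1 : c k <= expR (m / E) + 1.
    by rewrite /c /quotient -natr1 lerD2r truncn_le expR_ge0.
  have m0 : 0 <= m / E by rewrite divr_ge0 ?(mn_ge0 mn) // ltW.
  have e1 : 1 <= expR (m / E) by rewrite -[Z in Z <= _]expR0 ler_expR.
  have q3 := hmono k.
  have q2 : c k * h k.+1 <= (expR (m / E) + 1) * h k.+1.
    exact: ler_wpM2r (ltW (hpos _)) _ _ q1.
  have q4 : h k.+1 <= expR (m / E) * h k.+1 by rewrite ler_peMl //
    (ltW (hpos _)).
  by lra.
have lnx : - ln x <= ln 6 + m / E + ln (h k.+1).
  have h2 : (6 * expR (m / E) * h k.+1)^-1 <= x.
    apply: le_trans hx; rewrite lef_pV2 ?posrE ?mulr_gt0 ?expR_gt0 ?hpos ?ltr0n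
      //.
    by have := hk2E; lra.
  have : ln (6 * expR (m / E) * h k.+1)^-1 <= ln x.
    by rewrite ler_ln ?posrE // invr_gt0 !mulr_gt0 ?expR_gt0 ?hpos.
  rewrite lnV ?posrE ?mulr_gt0 ?expR_gt0 ?hpos //.
  rewrite [ln (_ * h _)]lnM ?[ln (6 * _)]lnM ?posrE ?mulr_gt0 ?expR_gt0 ?hpos
    // expRK.
  by lra.
have lnh : ln (h k.+1) <= ln ((nz + t) / N p1 p2).
  rewrite ler_ln ?posrE ?hpos //; last first.
    rewrite divr_gt0 //; have : 0 < H * N p1 p2 by rewrite mulr_gt0 //
      (lt_le_trans _ H1).
    by lra.
  by apply: le_trans hk1 _; rewrite ler_pdivlMr //; lra.
have pos : 0 < (nz + t) / N p1 p2.
  rewrite divr_gt0 //; have : 0 < H * N p1 p2 by rewrite mulr_gt0 //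
    (lt_le_trans _ H1).
  by lra.
have lnk : ln kap + ln ((nz + t) / N p1 p2) <= kap * ((nz + t) / N p1 p2) - 1.
  by rewrite -lnM ?posrE //; apply: ln_leB1; rewrite mulr_gt0.
have s1 : M * (- ln x) <= M * (ln 6 + m / E + (kap * ((nz + t) / N p1 p2) - 1 -
  ln kap)).
  by rewrite ler_pM2l //; lra.
have s2 : M / E * m <= M / E * (nz + 2 * t) by rewrite ler_pM2l // divr_gt0.
have s3 : M * (kap * ((nz + t) / N p1 p2)) = (1 - M / E) * nz + M * (kap * (t /
  N p1 p2)).
  by rewrite /kap; field; rewrite !gt_eqF.
rewrite /C -mulrN; apply: le_trans s1 _.
have s4 : M * (m / E) = M / E * m by rewrite mulrCA mulrC mulrAC mulrC mulrA.
have s5 : M * (ln 6 + m / E + (kap * ((nz + t) / N p1 p2) - 1 - ln kap)) =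
  M * ln 6 + M * (m / E) + M * (kap * ((nz + t) / N p1 p2)) - M - M * ln kap by
    ring.
rewrite s5 s4 s3.
by clearbody kap; lra.
Qed.

End Limit.

Lemma construction : exists r p1 p2, [/\ 0 <= r /\ r <= 1,
  p1 = (1 - r) * u1%:~R + r * w1%:~R, p2 = (1 - r) * u2%:~R + r * w2%:~R,
  irrational_point p1 p2 & flat_exponents N p1 p2 E].
Proof.
have [r alt] := alternating_limit h0 h1 y0 y1 convergent_h convergent_y
  quotient_ge1.
exists r, ((1 - r) * u1%:~R + r * w1%:~R), ((1 - r) * u2%:~R + r * w2%:~R).
split=> //.
- have := alt 0; have := alt 1; rewrite h0 h1 y0 y1 expr0 expr1; split; lra.
- exact: limit_irrational alt.
- split=> M; first exact: limit_approx alt M.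
  exact: limit_not_approx alt M.
Qed.

End Construction.

(** * Rigidity *)

Section Rigidity.
Variable R : realType.
Implicit Types (N : R -> R -> R) (n : 'rV[R]_2 -> R).

(** Upper counterpart of [intercept_nat]: the error 2 (B / A) lam^(-2 (j + 1)) is weakened to O(1 /
    j), enough for a limit. *)
Lemma norm_iter_le N (u1 u2 v1 v2 : int) (mn : markov_norm N)
    (uv : good u1 u2 v1 v2) j :
  N (v1 + u1 *+ j.+1)%:~R (v2 + u2 *+ j.+1)%:~R <=
  j.+1%:R * N u1%:~R u2%:~R + intercept N u1 u2 v1 v2
  + 2 * (coef N u1 u2 (- v1) (- v2) / coef N u1 u2 v1 v2) / (j.+1%:R * N u1%:~R
    u2%:~R).
Proof.
have A0 := coef_gt0 mn uv; have B0 := coef_gt0 mn (good_oppr uv).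
have n0 := good_norm_gt0 mn uv; have l1 := eigen_gt1 mn uv.
have := trace_iter mn uv j.+1; rewrite /trace_of.
set m := N (v1 + _)%:~R _; set A := coef _ _ _ v1 _ in A0 *;
  set B := coef _ _ _ _ _ in B0 *.
set lam := eigen _ _ _ in l1 *; set k := j.+1.
have k0 : 0 < k%:R * N u1%:~R u2%:~R by rewrite mulr_gt0 // ltr0n.
have lk : 0 < lam ^+ k by rewrite exprn_gt0 // (lt_trans _ l1).
have lk2 : lam ^+ k ^+ 2 = expR (k%:R * N u1%:~R u2%:~R).
  rewrite exprAC expRM_natl; congr (_ ^+ k); exact: eigen_sqr.
have lkn : ln (lam ^+ k) = k%:R * N u1%:~R u2%:~R / 2.
  by have := congr1 (@ln R) lk2; rewrite expRK lnXn // => <-;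
    rewrite -mulr_natl; field.
move=> e; have up : expR (m / 2) <= A * lam ^+ k * (1 + B / A * (lam ^+ k) ^-
  2).
  have -> : A * lam ^+ k * (1 + B / A * (lam ^+ k) ^- 2) = A * lam ^+ k + B *
    lam ^- k.
    by field; rewrite !gt_eqF.
  by rewrite -e lerDl expR_ge0.
have BA : 0 < B / A by rewrite divr_gt0.
have x0 : 0 < B / A * (lam ^+ k) ^- 2 by rewrite mulr_gt0 // invr_gt0 exprn_gt0.
have x1 : 0 < 1 + B / A * (lam ^+ k) ^- 2 by rewrite addr_gt0.
have : m / 2 <= ln (A * lam ^+ k * (1 + B / A * (lam ^+ k) ^- 2)).
  rewrite -[m / 2]expRK ler_ln ?posrE ?expR_gt0 //.
  exact: mulr_gt0 (mulr_gt0 A0 lk) x1.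
rewrite [X in _ <= X](lnM _ _); [|exact: mulr_gt0 A0 lk|exact: x1].
rewrite lnM ?posrE // lkn.
have lx := ln_leB1 x1; rewrite [X in _ <= X]addrAC subrr add0r in lx.
have xk : B / A * (lam ^+ k) ^- 2 <= B / A / (k%:R * N u1%:~R u2%:~R).
  rewrite ler_pM2l // lk2 lef_pV2 ?posrE ?expR_gt0 //.
  by apply: le_trans (expR_ge1Dx _); rewrite lerDr.
rewrite /intercept -/A.
have -> : 2 * (B / A) / (k%:R * N u1%:~R u2%:~R) = 2 * (B / A / (k%:R * N
  u1%:~R u2%:~R)).
  by rewrite [RHS]mulrA.
move: lx xk; move: (B / A / _) (B / A * _) (ln (1 + _)) => q1 q2 q3.
by lra.
Qed.

(** ln coth(x / 2), a quarter of the corner at a vector of norm x. *)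
Definition ln_coth (x : R) : R := ln ((expR x + 1) / (expR x - 1)).

Lemma ln_coth_lt (x y : R) : 0 < x -> x < y -> ln_coth y < ln_coth x.
Proof.
move=> x0 xy; have y0 := lt_trans x0 xy.
have gt1 (z : R) : 0 < z -> 1 < expR z by move=> z0;
  rewrite -[X in X < _]expR0 ltr_expR.
have [a b] := (gt1 _ x0, gt1 _ y0);
  have ab : expR x < expR y by rewrite ltr_expR.
rewrite /ln_coth; move: (expR x) (expR y) a b ab => p q a b ab.
have d (z : R) : 1 < z -> 0 < (z + 1) / (z - 1) by move=> z1; apply: divr_gt0;
  lra.
rewrite ltr_ln ?posrE; [|exact: d|exact: d].
by rewrite ltr_pdivrMr ?subr_gt0 // mulrAC ltr_pdivlMr ?subr_gt0 //; nra.
Qed.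

Lemma ln_coth_gt0 (x : R) : 0 < x -> 0 < ln_coth x.
Proof.
move=> x0; have a : 1 < expR x by rewrite -[X in X < _]expR0 ltr_expR.
by rewrite /ln_coth ln_gt0 // ltr_pdivlMr; lra.
Qed.

(* The corner of the unit sphere at a rational point has exterior angle
   4 ln coth(n/2), which is not homogeneous in the length n. *)
Lemma proportional_ge1 N1 N2 c : markov_norm N1 -> markov_norm N2 -> 0 < c ->
  (forall x y, N1 x y = c * N2 x y) -> 1 <= c.
Proof.
move=> mn1 mn2 c0 h12; have g := good_base.
rewrite leNgt; apply/negP => c1.
set n1 := N1 1%:~R 0%:~R; set n2 := N2 1%:~R 0%:~R.
have n20 : 0 < n2 := good_norm_gt0 mn2 g.
have n12 : n1 < n2 by rewrite /n1 h12 -/n2 gtr_pMl.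
have n10 : 0 < n1 := good_norm_gt0 mn1 g.
pose A := coef N2 1 0 0 1; pose B := coef N2 1 0 (- 0) (- 1).
have A0 : 0 < A := coef_gt0 mn2 g.
have B0 : 0 < B := coef_gt0 mn2 (good_oppr g).
(* The bounds at v and - v along u = (1, 0) are added; the linear terms cancel because n1 = c n2. *)
have key j : 4 * ln_coth n1 <= c * (4 * ln_coth n2 + 2 * (B / A + A / B) /
  (j.+1%:R * n2)).
  have a1 := intercept_nat mn1 g j.+1;
    have a2 := intercept_nat mn1 (good_oppr g) j.+1.
  rewrite -/n1 -[n1 *+ j.+1]mulr_natl h12 in a1.
  rewrite -/n1 -[n1 *+ j.+1]mulr_natl h12 in a2.
  have n1E : n1 = c * n2 by exact: h12.
  have b1 := norm_iter_le mn2 g j; have b2 := norm_iter_le mn2 (good_oppr g) j.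
  rewrite -/A -/B -/n2 in b1; rewrite -/A -/B -/n2 in b2.
  have s1 := intercept_sum mn1 g; have s2 := intercept_sum mn2 g.
  rewrite -/n1 -/n2 -/(ln_coth n1) in s1; rewrite -/n2 -/(ln_coth n2) in s2.
  rewrite -s1 -s2.
  set m1 := N2 _ _ in a1 b1; set m2 := N2 _ _ in a2 b2.
  have cb1 := ler_wpM2l (ltW c0) b1; have cb2 := ler_wpM2l (ltW c0) b2.
  have -> : 2 * (B / A + A / B) / (j.+1%:R * n2)
    = 2 * (B / A) / (j.+1%:R * n2) + 2 * (A / B) / (j.+1%:R * n2) by ring.
  move: (2 * (B / A) / (j.+1%:R * n2)) (2 * (A / B) / (j.+1%:R * n2)) cb1 cb2
    => q1 q2 cb1 cb2.
  rewrite n1E in a1 a2.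
  by move: (intercept N1 _ _ _ _) (intercept N1 _ _ _ _) (intercept N2 _ _ _ _)
    a1 a2 cb1 cb2 => *; lra.
have lt21 := ln_coth_lt n10 n12; have l2 := ln_coth_gt0 n20.
(* For c < 1 one has n1 < n2, and [ln_coth] decreases: the gap is positive while the error is O(1 /
   j). *)
set gap := 4 * ln_coth n1 - c * (4 * ln_coth n2).
have gap0 : 0 < gap.
  have : c * ln_coth n2 < ln_coth n2 by rewrite gtr_pMl.
  by rewrite /gap; lra.
pose S := c * (2 * (B / A + A / B)) / n2.
have := truncnS_gt (S / gap); set j := Num.truncn _ => hj.
rewrite ltr_pdivrMr // in hj.
have := key j; rewrite mulrDr -lerBlDl -/gap leNgt => /negP[].
rewrite (_ : c * _ = S / j.+1%:R).
  by rewrite ltr_pdivrMr ?ltr0n // mulrC.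
by rewrite /S; field; rewrite !gt_eqF.
Qed.

End Rigidity.

(** * Density of the level sets *)

Section Density.
Variables (R : realType) (n : 'rV[R]_2 -> R).
Local Notation N := (fun x y => n (vec x y)).
Hypothesis norm_n : is_norm n.
Hypothesis mn : markov_norm N.

Lemma norm_vec_gt0 p1 p2 : irrational_point p1 p2 -> 0 < n (vec p1 p2).
Proof.
have [n0 nsep _ _] := norm_n => /irrational_coord[p10 _].
rewrite lt0r n0 andbT; apply: contra p10 => /eqP /nsep /rowP /(_ 0).
by rewrite !mxE /= => ->.
Qed.

Lemma flat_exponents_scale p1 p2 t A : irrational_point p1 p2 -> t != 0 ->
  flat_exponents N p1 p2 A -> flat_exponents N (t * p1) (t * p2) A.
Proof.
move=> irr t0 [h1 h2]; split=> M.
  by move=> M0 MA; apply: approx_order_scale => //; exact: h1.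
move=> AM h; apply: (h2 M AM).
have := approx_order_scale (r := t^-1) (irrational_point_scale irr t0) _ h.
by rewrite invr_eq0 !mulKf // => /(_ t0).
Qed.

Lemma level_setP (v : 'rV[R]_2) A : 1 < A -> irrational_point (v 0 0) (v 0 1) ->
  level_set n A (line v) <-> flat_exponents N (v 0 0) (v 0 1) (A - 1).
Proof.
move=> A1 irr; have nv := norm_vec_gt0 irr; rewrite vecE in nv.
have [n0 nsep nZ nD] := norm_n.
have key t : t != 0 -> n (t *: v) = 1 ->
    (flatness n (t *: v) = A%:E <-> flat_exponents N (t * v 0 0) (t * v 0 1) (A
      - 1)).
  move=> t0 nt; rewrite -[t *: v]vecE.
  have -> : (t *: v) 0 0 = t * v 0 0 by rewrite mxE.
  have -> : (t *: v) 0 1 = t * v 0 1 by rewrite mxE.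
  apply: (flatness_exponents norm_n mn) => //;
    first exact: irrational_point_scale.
  by rewrite vecZ vecE.
split.
  move=> [_ h]; have t0 : (n v)^-1 != 0 by rewrite invr_eq0 gt_eqF.
  have n1 : n ((n v)^-1 *: v) = 1 by rewrite nZ gtr0_norm ?invr_gt0 // mulVf //
    gt_eqF.
  have /(key _ t0 n1) := h ((n v)^-1 *: v) ltac:(by exists (n v)^-1) n1.
  move=> /(flat_exponents_scale (irrational_point_scale irr t0) (t := n v)).
  by rewrite !mulVKf ?gt_eqF // => /(_ isT).
move=> h; split; first exact/line_irrational.
move=> p [t _ <-] nt; have t0 : t != 0.
  by apply/eqP => t0; move: nt; rewrite t0 nZ normr0 mul0r => /esym/eqP;
    rewrite oner_eq0.
by apply/(key _ t0 nt); exact: flat_exponents_scale.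
Qed.

Lemma line_scale t (v : 'rV[R]_2) : t != 0 -> line (t *: v) = line v.
Proof.
move=> t0; apply/seteqP; split => _ [s _ <-].
  by exists (s * t) => //; rewrite scalerA.
by exists (s / t) => //; rewrite scalerA divfK.
Qed.

(** Any irrational line lies in narrow cones over Farey pairs, and [construction] places a direction
    of flatness A in each of them. *)
Lemma level_set_dense A : 1 < A -> dense_in_irrationals (level_set n A).
Proof.
move=> A1 U [UP1 Uop] [b [Ub irrb]].
have [[v /= v0 vb] _] := irrb.
have irr : irrational_point (v 0 0) (v 0 1) by apply/line_irrational;
  rewrite vb.
have [v10 v20] := irrational_coord irr.
have : [set v : 'rV[R]_2 | v != 0 /\ U (line v)] v by rewrite /= vb.
move: Uop; rewrite openE => /[apply];
  rewrite /interior => /nbhs_ballP[e /= e0 he].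
set v1 := v 0 0 in irr v10; set v2 := v 0 1 in irr v20.
have nv1 : 0 < `|v1| by rewrite normr_gt0.
(* Rescaled to first coordinate v1, the constructed point differs from v by at most 1 / (m |v1|)
   with m >= K, hence by at most e / 2. *)
pose K := Num.max 1 (2 / (e * `|v1|)).
have K1 : 1 <= K by rewrite /K le_max lexx.
have lv : v1^-1 * v1 + 0 * v2 = 1 by rewrite mul0r addr0 mulVf.
have [u1 [u2 [w1 [w2 enc]]]] := enclosing_large K irr lv (expr1n _ 2).
have K0 : 0 < K by apply: lt_le_trans K1.
have det := enclosing_det lv (expr1n _ 2) K0 enc.
have [g Xu Xw mu mw] := enc.
have E0 : 0 < A - 1 by rewrite subr_gt0.
have Ndef x y : n (vec x y) = 0 -> x = 0 /\ y = 0.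
  have [_ nsep _ _] := norm_n.
  move=> /nsep h; have h1 := congr1 (fun M : 'rV[R]_2 => M 0 0) h.
  have h2 := congr1 (fun M : 'rV[R]_2 => M 0 1) h.
  by rewrite /= vec0 mxE in h1; rewrite /= vec1 mxE in h2.
have [r [p1 [p2 [[r0 r1] p1E p2E irrp fe]]]] := construction mn Ndef E0 g.
have fl : level_set n A (line (vec p1 p2)).
  by apply/level_setP => //; rewrite vec0 vec1.
exists (line (vec p1 p2)); split=> //.
rewrite !mul1r !mul0r !addr0 in det Xu Xw mu mw.
set a := v1^-1 * u1%:~R in mu det; set b' := v1^-1 * w1%:~R in mw det.
set x := v1 * u2%:~R - v2 * u1%:~R in Xu det;
  set y := v1 * w2%:~R - v2 * w1%:~R in Xw det.
have m0 : K <= v1^-1 * p1.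
  rewrite p1E (_ : v1^-1 * _ = (1 - r) * a + r * b'); last by rewrite /a /b';
    ring.
  have q1 : (1 - r) * K <= (1 - r) * a by rewrite ler_wpM2l // subr_ge0.
  have q2 : r * K <= r * b' by rewrite ler_wpM2l.
  by lra.
set m := v1^-1 * p1 in m0.
have mp : 0 < m by apply: lt_le_trans m0.
have mn0 : m != 0 by rewrite gt_eqF.
rewrite -(line_scale (t := m^-1)) ?invr_eq0 // -vecZ.
have yK : y * K <= 1.
  have h1 : y * K <= a * y by rewrite mulrC ler_pM2r.
  have h2 : 0 <= - x * b' by rewrite mulr_ge0 ?oppr_ge0 ?(ltW Xu) //
    (le_trans (ltW K0)).
  by lra.
have xK : - x * K <= 1.
  have h1 : - x * K <= - x * b' by rewrite ler_pM2l // oppr_gt0.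
  have h2 : 0 <= a * y by rewrite mulr_ge0 ?(ltW Xw) // (le_trans (ltW K0)).
  by lra.
have c1 : m^-1 * p1 = v1 by rewrite /m; field; rewrite v10 /=;
  apply: contra mn0 => /eqP z; rewrite /m z mulr0.
have c2 : m^-1 * p2 - v2 = ((1 - r) * x + r * y) / (m * v1).
  apply: (mulIf mn0); rewrite mulrBl mulrAC mulVf // mul1r.
  rewrite (_ : _ / (m * v1) * m = ((1 - r) * x + r * y) / v1); last by field;
    rewrite v10 mn0.
  by rewrite /m p1E p2E /x /y; field.
apply: (he (vec (m^-1 * p1) (m^-1 * p2)) _).2.
have close : `|m^-1 * p2 - v2| < e.
  rewrite c2 normf_div normrM (gtr0_norm mp) ltr_pdivrMr;
    last exact: mulr_gt0 mp nv1.
  have xy : `|(1 - r) * x + r * y| * K <= 1.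
    rewrite -(gtr0_norm K0) -normrM ler_norml; apply/andP; split.
      have q1 : (1 - r) * (- x * K) <= (1 - r) * 1 by rewrite ler_wpM2l //
        subr_ge0.
      have q2 : 0 <= r * (y * K) by rewrite !mulr_ge0 // ltW.
      by lra.
    have q1 : r * (y * K) <= r * 1 by rewrite ler_wpM2l.
    have q2 : 0 <= (1 - r) * (- x * K) by rewrite !mulr_ge0 ?subr_ge0 ?oppr_ge0
      // ltW.
    by lra.
  have xy1 : `|(1 - r) * x + r * y| <= 1.
    by apply: le_trans xy; rewrite ler_peMr.
  have ek : 2 <= e * `|v1| * K.
    rewrite mulrC -ler_pdivrMr ?mulr_gt0 //; by rewrite /K le_max lexx orbT.
  have em : e * `|v1| * K <= e * (m * `|v1|).
    rewrite (_ : e * (m * `|v1|) = e * `|v1| * m); last by ring.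
    by rewrite ler_pM2l // mulr_gt0.
  by lra.
split=> // i j; rewrite /ball /= c1 mxE; case: ifP => [/eqP ->|j0].
  by rewrite (_ : i = 0) ?ord1 // -/v1 subrr normr0.
rewrite (_ : i = 0) ?ord1 // (_ : j = 1).
  by rewrite -/v2 distrC.
by case: j j0 => -[|[|//]] h // _; apply/val_inj.
Qed.

End Density.

(** * Proportionality from a dense set of lines *)

Section Proportional.
Variable R : realType.
Implicit Types (n : 'rV[R]_2 -> R).

Lemma norm_close n (v w : 'rV[R]_2) d : is_norm n ->
  (forall j, `|v 0 j - w 0 j| <= d) ->
  `|n v - n w| <= d * (n (vec 1 0) + n (vec 0 1)).
Proof.
move=> [n0 _ nZ nD] h.
have one (a b : 'rV[R]_2) : (forall j, `|a 0 j - b 0 j| <= d) ->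
    n a <= n b + d * (n (vec 1 0) + n (vec 0 1)).
  move=> hab; have -> : a = b + ((a 0 0 - b 0 0) *: vec 1 0 + (a 0 1 - b 0 1)
    *: vec 0 1).
    rewrite -[LHS]vecE -[X in X + _]vecE -!vecZ -!vecD.
    by congr vec; rewrite ?mulr1 ?mulr0; ring.
  apply: le_trans (nD _ _) _; rewrite lerD2l; apply: le_trans (nD _ _) _.
  by rewrite !nZ mulrDr lerD // ler_wpM2r.
have h' j : `|w 0 j - v 0 j| <= d by rewrite distrC.
have := one v w h; have := one w v h'.
by rewrite ler_norml => h1 h2; apply/andP; split; lra.
Qed.

(** Rational translates of an irrational slope are irrational, and they are dense. *)
Lemma irrational_in_interval (rho a b : R) :
  (forall w1 w2 : int, (w1, w2) != (0,
    0) -> w2%:~R - rho * w1%:~R != 0) -> a < b ->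
  exists2 s, a < s /\ s < b &
    forall w1 w2 : int, (w1, w2) != (0, 0) -> w2%:~R - s * w1%:~R != 0.
Proof.
move=> irr ab; have : a - rho < b - rho by rewrite ltrD2r.
move=> /rat_in_itvoo[q]; rewrite in_itv /= => /andP[q1 q2].
exists (ratr q + rho); first by split; lra.
move=> w1 w2 w0; apply/eqP => z.
have dn0 : (denq q)%:~R != 0 :> R by rewrite intr_eq0 denq_eq0.
have qE : ratr q = (numq q)%:~R / (denq q)%:~R :> R by [].
have := irr (denq q * w1) (denq q * w2 - numq q * w1).
rewrite rmorphB !rmorphM /= => h;
  suff : (denq q * w1, denq q * w2 - numq q * w1) != (0, 0).
  move=> /h/eqP; apply.
  transitivity ((denq q)%:~R * (w2%:~R - (ratr q + rho) * w1%:~R) : R);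
    last by rewrite z mulr0.
  by rewrite qE; field.
apply: contra w0 => /eqP[/eqP]; rewrite mulf_eq0 denq_eq0 /= => /eqP ->.
by rewrite mulr0 subr0 => /eqP; rewrite mulf_eq0 denq_eq0 /= => /eqP ->.
Qed.

(* If two norms are not proportional, they differ on an open set of lines,
   which contains an irrational one. *)
Lemma proportional_of_dense n1 n2 (c : R) (D : set (set 'rV[R]_2)) :
  is_norm n1 -> is_norm n2 ->
  (exists p1 p2 : R, irrational_point p1 p2) ->
  dense_in_irrationals D ->
  (forall v : 'rV[R]_2, D (line v) -> n1 v = c * n2 v) ->
  forall v, n1 v = c * n2 v.
Proof.
move=> hn1 hn2 [p1 [p2 irrp]] dense eqD.
pose G := [set v | n1 v != c * n2 v].
pose U := [set b | exists v : 'rV[R]_2, [/\ v != 0,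
  b = line v & n1 v != c * n2 v]].
have norm0 n : is_norm n -> n 0 = 0.
  by move=> [_ _ nZ _]; rewrite -(scale0r 0) nZ normr0 mul0r.
have G0 v : G v -> v != 0.
  by apply: contra => /eqP ->; rewrite !norm0 // mulr0.
have UG : [set v : 'rV[R]_2 | v != 0 /\ U (line v)] = G.
  apply/seteqP; split => v /=; last by move=> Gv; split; [exact: G0|exists v;
    split=> //; exact: G0].
  move=> [v0 [w [w0 vw nw]]].
  have [t _ wt] : line w v by rewrite -vw; exists 1 => //; rewrite scale1r.
  have [_ _ nZ1 _] := hn1; have [_ _ nZ2 _] := hn2.
  rewrite /G /= -wt nZ1 nZ2 mulrCA; apply: contra nw => /eqP h.
  have t0 : `|t| != 0 by rewrite normr_eq0; apply: contra v0 => /eqP z;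
    rewrite -wt z scale0r.
  by apply/eqP; exact: mulfI t0 _ _ h.
(* A Lipschitz constant of n1 - c n2 for the maximum norm, increased by 1 to be positive. *)
pose k := n1 (vec 1 0) + n1 (vec 0 1) + `|c| * (n2 (vec 1 0) + n2 (vec 0 1)) +
  1.
have k0 : 0 < k.
  have [[a0 _ _ _] [b0 _ _ _]] := (hn1, hn2).
  by rewrite ltr_wpDl // !addr_ge0 // mulr_ge0 // addr_ge0.
have Gnear v : G v -> exists2 e : R, 0 < e & forall w : 'rV[R]_2, (forall j,
  `|v 0 j - w 0 j| <= e) -> G w.
  move=> Gv; have d0 : 0 < `|n1 v - c * n2 v| by rewrite normr_gt0 subr_eq0.
  exists (`|n1 v - c * n2 v| / (2 * k)); first by rewrite divr_gt0 ?mulr_gt0.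
  move=> w hw; have h1 := norm_close hn1 hw; have h2 := norm_close hn2 hw.
  apply/eqP => eqw; set e := _ / (2 * k) in h1 h2.
  have e0 : 0 < e by rewrite divr_gt0 ?mulr_gt0.
  have ek : e * k = `|n1 v - c * n2 v| / 2 by rewrite /e; field; rewrite gt_eqF.
  have : `|n1 v - c * n2 v| <= e * k.
    rewrite (_ : n1 v - c * n2 v = (n1 v - n1 w) - c * (n2 v - n2 w));
      last by rewrite eqw; ring.
    apply: le_trans (ler_normB _ _) _; rewrite normrM.
    have h3 : `|c| * `|n2 v - n2 w| <= `|c| * (e * (n2 (vec 1 0) + n2 (vec 0
      1))).
      by rewrite ler_wpM2l.
    by rewrite /k; lra.
  by rewrite ek; lra.
have Uopen : P1_open U.
  split; first by move=> _ [v [v0 -> _]]; exists v.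
  rewrite UG openE => v /Gnear[e e0 he]; apply/nbhs_ballP;
    exists e => // w [_ hw].
  by apply: he => j; apply/ltW; exact: hw.
move=> v; apply/eqP; apply/negPn/negP => Gv.
have [p10 p20] := irrational_coord irrp.
have irrho (w1 w2 : int) : (w1, w2) != (0, 0) -> w2%:~R - p2 / p1 * w1%:~R != 0.
  move=> /irrp h; apply: contra h => /eqP z.
  rewrite (_ : _ - _ = p1 * (w2%:~R - p2 / p1 * w1%:~R)); last by field.
  by rewrite z mulr0.
have [e e0 he] := Gnear v Gv.
have [w irrw Gw] : exists2 w : 'rV[R]_2, irrational_point (w 0 0) (w 0 1) & G w.
  (* The slope of v is moved to a nearby irrational one; on the vertical axis the inverse slope is
     used. *)
  have [v00|v00] := eqVneq (v 0 0) 0.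
    have v01 : v 0 1 != 0.
      apply: contra (G0 _ Gv) => /eqP v01.
      by rewrite -[v]vecE v00 v01 -(scale0r (vec 0 0)) -vecZ !mul0r.
    have ne : 0 < e / `|v 0 1| by rewrite divr_gt0 // normr_gt0.
    have [s [s1 s2] irrs] := irrational_in_interval irrho ne.
    exists (vec (s * v 0 1) (v 0 1)).
      move=> w1 w2 w0; rewrite vec0 vec1.
      rewrite (_ : _ - _ = - (v 0 1) * (w1%:~R - s * w2%:~R)); last by ring.
      rewrite mulf_neq0 ?oppr_eq0 // irrs //.
      by apply: contra w0 => /eqP[-> ->].
    apply: he => j; rewrite mxE; case: ifP => [/eqP ->|j0].
      rewrite v00 sub0r normrN normrM gtr0_norm //.
      by rewrite ltr_pdivlMr ?normr_gt0 // in s2; exact: ltW.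
    rewrite (_ : j = 1) ?subrr ?normr0 ?ltW //.
    by case: j j0 => -[|[|//]] h // _; apply/val_inj.
  have ne : v 0 1 / v 0 0 < v 0 1 / v 0 0 + e / `|v 0 0|.
    by rewrite ltrDl divr_gt0 // normr_gt0.
  have [s [s1 s2] irrs] := irrational_in_interval irrho ne.
  exists (vec (v 0 0) (s * v 0 0)).
    move=> w1 w2 w0; rewrite vec0 vec1.
    rewrite (_ : _ - _ = v 0 0 * (w2%:~R - s * w1%:~R)); last by ring.
    by rewrite mulf_neq0 // irrs.
  apply: he => j; rewrite mxE; case: ifP => [/eqP ->|j0];
    first by rewrite subrr normr0 ltW.
  rewrite (_ : j = 1); last by case: j j0 => -[|[|//]] h // _; apply/val_inj.
  have nv : 0 < `|v 0 0| by rewrite normr_gt0.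
  rewrite (_ : v 0 1 - _ = - (s - v 0 1 / v 0 0) * v 0 0); last by field.
  have d0 : 0 < s - v 0 1 / v 0 0 by rewrite subr_gt0.
  have d1 : s - v 0 1 / v 0 0 < e / `|v 0 0| by rewrite ltrBlDl.
  rewrite ltr_pdivlMr // in d1.
  by rewrite normrM normrN (gtr0_norm d0) ltW.
have Uw : U (line w) by exists w; split=> //; exact: G0.
have irw : irrationals (line w) by exact/line_irrational.
have [b [Ub Db]] := dense U Uopen (ex_intro _ _ (conj Uw irw)).
have [x [x0 bx nx]] := Ub.
by move: nx; rewrite (eqD x) ?eqxx // -bx.
Qed.

End Proportional.

Theorem corollary1p4 (R : realType) :
  (forall (A B : R) (X Y : marked_torus R) (nX nY : 'rV[R]_2 -> R),
     1 < A -> 1 < B ->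
     is_mcshane_rivin_norm X nX -> is_mcshane_rivin_norm Y nY ->
     dense_in_irrationals (level_set nX A `&` level_set nY B) ->
     [/\ A = B, nX = nY & teich_eq X Y])
  /\
  (forall (A : R) (X Y : marked_torus R) (nX nY : 'rV[R]_2 -> R),
     1 < A ->
     is_mcshane_rivin_norm X nX -> is_mcshane_rivin_norm Y nY ->
     level_set nX A = level_set nY A ->
     teich_eq X Y).
Proof.
have main (A B : R) (X Y : marked_torus R) (nX nY : 'rV[R]_2 -> R) :
     1 < A -> 1 < B ->
     is_mcshane_rivin_norm X nX -> is_mcshane_rivin_norm Y nY ->
     dense_in_irrationals (level_set nX A `&` level_set nY B) ->
     [/\ A = B, nX = nY & teich_eq X Y].
  move=> A1 B1 hX hY dense.
  have [mX trX] := mcshane_rivin_markov hX;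
    have [mY trY] := mcshane_rivin_markov hY.
  have [[normX _] [normY _]] := (hX, hY).
  have [A0 B0] : 0 < A - 1 /\ 0 < B - 1 by rewrite !subr_gt0.
  have NdefX x y : nX (vec x y) = 0 -> x = 0 /\ y = 0.
    have [_ nsep _ _] := normX.
    move=> /nsep h; have h1 := congr1 (fun M : 'rV[R]_2 => M 0 0) h.
    have h2 := congr1 (fun M : 'rV[R]_2 => M 0 1) h.
    by rewrite /= vec0 mxE in h1; rewrite /= vec1 mxE in h2.
  (* This supplies an irrational point; the exponent 1 is an arbitrary choice. *)
  have [r [p1 [p2 [_ _ _ irrp _]]]] := construction mX NdefX ltr01 good_base.
  pose c := (A - 1) / (B - 1).
  have c0 : 0 < c by rewrite divr_gt0.
  have prop : forall v, nX v = c * nY v.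
    apply: (proportional_of_dense normX normY _ dense); first by exists p1, p2.
    move=> v [lX lY]; have irr := (line_irrational v).2 lX.1.
    have eX := (level_setP normX mX A1 irr).1 lX.
    have eY := (level_setP normY mY B1 irr).1 lY.
    have h1 := flat_exponents_ratio mX mY irr A0 B0 eX eY.
    have h2 := flat_exponents_ratio mY mX irr B0 A0 eY eX.
    rewrite !vecE in h1 h2; apply: (mulfI (x := B - 1));
      first by rewrite gt_eqF.
    rewrite /c mulrA mulrCA divff ?gt_eqF // mulr1.
    by apply/eqP; rewrite eq_le h1 h2.
  (* The relation is symmetric, so [proportional_ge1] applies to c and to its inverse. *)
  have c1 : c = 1.
    apply/eqP; rewrite eq_le; apply/andP; split; last first.
      by apply: (proportional_ge1 mX mY c0) => x y.
    have cV : 0 < c^-1 by rewrite invr_gt0.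
    rewrite -invr_ge1 ?posrE //; last by rewrite unitfE gt_eqF.
    apply: (proportional_ge1 mY mX cV) => x y;
      rewrite prop mulrA mulVf ?mul1r //.
    by rewrite gt_eqF.
  have nXY : nX = nY by apply/funext => v; rewrite prop c1 mul1r.
  split=> //.
    have := congr1 (fun x => x * (B - 1)) c1.
    by rewrite /c divfK ?gt_eqF // mul1r => /addIr.
  have tr U V (h : nielsen U V) : `|\tr (holonomy X U)| = `|\tr (holonomy Y U)|.
    by rewrite -(trX U V h) -(trY U V h) nXY.
  apply: teich_eq_traces; first exact: tr nielsen_base.
    exact: tr (nielsen_swap nielsen_base).
  exact: tr (nielsen_swap (nielsen_mul nielsen_base)).
split=> // A X Y nX nY A1 hX hY eqL.
have [normX _] := hX; have [mX _] := mcshane_rivin_markov hX.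
have [//|_ _ //] := main A A X Y nX nY A1 A1 hX hY.
by rewrite -eqL setIid; exact: (level_set_dense normX mX A1).
Qed.
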